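(* Assume $N\ge3$ and $\frac{N}{N-2}<p<\frac{N+2}{N-2}$. If $\overline M\le M<0$ there exists no ground state of (E). Moreover there exists a positive solution $u$ of (E) on $(0,\infty)$, unique up to the similarity transformations $u\mapsto k^{\frac{2}{p-1}}u(k\,\cdot)$, $k>0$, satisfying $u(r)\sim U_M(r)$ as $r\to0$ and $u(r)\sim cr^{2-N}$ for some $c>0$ as $r\to\infty$.
   Context: (E) denotes the ODE $-u_{rr}-\frac{N-1}{r}u_r=|u|^{p-1}u+M|u_r|^{\frac{2p}{p+1}}$ for $r>0$. A ground state is a nonnegative $u\in C^2([0,\infty))$ with $u_r(0)=0$ solving (E) on $(0,\infty)$. Let $K=\frac{(N-2)p-N}{p-1}$; for $M<0$, $X_M$ is the unique positive root of $X^{p-1}+M\left(\frac{2}{p-1}\right)^{\frac{2p}{p+1}}X^{\frac{p-1}{p+1}}-\frac{2K}{p-1}=0$ and $U_M(r)=X_Mr^{-\frac{2}{p-1}}$. $\overline M=\frac{(p+1)((N-2)p-N-2)}{(4p)^{\frac{p}{p+1}}((N-2)(p-1)^2+4)^{\frac{1}{p+1}}}$, which is negative here. $f\sim g$ means $f/g\to1$.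
   Formalization: ''Ground state'' is taken to mean a nonnegative solution that is not identically zero, since the zero function satisfies the definition as given and would make the non-existence claim false. *)

(* Defs.v *)
From Stdlib Require Import Reals Lra ClassicalEpsilon.
From Coquelicot Require Import Coquelicot.
Open Scope R_scope.

(* Real power x^a for x >= 0 and a > 0, with the convention 0^a = 0
   (Stdlib's Rpower 0 a = 1, which is wrong here). *)
Definition powa (x a : R) : R := if Rle_dec x 0 then 0 else Rpower x a.

Definition solves_E (N : nat) (p M : R) (u : R -> R) : Prop :=
  exists u1 u2 : R -> R,
    forall r, 0 < r ->
      is_derive u r (u1 r) /\ is_derive u1 r (u2 r) /\
      - u2 r - (INR N - 1) / r * u1 r
        = powa (Rabs (u r)) (p - 1) * u r + M * powa (Rabs (u1 r)) (2 * p / (p + 1)).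

Definition ground_state (N : nat) (p M : R) (u : R -> R) : Prop :=
  (forall r, 0 <= r -> 0 <= u r) /\
  (exists r, 0 <= r /\ u r <> 0) /\
  exists u1 u2 : R -> R,
    (forall r, 0 < r -> is_derive u r (u1 r) /\ is_derive u1 r (u2 r)) /\
    filterlim (fun h => (u h - u 0) / h) (at_right 0) (locally (u1 0)) /\
    filterlim (fun h => (u1 h - u1 0) / h) (at_right 0) (locally (u2 0)) /\
    (forall r, 0 < r -> continuous u2 r) /\
    filterlim u2 (at_right 0) (locally (u2 0)) /\
    u1 0 = 0 /\
    (forall r, 0 < r ->
      - u2 r - (INR N - 1) / r * u1 r
        = powa (Rabs (u r)) (p - 1) * u r + M * powa (Rabs (u1 r)) (2 * p / (p + 1))).

Definition Kc (N : nat) (p : R) : R := ((INR N - 2) * p - INR N) / (p - 1).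

Definition FX (N : nat) (p M X : R) : R :=
  powa X (p - 1) + M * Rpower (2 / (p - 1)) (2 * p / (p + 1)) * powa X ((p - 1) / (p + 1))
  - 2 * Kc N p / (p - 1).

(* X_M : the (unique) positive root of FX (chosen by Hilbert's epsilon). *)
Definition XM (N : nat) (p M : R) : R :=
  epsilon (inhabits 0) (fun X => 0 < X /\ FX N p M X = 0).

Definition UM (N : nat) (p M r : R) : R := XM N p M * Rpower r (- (2 / (p - 1))).

Definition Mbar (N : nat) (p : R) : R :=
  (p + 1) * ((INR N - 2) * p - INR N - 2)
  / (Rpower (4 * p) (p / (p + 1))
     * Rpower ((INR N - 2) * (p - 1) ^ 2 + 4) (1 / (p + 1))).

Definition equiv_at_0 (f g : R -> R) : Prop :=
  filterlim (fun r => f r / g r) (at_right 0) (locally 1).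
Definition equiv_at_infty (f g : R -> R) : Prop :=
  filterlim (fun r => f r / g r) (Rbar_locally p_infty) (locally 1).

Definition good_solution (N : nat) (p M : R) (u : R -> R) : Prop :=
  (forall r, 0 < r -> 0 < u r) /\ solves_E N p M u /\
  equiv_at_0 u (UM N p M) /\
  exists c, 0 < c /\ equiv_at_infty u (fun r => c * Rpower r (2 - INR N)).

(* Main.v *)
Require Import Defs.
From Stdlib Require Import Reals Lra Lia ClassicalEpsilon.
From Coquelicot Require Import Coquelicot.
Open Scope R_scope.

(* Put n = N - 2, al = 2/(p-1), q = 2p/(p+1), m = -M, t = ln r, X = r^al u and s = - r u'/u.
   Then (E) is the autonomous system
     X' = X (al - s),   s' = s^2 - n s + X^(p-1) - m s^q X^(q-1),
   a ground state is a trajectory leaving the origin with s -> 0, and the solution sought is the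
   trajectory entering the origin with s -> n and leaving the stationary point X = X_M, s = al.
   In the plane (X, Y = s X) the function X^(-a) Y^b is a Dulac function for suitable a, b > 0:
   up to a positive factor the divergence is a s + b X^(p-1)/s - m (b+q) (X s)^(q-1), which is
   nonnegative by the weighted arithmetic-geometric inequality exactly when m <= |Mbar|.
   Integrating it gives a Lyapunov function V with V' = X^g (al - s) (J(X,al) - J(X,s)) >= 0, J
   increasing in s.  V vanishes at the origin and is negative at the stationary point.  Along a
   ground state V stays above a positive constant, which keeps the trajectory in a compact set,
   where it would have to converge to the stationary point: a contradiction.  Along the stable
   trajectory of the origin V < 0, so going backwards it stays in a compact set and converges to
   the stationary point. *)

(** Origin of V. In the coordinates x = ln X, l = ln s take the weight w = X^g s^(b+1). The choice g
    al = n (b+1) removes the constant term, so the weighted field has divergence w D, and J is the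
    integral of s^(b+1) D in l. The form w (l' dx - x' dl) is not closed, but adding X^g (J(X,al) -
    J(X,s)) dx makes it closed, and V is its primitive. Using J(X,al) as constant of integration is
    what gives V' the same sign on both sides of s = al.

    The obstacle is the origin. Since q - 1 < 1, the term s^q X^(q-1) is not Lipschitz at X = 0, and
    the usual stable manifold theorem does not apply. Existence of the stable trajectory is obtained
    instead from an integral equation in a power of r in which the gradient term becomes regular;
    its uniqueness comes from an invariant cone in logarithmic coordinates. The integral equation is
    solved globally with truncated powers, so the truncation level has to be fixed before the
    solution is known. This is possible because the bounds on the region V < 0 do not involve that
    level. *)

Lemma is_derive_continuity_pt (f : R -> R) (x l : R) :
  is_derive f x l -> continuity_pt f x.
Proof.
  intros H. apply continuity_pt_filterlim.
  apply (ex_derive_continuous (V := R_NormedModule)). now exists l.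
Qed.

Lemma mean_value (f df : R -> R) (a b : R) :
  a <= b -> (forall x, a <= x <= b -> is_derive f x (df x)) ->
  exists c, a <= c <= b /\ f b - f a = df c * (b - a).
Proof.
  intros Hab H.
  destruct (MVT_gen f a b df) as [c [Hc E]];
    rewrite ?Rmin_left, ?Rmax_right in * by lra.
  - intros x Hx. apply H. lra.
  - intros x Hx. eapply is_derive_continuity_pt, H, Hx.
  - now exists c.
Qed.

Lemma nondecreasing_of_derive (f df : R -> R) (a b : R) :
  a <= b -> (forall x, a <= x <= b -> is_derive f x (df x)) ->
  (forall x, a <= x <= b -> 0 <= df x) -> f a <= f b.
Proof.
  intros Hab H H0. destruct (mean_value f df a b Hab H) as [c [Hc E]].
  specialize (H0 c Hc). nra.
Qed.

Lemma nonincreasing_of_derive (f df : R -> R) (a b : R) :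
  a <= b -> (forall x, a <= x <= b -> is_derive f x (df x)) ->
  (forall x, a <= x <= b -> df x <= 0) -> f b <= f a.
Proof.
  intros Hab H H0. destruct (mean_value f df a b Hab H) as [c [Hc E]].
  specialize (H0 c Hc). nra.
Qed.

(** The supremum of the initial segments on which [P] holds can be neither a last good point nor a
    first bad one. It carries the continuation arguments, in which reaching an endpoint and passing
    beyond it have different reasons. *)
Lemma real_induction (P : R -> Prop) (a : R) :
  P a ->
  (forall T, a <= T -> (forall z, a <= z <= T -> P z) ->
     exists d, 0 < d /\ forall z, T < z < T + d -> P z) ->
  (forall T, a < T -> (forall z, a <= z < T -> P z) -> P T) ->
  forall z, a <= z -> P z.
Proof.
  intros Ha Hopen Hclosed z0 Hz0.
  destruct (excluded_middle_informative (P z0)) as [|Hn]; [assumption|exfalso].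
  set (E := fun T => a <= T /\ forall z, a <= z <= T -> P z).
  assert (Ea : E a).
  { split; [lra|]. intros z Hz. now replace z with a by lra. }
  assert (Eb : forall T, E T -> T <= z0).
  { intros T [HT HP]. destruct (Rle_lt_dec T z0) as [|HTz]; [assumption|].
    exfalso. apply Hn, HP. lra. }
  destruct (completeness E) as [S [Sub Slub]].
  { exists z0. exact Eb. }
  { now exists a. }
  assert (HaS : a <= S) by now apply Sub.
  assert (Hlt : forall z, a <= z < S -> P z).
  { intros z Hz. destruct (excluded_middle_informative (P z)) as [|Hnz]; [assumption|exfalso].
    assert (S <= z); [|lra]. apply Slub. intros T [HT HP].
    destruct (Rle_lt_dec T z) as [|HTz]; [assumption|]. exfalso. apply Hnz, HP. lra. }
  assert (HS : P S).
  { destruct (Rle_lt_or_eq_dec a S HaS) as [H|<-]; [|assumption].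
    now apply Hclosed. }
  destruct (Hopen S HaS) as [d [Hd Hd']].
  { intros z Hz. destruct (Rle_lt_or_eq_dec z S) as [H| ->]; [lra| |assumption].
    apply Hlt. lra. }
  assert (S + d / 2 <= S); [|lra].
  apply Sub. split; [lra|]. intros z Hz.
  destruct (Rtotal_order z S) as [H|[->|H]]; [apply Hlt; lra|assumption|apply Hd'; lra].
Qed.

Lemma continuity_pt_lt (f : R -> R) (x b : R) :
  continuity_pt f x -> f x < b -> exists d, 0 < d /\ forall z, Rabs (z - x) < d -> f z < b.
Proof.
  intros Hc Hb.
  pose proof (proj1 (continuity_pt_locally f x) Hc) as Hc0.
  destruct (Hc0 (mkposreal (b - f x) ltac:(lra))) as [d Hd].
  exists d. split; [apply cond_pos|]. intros z Hz. specialize (Hd z Hz).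
  simpl in Hd. apply Rabs_def2 in Hd. lra.
Qed.

Lemma continuity_pt_gt (f : R -> R) (x b : R) :
  continuity_pt f x -> b < f x -> exists d, 0 < d /\ forall z, Rabs (z - x) < d -> b < f z.
Proof.
  intros Hc Hb.
  destruct (continuity_pt_lt (fun z => - f z) x (- b)) as [d [Hd H]].
  - now apply continuity_pt_opp.
  - lra.
  - exists d. split; [assumption|]. intros z Hz. specialize (H z Hz). simpl in H. lra.
Qed.

Lemma derive_pos_left (f : R -> R) (x l : R) :
  is_derive f x l -> 0 < l -> exists d, 0 < d /\ forall z, x - d < z < x -> f z < f x.
Proof.
  intros H Hl. apply is_derive_Reals in H.
  destruct (H l Hl) as [d Hd].
  exists d. split; [apply cond_pos|]. intros z Hz.
  specialize (Hd (z - x)). replace (x + (z - x)) with z in Hd by ring.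
  assert (Hne : z - x <> 0) by lra.
  assert (Hab : Rabs (z - x) < d) by (apply Rabs_def1; lra).
  specialize (Hd Hne Hab). apply Rabs_def2 in Hd.
  assert (E : f z - f x = (f z - f x) / (z - x) * (z - x)) by (field; lra).
  nra.
Qed.

Lemma barrier (f df : R -> R) (a b : R) :
  b < f a -> (forall x, a <= x -> is_derive f x (df x)) ->
  (forall x, a <= x -> f x = b -> 0 < df x) ->
  forall x, a <= x -> b < f x.
Proof.
  intros Ha Hd Hb. apply real_induction.
  - assumption.
  - intros T HT HP. destruct (continuity_pt_gt f T b) as [d [Hd0 H]].
    + eapply is_derive_continuity_pt, Hd, HT.
    + apply HP. lra.
    + exists d. split; [assumption|]. intros z Hz. apply H. apply Rabs_def1; lra.
  - intros T HT HP. destruct (Rtotal_order (f T) b) as [H|[H|H]]; [exfalso|exfalso|assumption].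
    + destruct (continuity_pt_lt f T b) as [d [Hd0 Hlt]]; [eapply is_derive_continuity_pt, Hd; lra|assumption|].
      (* The witness lies in [a, T) at distance less than [d] from [T], whichever argument the
         maximum selects. *)
      assert (Hm : a <= Rmax a (T - d / 2) < T) by (unfold Rmax; destruct Rle_dec; lra).
      specialize (HP _ Hm). specialize (Hlt (Rmax a (T - d / 2))).
      assert (f (Rmax a (T - d / 2)) < b); [|lra].
      apply Hlt. apply Rabs_def1; [|unfold Rmax; destruct Rle_dec]; lra.
    + destruct (derive_pos_left f T (df T)) as [d [Hd0 Hlt]]; [apply Hd; lra|apply Hb; lra|].
      assert (Hm : a <= Rmax a (T - d / 2) < T) by (unfold Rmax; destruct Rle_dec; lra).
      specialize (HP _ Hm). specialize (Hlt (Rmax a (T - d / 2))).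
      assert (f (Rmax a (T - d / 2)) < f T); [|lra].
      apply Hlt. unfold Rmax; destruct Rle_dec; lra.
Qed.

Lemma barrier_below (f df : R -> R) (a b : R) :
  f a < b -> (forall x, a <= x -> is_derive f x (df x)) ->
  (forall x, a <= x -> f x = b -> df x < 0) ->
  forall x, a <= x -> f x < b.
Proof.
  intros Ha Hd Hb x Hx.
  assert (- b < - f x); [|lra].
  apply (barrier (fun z => - f z) (fun z => - df z) a (- b)); try lra.
  - intros z Hz. apply (is_derive_opp f z (df z)). now apply Hd.
  - intros z Hz E. specialize (Hb z Hz). lra.
Qed.

(** G exp(-C x) is nonincreasing and G exp(C x) is nondecreasing: the first spreads the zero at [c]
    to the right, the second to the left. *)
Lemma gronwall_zero (G dG : R -> R) (C a b c : R) :
  a <= c <= b -> (forall x, a <= x <= b -> is_derive G x (dG x)) ->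
  (forall x, a <= x <= b -> 0 <= G x) ->
  (forall x, a <= x <= b -> Rabs (dG x) <= C * G x) ->
  G c = 0 -> forall x, a <= x <= b -> G x = 0.
Proof.
  intros Hc Hd Hpos HC H0 x Hx.
  assert (D : forall k z, a <= z <= b ->
            is_derive (fun z => G z * exp (k * z)) z ((dG z + k * G z) * exp (k * z))).
  { intros k z Hz. evar_last.
    - apply (is_derive_mult G (fun z => exp (k * z)) z (dG z) (k * exp (k * z))).
      + now apply Hd.
      + auto_derive; [exact I|ring].
      + intros; apply Rmult_comm.
    - unfold plus, mult; simpl. ring. }
  assert (G x <= 0); [|specialize (Hpos x Hx); lra].
  destruct (Rle_lt_dec c x) as [Hcx|Hcx].
  - assert (G x * exp (- C * x) <= G c * exp (- C * c)).
    { apply (nonincreasing_of_derive (fun z => G z * exp (- C * z))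
               (fun z => (dG z + - C * G z) * exp (- C * z))); [lra| |].
      - intros z Hz. apply D. lra.
      - intros z Hz. specialize (HC z ltac:(lra)). apply Rabs_le_between in HC.
        pose proof (exp_pos (- C * z)). nra. }
    rewrite H0 in H. pose proof (exp_pos (- C * x)). nra.
  - assert (G x * exp (C * x) <= G c * exp (C * c)).
    { apply (nondecreasing_of_derive (fun z => G z * exp (C * z))
               (fun z => (dG z + C * G z) * exp (C * z))); [lra| |].
      - intros z Hz. apply D. lra.
      - intros z Hz. specialize (HC z ltac:(lra)). apply Rabs_le_between in HC.
        pose proof (exp_pos (C * z)). nra. }
    rewrite H0 in H. pose proof (exp_pos (C * x)). nra.
Qed.

Lemma exp_le_compat (x y : R) : x <= y -> exp x <= exp y.
Proof. intros [H| ->]; [left; now apply exp_increasing|apply Rle_refl]. Qed.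

Lemma exp_small (k c e : R) : 0 < k -> 0 <= c -> 0 < e ->
  exists A, forall x, x <= A -> c * exp (k * x) < e.
Proof.
  intros Hk Hc He. exists (ln (e / (c + 1)) / k). intros x Hx.
  assert (exp (k * x) <= e / (c + 1)).
  { rewrite <- (exp_ln (e / (c + 1))) by (apply Rdiv_lt_0_compat; lra).
    apply exp_le_compat. apply Rmult_le_compat_l with (r := k) in Hx; [|lra].
    replace (k * (ln (e / (c + 1)) / k)) with (ln (e / (c + 1))) in Hx by (field; lra). exact Hx. }
  apply Rle_lt_trans with (c * (e / (c + 1))); [now apply Rmult_le_compat_l|].
  apply Rmult_lt_reg_r with (c + 1); [lra|]. field_simplify; lra.
Qed.

(** Let x tend to -oo. It serves for monotone quantities, whose value dominates their values further
    left, where only an exponentially small negative term is left. *)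
Lemma nonneg_of_exp_bound (k c x0 v : R) : 0 < k -> 0 <= c ->
  (forall x, x <= x0 -> - (c * exp (k * x)) <= v) -> 0 <= v.
Proof.
  intros Hk Hc H. apply Rnot_lt_le. intros Hv.
  destruct (exp_small k c (- v) Hk Hc ltac:(lra)) as [A HA].
  specialize (H (Rmin A x0) (Rmin_r _ _)). specialize (HA (Rmin A x0) (Rmin_l _ _)). lra.
Qed.

(** Factor out the exponential of the weighted average [c] and use exp y >= 1 + y; the linear terms
    cancel. The strict form locates the possible zeros of the Dulac divergence. *)
Lemma weighted_amgm_exp (P A B : R) : 0 < P ->
  (P + 1) * exp ((P * A + B) / (P + 1)) <= P * exp A + exp B /\
  (A <> B -> (P + 1) * exp ((P * A + B) / (P + 1)) < P * exp A + exp B).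
Proof.
  intros HP. set (c := (P * A + B) / (P + 1)).
  assert (EA : exp A = exp c * exp (A - c)) by (rewrite <- exp_plus; f_equal; ring).
  assert (EB : exp B = exp c * exp (B - c)) by (rewrite <- exp_plus; f_equal; ring).
  assert (Hc : P * (A - c) + (B - c) = 0) by (unfold c; field; lra).
  pose proof (exp_pos c).
  assert (E : P * exp A + exp B - (P + 1) * exp c
    = exp c * (P * (exp (A - c) - 1 - (A - c)) + (exp (B - c) - 1 - (B - c)))).
  { rewrite EA, EB.
    apply Rminus_diag_uniq. transitivity (exp c * (P * (A - c) + (B - c))); [ring|].
    rewrite Hc. ring. }
  pose proof (exp_ineq1_le (A - c)) as HA. pose proof (exp_ineq1_le (B - c)) as HB.
  split.
  - assert (0 <= P * (exp (A - c) - 1 - (A - c))) by (apply Rmult_le_pos; lra).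
    assert (0 <= exp c * (P * (exp (A - c) - 1 - (A - c)) + (exp (B - c) - 1 - (B - c))))
      by (apply Rmult_le_pos; lra).
    lra.
  - intros Hne. assert (HAc : A - c <> 0).
    { intros E0. rewrite E0, Rmult_0_r in Hc. lra. }
    pose proof (exp_ineq1 _ HAc).
    assert (0 < P * (exp (A - c) - 1 - (A - c))) by (apply Rmult_lt_0_compat; lra).
    assert (0 < exp c * (P * (exp (A - c) - 1 - (A - c)) + (exp (B - c) - 1 - (B - c))))
      by (apply Rmult_lt_0_compat; lra).
    lra.
Qed.

Lemma exp_diff (u v : R) : exists c, Rmin u v <= c <= Rmax u v /\ exp u - exp v = exp c * (u - v).
Proof.
  destruct (MVT_gen exp v u exp) as [c [Hc E]].
  - intros x _. auto_derive; [exact I|ring].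
  - intros x _. apply derivable_continuous_pt, derivable_pt_exp.
  - exists c. rewrite Rmin_comm, Rmax_comm. now split.
Qed.

Lemma exp_lipschitz (M u v : R) : u <= M -> v <= M -> Rabs (exp u - exp v) <= exp M * Rabs (u - v).
Proof.
  intros Hu Hv. destruct (exp_diff u v) as [c [Hc E]]. rewrite E, Rabs_mult.
  rewrite (Rabs_pos_eq (exp c)) by (left; apply exp_pos).
  apply Rmult_le_compat_r; [apply Rabs_pos|]. apply exp_le_compat.
  apply Rle_trans with (Rmax u v); [apply Hc|]. now apply Rmax_lub.
Qed.

Lemma ln_near (e : R) : 0 < e -> forall a, 0 < a -> exists d, 0 < d /\
  forall l, Rabs (exp l - a) < d -> Rabs (l - ln a) < e.
Proof.
  intros He a Ha. exists (Rmin (a - exp (ln a - e)) (exp (ln a + e) - a)).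
  assert (exp (ln a - e) < a) by (rewrite <- (exp_ln a Ha) at 2; apply exp_increasing; lra).
  assert (a < exp (ln a + e)) by (rewrite <- (exp_ln a Ha) at 1; apply exp_increasing; lra).
  split; [apply Rmin_glb_lt; lra|]. intros l Hl.
  pose proof (Rmin_l (a - exp (ln a - e)) (exp (ln a + e) - a)).
  pose proof (Rmin_r (a - exp (ln a - e)) (exp (ln a + e) - a)).
  apply Rabs_def2 in Hl.
  apply Rabs_def1; [assert (l < ln a + e)|assert (ln a - e < l)]; try lra; apply exp_lt_inv; lra.
Qed.

Lemma bounds_at_endpoint (g : R -> R) (a T lo hi : R) : a < T -> continuity_pt g T ->
  (forall z, a <= z < T -> lo <= g z <= hi) -> lo <= g T <= hi.
Proof.
  intros HaT Hg H.
  assert (K : forall d, 0 < d -> exists z, a <= z < T /\ Rabs (z - T) < d).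
  { intros d Hd. exists (Rmax a (T - d / 2)). unfold Rmax. destruct Rle_dec; split; try lra; apply Rabs_def1; lra. }
  split; apply Rnot_lt_le; intros Hlt.
  - destruct (continuity_pt_lt g T lo Hg Hlt) as [d [Hd Hd']]. destruct (K d Hd) as [z [Hz Hzd]].
    specialize (Hd' z Hzd). specialize (H z Hz). lra.
  - destruct (continuity_pt_gt g T hi Hg Hlt) as [d [Hd Hd']]. destruct (K d Hd) as [z [Hz Hzd]].
    specialize (Hd' z Hzd). specialize (H z Hz). lra.
Qed.

Lemma ln_near_one (e : R) : 0 < e -> exists d, 0 < d < 1 /\ forall y, Rabs (y - 1) < d -> Rabs (ln y) < e.
Proof.
  intros He.
  assert (Hc : continuity_pt (fun y => Rabs (ln y)) 1).
  { apply (continuity_pt_comp ln Rabs); [|apply Rcontinuity_abs].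
    apply (is_derive_continuity_pt _ _ 1). auto_derive; lra. }
  destruct (continuity_pt_lt _ 1 e Hc) as [d [Hd H]]; [rewrite ln_1, Rabs_R0; assumption|].
  exists (Rmin d (1 / 2)). pose proof (Rmin_l d (1 / 2)). pose proof (Rmin_r d (1 / 2)).
  split; [split; [apply Rmin_glb_lt; lra|lra]|]. intros y Hy. apply H. lra.
Qed.

Lemma mean_value_abs_le (f df : R -> R) (a b C : R) :
  a <= b -> (forall x, a <= x <= b -> is_derive f x (df x)) ->
  (forall x, a <= x <= b -> Rabs (df x) <= C) -> Rabs (f b - f a) <= C * (b - a).
Proof.
  intros Hab H HC. destruct (mean_value f df a b Hab H) as [c [Hc ->]].
  rewrite Rabs_mult, (Rabs_pos_eq (b - a)) by lra. apply Rmult_le_compat_r; [lra|auto].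
Qed.

Lemma continuity_pt_Rmax0 (x : R) : continuity_pt (Rmax 0) x.
Proof.
  apply continuity_pt_ext with (fun y => (y + Rabs y) / 2).
  - intros y. unfold Rmax, Rabs. destruct Rle_dec, Rcase_abs; lra.
  - apply continuity_pt_mult; [|apply continuity_pt_const; easy].
    apply continuity_pt_plus; [apply continuity_pt_id|apply Rcontinuity_abs].
Qed.

Lemma is_derive_RInt_continuous (f : R -> R) (c x : R) :
  (forall y, continuity_pt f y) -> is_derive (fun x => c + RInt f 0 x) x (f x).
Proof.
  intros Hf. evar_last; [apply (is_derive_plus (fun _ => c) (fun x => RInt f 0 x) x 0 (f x))|apply Rplus_0_l].
  - apply (is_derive_const (V := R_NormedModule) c x).
  - apply (is_derive_RInt (V := R_CompleteNormedModule) f (fun x => RInt f 0 x) 0 x).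
    + exists (mkposreal 1 Rlt_0_1). intros y _. apply (RInt_correct (V := R_CompleteNormedModule)).
      apply (ex_RInt_continuous (V := R_CompleteNormedModule)). intros z _.
      now apply continuity_pt_filterlim.
    + now apply continuity_pt_filterlim.
Qed.

(** * A Picard theorem for causal operators *)

Section Volterra.
Variables (F : (R -> R) -> R -> R) (c : R).
Hypothesis F_continuous : forall f, (forall z, continuity_pt f z) -> forall z, continuity_pt (F f) z.
(** The value at z is controlled by the supremum of the difference over all of [0, z] and not by its
    value at z alone, because the operator to be treated contains a mean over [0, z]. *)
Hypothesis F_causal : forall a, 0 < a -> exists L, 0 < L /\
  forall f g, (forall z, continuity_pt f z) -> (forall z, continuity_pt g z) ->
  forall z B, 0 <= z <= a -> (forall y, 0 <= y <= z -> Rabs (f y - g y) <= B) ->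
  Rabs (F f z - F g z) <= L * B.

Let I (f : R -> R) (x : R) := c + RInt (F f) 0 x.

(** Composing with [Rmax 0] extends each iterate by a constant to negative arguments, so that it is
    continuous on the whole line, as [F_continuous] demands. *)
Fixpoint picard (k : nat) : R -> R :=
  match k with O => fun _ => c | S k => fun x => I (picard k) (Rmax 0 x) end.

Lemma picard_continuous (k : nat) (x : R) : continuity_pt (picard k) x.
Proof.
  revert x; induction k as [|k IH]; intros x; simpl; [apply continuity_pt_const; easy|].
  apply (continuity_pt_comp (Rmax 0) (I (picard k))); [apply continuity_pt_Rmax0|].
  eapply is_derive_continuity_pt, is_derive_RInt_continuous, F_continuous, IH.
Qed.

Lemma picard_S_nonneg (k : nat) (x : R) : 0 <= x -> picard (S k) x = I (picard k) x.
Proof. intros Hx. simpl. now rewrite Rmax_right. Qed.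

(** In the supremum norm weighted by exp(-2 L x) the integral operator contracts by 1/2, since L
    times the integral of exp(2 L z) is at most exp(2 L x) / 2. Hence the rate holds on every [0, a]
    with no smallness condition. *)
Lemma picard_step (a : R) : 0 < a -> exists C, 0 < C /\
  forall k x, 0 <= x <= a -> Rabs (picard (S k) x - picard k x) <= C * (1 / 2) ^ k.
Proof.
  intros Ha. destruct (F_causal a Ha) as [L [HL HF]].
  destruct (continuity_ab_maj (fun x => Rabs (picard 1 x - picard 0 x)) 0 a) as [x0 [Hx0 _]]; [lra| |].
  { intros y _. apply (continuity_pt_comp (fun x => picard 1 x - picard 0 x) Rabs); [|apply Rcontinuity_abs].
    apply continuity_pt_minus; apply picard_continuous. }
  set (D := Rabs (picard 1 x0 - picard 0 x0) + 1).
  assert (HD : 0 < D) by (pose proof (Rabs_pos (picard 1 x0 - picard 0 x0)); unfold D; lra).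
  assert (H : forall k x, 0 <= x <= a -> Rabs (picard (S k) x - picard k x) <= D * (1 / 2) ^ k * exp (2 * L * x)).
  { induction k as [|k IH]; intros x Hx.
    - rewrite pow_O, Rmult_1_r. specialize (Hx0 x Hx).
      assert (1 <= exp (2 * L * x)).
      { rewrite <- exp_0. apply exp_le_compat. apply Rmult_le_pos; lra. }
      apply Rle_trans with (D * 1); [unfold D; lra|]. apply Rmult_le_compat_l; lra.
    - assert (Hp : 0 < (1 / 2) ^ k) by (apply pow_lt; lra).
      set (E := D * (1 / 2) ^ S k).
      assert (HE : 0 < E) by (apply Rmult_lt_0_compat; [lra|apply pow_lt; lra]).
      rewrite !picard_S_nonneg by lra.
      set (f := picard (S k)) in *. set (g := picard k) in *.
      assert (Hd : forall z, is_derive (fun z => I f z - I g z) z (F f z - F g z)).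
      { intros z. apply (is_derive_minus (I f) (I g) z (F f z) (F g z));
          apply is_derive_RInt_continuous, F_continuous; intros; apply picard_continuous. }
      assert (Hb : forall z, 0 <= z <= a -> Rabs (F f z - F g z) <= E * (2 * L) * exp (2 * L * z)).
      { intros z Hz. replace (E * (2 * L) * exp (2 * L * z)) with (L * (D * (1 / 2) ^ k * exp (2 * L * z))) by (unfold E; simpl; field).
        apply HF; [apply (picard_continuous (S k))|apply picard_continuous|assumption|].
        intros y Hy. eapply Rle_trans; [apply IH; lra|]. apply Rmult_le_compat_l; [apply Rmult_le_pos; lra|].
        apply exp_le_compat, Rmult_le_compat_l; lra. }
      assert (H0 : I f 0 - I g 0 = 0) by (unfold I; rewrite !RInt_point; unfold zero; simpl; lra).
      (* The difference plus E exp(2 L z) is nondecreasing and the difference minus it is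
         nonincreasing; the signs s = 1 and s = -1 give the two halves of the estimate. *)
      assert (He : forall s z, is_derive (fun z => I f z - I g z + s * (E * exp (2 * L * z))) z (F f z - F g z + s * (E * (2 * L) * exp (2 * L * z)))).
      { intros s z. apply (is_derive_plus (fun z => I f z - I g z) (fun z => s * (E * exp (2 * L * z)))); [apply Hd|].
        auto_derive; [exact Logic.I|ring]. }
      apply Rabs_le_between. split.
      + assert (I f 0 - I g 0 + 1 * (E * exp (2 * L * 0)) <= I f x - I g x + 1 * (E * exp (2 * L * x))).
        { apply (nondecreasing_of_derive (fun z => I f z - I g z + 1 * (E * exp (2 * L * z))) _ 0 x ltac:(lra) (fun z _ => He 1 z)).
          intros z Hz. specialize (Hb z ltac:(lra)). apply Rabs_le_between in Hb. lra. }
        rewrite H0, Rmult_0_r, exp_0 in H. lra.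
      + assert (I f x - I g x + - 1 * (E * exp (2 * L * x)) <= I f 0 - I g 0 + - 1 * (E * exp (2 * L * 0))).
        { apply (nonincreasing_of_derive (fun z => I f z - I g z + - 1 * (E * exp (2 * L * z))) _ 0 x ltac:(lra) (fun z _ => He (- 1) z)).
          intros z Hz. specialize (Hb z ltac:(lra)). apply Rabs_le_between in Hb. lra. }
        rewrite H0, Rmult_0_r, exp_0 in H. lra. }
  exists (D * exp (2 * L * a)). split; [apply Rmult_lt_0_compat; [lra|apply exp_pos]|].
  intros k x Hx. eapply Rle_trans; [now apply H|].
  rewrite (Rmult_assoc D), (Rmult_assoc D), (Rmult_comm (exp _)).
  apply Rmult_le_compat_l; [lra|]. apply Rmult_le_compat_l; [apply pow_le; lra|].
  apply exp_le_compat, Rmult_le_compat_l; lra.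
Qed.

Let picard_limit (x : R) := real (Lim_seq (fun k => picard k (Rmax 0 x))).

Lemma picard_cauchy (a : R) : 0 < a -> exists C, 0 < C /\
  forall k x, 0 <= x <= a -> is_lim_seq (fun j => picard j x) (picard_limit x) /\
    Rabs (picard k x - picard_limit x) <= C * (1 / 2) ^ k.
Proof.
  intros Ha. destruct (picard_step a Ha) as [C [HC H]].
  (* Keeping the exact geometric remainder is what makes the induction on [j] close. *)
  assert (Hj : forall j k x, 0 <= x <= a -> Rabs (picard (j + k) x - picard k x) <= 2 * C * ((1 / 2) ^ k - (1 / 2) ^ (j + k))).
  { intros j k x Hx. induction j as [|j IH].
    - simpl. rewrite !Rminus_diag, Rabs_R0. lra.
    - specialize (H (j + k)%nat x Hx). replace (S j + k)%nat with (S (j + k)) by lia.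
      replace (picard (S (j + k)) x - picard k x) with ((picard (S (j + k)) x - picard (j + k) x) + (picard (j + k) x - picard k x)) by ring.
      eapply Rle_trans; [apply Rabs_triang|]. rewrite <- (tech_pow_Rmult (1 / 2)). lra. }
  assert (Hj2 : forall j k x, 0 <= x <= a -> Rabs (picard (j + k) x - picard k x) <= 2 * C * (1 / 2) ^ k).
  { intros j k x Hx. eapply Rle_trans; [now apply Hj|]. apply Rmult_le_compat_l; [lra|].
    assert (0 < (1 / 2) ^ (j + k)) by (apply pow_lt; lra). lra. }
  assert (Hlim : forall x, 0 <= x <= a -> is_lim_seq (fun j => picard j x) (picard_limit x)).
  { intros x Hx.
    assert (Hex : ex_finite_lim_seq (fun j => picard j x)).
    { apply ex_lim_seq_cauchy_corr. intros e.
      destruct (pow_lt_1_zero (1 / 2) ltac:(rewrite Rabs_pos_eq; lra) (e / (4 * C + 1))) as [N0 HN].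
      { apply Rdiv_lt_0_compat; [apply cond_pos|lra]. }
      specialize (HN N0 (le_n _)). rewrite Rabs_pos_eq in HN by (apply pow_le; lra).
      assert (Hs : 4 * C * (1 / 2) ^ N0 < e).
      { apply Rle_lt_trans with ((4 * C + 1) * (1 / 2) ^ N0); [apply Rmult_le_compat_r; [apply pow_le; lra|lra]|].
        apply Rmult_lt_reg_r with (/ (4 * C + 1)); [apply Rinv_0_lt_compat; lra|].
        rewrite (Rmult_comm (4 * C + 1)), Rmult_assoc, Rinv_r by lra. unfold Rdiv in HN. lra. }
      exists N0. intros k1 k2 Hk1 Hk2.
      pose proof (Hj2 (k1 - N0)%nat N0 x Hx) as B1. pose proof (Hj2 (k2 - N0)%nat N0 x Hx) as B2.
      replace (k1 - N0 + N0)%nat with k1 in B1 by lia. replace (k2 - N0 + N0)%nat with k2 in B2 by lia.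
      apply Rabs_le_between in B1. apply Rabs_le_between in B2. apply Rabs_def1; lra. }
    destruct Hex as [l Hl]. unfold picard_limit. rewrite Rmax_right by lra.
    now rewrite (is_lim_seq_unique _ _ Hl). }
  exists (2 * C). split; [lra|]. intros k x Hx. split; [now apply Hlim|].
  assert (Hl := Hlim x Hx). apply (is_lim_seq_incr_n _ k) in Hl.
  apply Rabs_le_between'. cut (picard k x - 2 * C * (1 / 2) ^ k <= picard_limit x /\ picard_limit x <= picard k x + 2 * C * (1 / 2) ^ k); [lra|]. split.
  - assert (Hle : Rbar_le (picard k x - 2 * C * (1 / 2) ^ k) (picard_limit x)).
    { apply (is_lim_seq_le (fun _ => picard k x - 2 * C * (1 / 2) ^ k) (fun j => picard (j + k) x));
        [|apply is_lim_seq_const|assumption].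
      intros j. specialize (Hj2 j k x Hx). apply Rabs_le_between in Hj2. lra. }
    simpl in Hle. lra.
  - assert (Hle : Rbar_le (picard_limit x) (picard k x + 2 * C * (1 / 2) ^ k)).
    { apply (is_lim_seq_le (fun j => picard (j + k) x) (fun _ => picard k x + 2 * C * (1 / 2) ^ k));
        [|assumption|apply is_lim_seq_const].
      intros j. specialize (Hj2 j k x Hx). apply Rabs_le_between in Hj2. lra. }
    simpl in Hle. lra.
Qed.

Lemma half_pow_small (C e : R) : 0 < C -> 0 < e -> exists k, C * (1 / 2) ^ k < e.
Proof.
  intros HC He.
  destruct (pow_lt_1_zero (1 / 2) ltac:(rewrite Rabs_pos_eq; lra) (e / C)) as [N0 HN].
  { apply Rdiv_lt_0_compat; lra. }
  specialize (HN N0 (le_n _)). rewrite Rabs_pos_eq in HN by (apply pow_le; lra).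
  exists N0. apply Rmult_lt_compat_l with (r := C) in HN; [|lra].
  replace (C * (e / C)) with e in HN by (field; lra). exact HN.
Qed.

Lemma picard_limit_continuous (x : R) : continuity_pt picard_limit x.
Proof.
  assert (Hx : 0 <= Rabs x) by apply Rabs_pos.
  destruct (picard_cauchy (Rabs x + 1) ltac:(lra)) as [C [HC H]].
  assert (Hlr : forall y, picard_limit y = picard_limit (Rmax 0 y)).
  { intros y. unfold picard_limit. f_equal. f_equal. unfold Rmax. repeat destruct Rle_dec; try reflexivity; lra. }
  apply continuity_pt_locally. intros e.
  destruct (half_pow_small C (e / 3) HC) as [k Hk]; [pose proof (cond_pos e); lra|].
  assert (Hc : continuity_pt (fun y => picard k (Rmax 0 y)) x).
  { apply (continuity_pt_comp (Rmax 0) (picard k)); [apply continuity_pt_Rmax0|apply picard_continuous]. }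
  destruct (proj1 (continuity_pt_locally _ _) Hc (mkposreal (e / 3) ltac:(pose proof (cond_pos e); lra))) as [d Hd].
  exists (mkposreal (Rmin d 1) ltac:(apply Rmin_glb_lt; [apply cond_pos|lra])). intros y Hy.
  assert (Hyd : Rabs (y - x) < d) by (eapply Rlt_le_trans; [exact Hy|apply Rmin_l]).
  assert (Hy1 : Rabs (y - x) < 1) by (eapply Rlt_le_trans; [exact Hy|apply Rmin_r]).
  specialize (Hd y Hyd). simpl in Hd.
  assert (Hr : forall z, Rabs (z - x) < 1 -> 0 <= Rmax 0 z <= Rabs x + 1).
  { intros z Hz. apply Rabs_def2 in Hz. pose proof (Rle_abs x). split; [apply Rmax_l|apply Rmax_lub; lra]. }
  pose proof (proj2 (H k _ (Hr y Hy1))) as B1. pose proof (proj2 (H k _ (Hr x ltac:(rewrite Rminus_diag, Rabs_R0; lra)))) as B2.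
  rewrite (Hlr y), (Hlr x).
  apply Rabs_le_between in B1. apply Rabs_le_between in B2. apply Rabs_def2 in Hd. apply Rabs_def1; lra.
Qed.

Lemma picard_limit_fixpoint (x : R) : 0 <= x -> picard_limit x = I picard_limit x.
Proof.
  intros Hx. apply cond_eq. intros e He.
  destruct (picard_cauchy (x + 1) ltac:(lra)) as [C [HC H]].
  destruct (F_causal (x + 1) ltac:(lra)) as [L [HL HF]].
  (* Iterate k + 1 contributes at most C / 2^k to the error, and the integral of the difference of
     the fields L x times that. *)
  destruct (half_pow_small (C * (1 + L * x)) e) as [k Hk]; [|assumption|].
  { apply Rmult_lt_0_compat; [lra|]. assert (0 <= L * x) by (apply Rmult_le_pos; lra). lra. }
  set (f := picard k).
  assert (B1 : Rabs ((I f x - I picard_limit x) - (I f 0 - I picard_limit 0)) <= L * (C * (1 / 2) ^ k) * (x - 0)).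
  { apply (mean_value_abs_le (fun z => I f z - I picard_limit z) (fun z => F f z - F picard_limit z)); [assumption| |].
    - intros z _. apply (is_derive_minus (I f) (I picard_limit) z (F f z) (F picard_limit z));
        apply is_derive_RInt_continuous, F_continuous; intros; [apply picard_continuous|apply picard_limit_continuous].
    - intros z Hz. apply HF; [apply picard_continuous|apply picard_limit_continuous|lra|].
      intros y Hy. apply H. lra. }
  assert (H0 : I f 0 - I picard_limit 0 = 0) by (unfold I; rewrite !RInt_point; unfold zero; simpl; lra).
  rewrite H0, !Rminus_0_r in B1.
  pose proof (proj2 (H (S k) x ltac:(lra))) as B2. rewrite picard_S_nonneg in B2 by assumption. fold f in B2.
  assert (Hp : 0 < (1 / 2) ^ k) by (apply pow_lt; lra).
  assert (C * (1 / 2) ^ S k <= C * (1 / 2) ^ k) by (apply Rmult_le_compat_l; [lra|]; simpl; lra).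
  apply Rabs_le_between in B1. apply Rabs_le_between in B2. apply Rabs_def1; lra.
Qed.

Lemma volterra_fixpoint : exists f, (forall z, continuity_pt f z) /\ f 0 = c /\
  (forall x, 0 <= x -> f x = c + RInt (F f) 0 x).
Proof.
  exists picard_limit. split; [exact picard_limit_continuous|]. split; [|exact picard_limit_fixpoint].
  rewrite picard_limit_fixpoint by lra. unfold I. rewrite RInt_point. unfold zero; simpl. ring.
Qed.

End Volterra.

(** * Powers extended by 0 to the whole line *)

Lemma powa_pos_eq (x a : R) : 0 < x -> powa x a = exp (a * ln x).
Proof. intros Hx. unfold powa, Rpower. destruct (Rle_dec x 0); [lra|reflexivity]. Qed.

Lemma powa_nonpos (x a : R) : x <= 0 -> powa x a = 0.
Proof. intros Hx. unfold powa. destruct (Rle_dec x 0); [reflexivity|lra]. Qed.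

Lemma powa_nonneg (x a : R) : 0 <= powa x a.
Proof.
  destruct (Rle_lt_dec x 0) as [H|H]; [rewrite powa_nonpos by assumption; lra|].
  rewrite powa_pos_eq by assumption. left; apply exp_pos.
Qed.

Lemma powa_pos (x a : R) : 0 < x -> 0 < powa x a.
Proof. intros H. rewrite powa_pos_eq by assumption. apply exp_pos. Qed.

Lemma powa_le (x y a : R) : 0 <= a -> x <= y -> powa x a <= powa y a.
Proof.
  intros Ha Hxy. destruct (Rle_lt_dec x 0) as [H|H].
  - rewrite powa_nonpos by assumption. apply powa_nonneg.
  - rewrite !powa_pos_eq by lra. apply exp_le_compat, Rmult_le_compat_l; [assumption|]. apply ln_le; lra.
Qed.

Lemma powa_small (a e : R) : 0 < a -> 0 < e -> exists d, 0 < d /\ forall x, x < d -> powa x a < e.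
Proof.
  intros Ha He. exists (exp (ln e / a)). split; [apply exp_pos|]. intros x Hx.
  destruct (Rle_lt_dec x 0) as [H|H]; [rewrite powa_nonpos by assumption; lra|].
  rewrite powa_pos_eq by assumption. rewrite <- (exp_ln e He). apply exp_increasing.
  assert (ln x < ln e / a) by (rewrite <- (ln_exp (ln e / a)); apply ln_increasing; assumption).
  apply Rmult_lt_compat_l with (r := a) in H0; [|assumption].
  replace (a * (ln e / a)) with (ln e) in H0 by (field; lra). exact H0.
Qed.

Lemma powa_S (x a : R) : 0 < x -> powa x (a + 1) = powa x a * x.
Proof.
  intros Hx. rewrite !powa_pos_eq by assumption.
  replace ((a + 1) * ln x) with (a * ln x + ln x) by ring. now rewrite exp_plus, exp_ln.
Qed.

Lemma is_derive_ext_pos (f g : R -> R) (x l : R) : 0 < x ->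
  (forall y, 0 < y -> f y = g y) -> is_derive f x l -> is_derive g x l.
Proof.
  intros Hx Hfg H. apply is_derive_ext_loc with f; [|assumption].
  exists (mkposreal x Hx). intros y Hy. apply Hfg.
  assert (Rabs (y - x) < x) as Hb by exact Hy. apply Rabs_def2 in Hb. lra.
Qed.

(** Only 0 is delicate: there the right difference quotient is [powa h a], which tends to 0.
    Exponents above 1 are thus continuously differentiable across 0, and Lipschitz on bounded
    sets. *)
Lemma powa_derive (a x : R) : 0 < a -> is_derive (fun x => powa x (a + 1)) x ((a + 1) * powa x a).
Proof.
  intros Ha. destruct (Rtotal_order x 0) as [Hx|[->|Hx]].
  - rewrite powa_nonpos by lra. rewrite Rmult_0_r.
    apply is_derive_ext_loc with (fun _ => 0).
    + exists (mkposreal (- x) ltac:(lra)). intros y Hy. symmetry. apply powa_nonpos.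
      assert (Rabs (y - x) < - x) as Hb by exact Hy. apply Rabs_def2 in Hb. lra.
    + apply (is_derive_const (V := R_NormedModule) 0 x).
  - rewrite powa_nonpos by lra. rewrite Rmult_0_r. apply is_derive_Reals.
    intros e He. destruct (powa_small a e Ha He) as [d [Hd H]].
    exists (mkposreal d Hd). intros h Hh Hhd. simpl in Hhd.
    rewrite (powa_nonpos 0) by lra. rewrite Rplus_0_l, !Rminus_0_r.
    destruct (Rle_lt_dec h 0) as [Hle|Hlt].
    + rewrite powa_nonpos by assumption. unfold Rdiv. now rewrite Rmult_0_l, Rabs_R0.
    + rewrite powa_S by assumption. replace (powa h a * h / h) with (powa h a) by (field; lra).
      rewrite Rabs_pos_eq by apply powa_nonneg. apply H. now rewrite Rabs_pos_eq in Hhd by lra.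
  - apply (is_derive_ext_pos (fun x => exp ((a + 1) * ln x))); [assumption|intros; symmetry; now apply powa_pos_eq|].
    rewrite powa_pos_eq by assumption. auto_derive; [assumption|].
    replace ((a + 1) * ln x) with (a * ln x + ln x) by ring. rewrite exp_plus, exp_ln by assumption. field. lra.
Qed.

Lemma powa_continuous (a x : R) : 0 < a -> continuity_pt (fun x => powa x a) x.
Proof.
  intros Ha. destruct (Rtotal_order x 0) as [Hx|[->|Hx]].
  - apply continuity_pt_locally. intros e. exists (mkposreal (- x) ltac:(lra)). intros y Hy.
    assert (Rabs (y - x) < - x) as Hb by exact Hy. apply Rabs_def2 in Hb.
    rewrite !powa_nonpos by lra. rewrite Rminus_diag, Rabs_R0. apply cond_pos.
  - apply continuity_pt_locally. intros e. destruct (powa_small a e Ha (cond_pos e)) as [d [Hd H]].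
    exists (mkposreal d Hd). intros y Hy. assert (Rabs (y - 0) < d) as Hb by exact Hy.
    rewrite (powa_nonpos 0), Rminus_0_r by lra. rewrite Rabs_pos_eq by apply powa_nonneg. apply H.
    apply Rabs_def2 in Hb. lra.
  - apply (is_derive_continuity_pt _ _ (a * exp (a * ln x) / x)).
    apply (is_derive_ext_pos (fun x => exp (a * ln x))); [assumption|intros; symmetry; now apply powa_pos_eq|].
    auto_derive; [assumption|]. field. lra.
Qed.

Lemma powa_lipschitz (a C u v : R) : 0 < a -> 0 <= u <= C -> 0 <= v <= C ->
  Rabs (powa u (a + 1) - powa v (a + 1)) <= (a + 1) * powa C a * Rabs (u - v).
Proof.
  intros Ha Hu Hv.
  assert (H : forall u v, v <= u -> 0 <= u <= C -> 0 <= v <= C ->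
     Rabs (powa u (a + 1) - powa v (a + 1)) <= (a + 1) * powa C a * (u - v)).
  { intros u' v' Huv Hu' Hv'.
    apply (mean_value_abs_le (fun x => powa x (a + 1)) (fun x => (a + 1) * powa x a)); [assumption| |].
    - intros; now apply powa_derive.
    - intros z Hz. rewrite Rabs_pos_eq by (apply Rmult_le_pos; [lra|apply powa_nonneg]).
      apply Rmult_le_compat_l; [lra|]. apply powa_le; lra. }
  destruct (Rle_lt_dec v u) as [Huv|Huv].
  - rewrite (Rabs_pos_eq (u - v)) by lra. now apply H.
  - rewrite Rabs_minus_sym, (Rabs_minus_sym u), (Rabs_pos_eq (v - u)) by lra. apply H; lra.
Qed.

(** * Truncation, and the regularised integral operator near infinity *)

Definition clamp (C z : R) := Rmax 0 (Rmin z C).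

Lemma clamp_range (C z : R) : 0 <= C -> 0 <= clamp C z <= C.
Proof. intros HC. unfold clamp, Rmax, Rmin. repeat destruct Rle_dec; lra. Qed.

Lemma clamp_id (C z : R) : 0 <= z <= C -> clamp C z = z.
Proof. intros HC. unfold clamp, Rmax, Rmin. repeat destruct Rle_dec; lra. Qed.

Lemma clamp_le (C b z : R) : 0 <= b -> z <= b -> clamp C z <= b.
Proof. intros Hb Hz. unfold clamp, Rmax, Rmin. repeat destruct Rle_dec; lra. Qed.

Lemma clamp_lipschitz (C u v : R) : Rabs (clamp C u - clamp C v) <= Rabs (u - v).
Proof.
  unfold clamp, Rmax, Rmin, Rabs. repeat destruct Rle_dec; repeat destruct Rcase_abs; lra.
Qed.

Lemma clamp_continuous (C x : R) : continuity_pt (clamp C) x.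
Proof.
  apply continuity_pt_locally. intros e. exists e. intros y Hy.
  eapply Rle_lt_trans; [apply clamp_lipschitz|exact Hy].
Qed.

(* [powa x nu] has to vanish at 0, so that [weighted_mean] and [clamped_field] make sense on the
   whole line; the values at [x <= 0] are junk that is multiplied by 0. The clamp makes the field
   Lipschitz; it turns out to be inactive along the solution. *)
Section Operator.
Variables n m ep nu p1 q1 C : R.
Hypothesis Hn : 1 <= n.
Hypothesis Hm : 0 < m.
Hypothesis Hep : 0 < ep.
Hypothesis Hnu : 0 < nu.
Hypothesis Hnue : (nu + 1) * ep = n.
Hypothesis Hp : 0 < p1.
Hypothesis Hq : 0 < q1.
Hypothesis HC : 0 < C.

Definition weighted_integral (f : R -> R) (x : R) : R := RInt (fun z => powa z nu * f z / ep) 0 x.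
Definition weighted_mean (f : R -> R) (x : R) := weighted_integral f x / powa x (nu + 1).
Definition clamped_field (f : R -> R) (x : R) :=
  - (powa x (p1 + 1) * powa (clamp C (weighted_mean f x)) (p1 + 1) - m * powa (clamp C (f x)) (q1 + 1)) / ep.

Lemma weighted_integral_derive (f : R -> R) (x : R) : (forall z, continuity_pt f z) ->
  is_derive (weighted_integral f) x (powa x nu * f x / ep).
Proof.
  intros Hf. apply (is_derive_ext (fun x => 0 + RInt (fun z => powa z nu * f z / ep) 0 x));
    [intros; apply Rplus_0_l|].
  apply (is_derive_RInt_continuous (fun z => powa z nu * f z / ep)).
  intros y. apply continuity_pt_mult; [|apply continuity_pt_const; easy].
  apply continuity_pt_mult; [now apply powa_continuous|apply Hf].
Qed.

(** The relation (nu + 1) ep = n gives the constant B the weighted mean B / n. The comparison is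
    made on the integrals, which all vanish at 0, through their derivatives. *)
Lemma weighted_mean_le (f g : R -> R) (x B : R) :
  (forall z, continuity_pt f z) -> (forall z, continuity_pt g z) -> 0 < x ->
  (forall y, 0 <= y <= x -> f y <= g y + B) -> weighted_mean f x <= weighted_mean g x + B / n.
Proof.
  intros Hf Hg Hx H.
  assert (Hd : weighted_integral f x - weighted_integral g x - B / n * powa x (nu + 1)
     <= weighted_integral f 0 - weighted_integral g 0 - B / n * powa 0 (nu + 1)).
  { apply (nonincreasing_of_derive (fun x => weighted_integral f x - weighted_integral g x - B / n * powa x (nu + 1))
      (fun x => powa x nu * f x / ep - powa x nu * g x / ep - B / n * ((nu + 1) * powa x nu))); [lra| |].
    - intros z _.
      apply (is_derive_minus (fun x => weighted_integral f x - weighted_integral g x) (fun x => B / n * powa x (nu + 1))).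
      + apply (is_derive_minus (weighted_integral f) (weighted_integral g)); now apply weighted_integral_derive.
      + apply (is_derive_scal (fun x => powa x (nu + 1)) z (B / n) ((nu + 1) * powa z nu)). now apply powa_derive.
    - intros z Hz. specialize (H z Hz).
      replace (B / n * ((nu + 1) * powa z nu)) with (powa z nu * B / ep).
      2:{ rewrite <- Hnue. field. lra. }
      pose proof (powa_nonneg z nu).
      assert (0 <= powa z nu * (g z + B - f z) / ep).
      { apply Rmult_le_pos; [apply Rmult_le_pos; lra|left; now apply Rinv_0_lt_compat]. }
      unfold Rdiv in *. lra. }
  unfold weighted_integral in Hd at 3 4. rewrite !RInt_point, (powa_nonpos 0) in Hd by lra. unfold zero in Hd; simpl in Hd.
  pose proof (powa_pos x (nu + 1) Hx) as Hpx.
  unfold weighted_mean. apply Rmult_le_reg_r with (powa x (nu + 1)); [assumption|].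
  rewrite Rmult_plus_distr_r.
  replace (weighted_integral f x / powa x (nu + 1) * powa x (nu + 1)) with (weighted_integral f x) by (field; lra).
  replace (weighted_integral g x / powa x (nu + 1) * powa x (nu + 1)) with (weighted_integral g x) by (field; lra).
  lra.
Qed.

Lemma weighted_mean_zero (x : R) : weighted_mean (fun _ => 0) x = 0.
Proof.
  unfold weighted_mean, weighted_integral.
  rewrite (RInt_ext _ (fun _ => 0)) by (intros; unfold Rdiv; simpl; ring).
  rewrite RInt_const. unfold scal; simpl; unfold mult; simpl. unfold Rdiv. ring.
Qed.

Lemma weighted_mean_upper (f : R -> R) (x B : R) : (forall z, continuity_pt f z) -> 0 < x ->
  (forall y, 0 <= y <= x -> f y <= B) -> weighted_mean f x <= B / n.
Proof.
  intros Hf Hx H. rewrite <- (Rplus_0_l (B / n)), <- (weighted_mean_zero x).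
  apply weighted_mean_le; auto; [intros; apply continuity_pt_const; easy|].
  intros y Hy. specialize (H y Hy). lra.
Qed.

Lemma weighted_mean_lower (f : R -> R) (x B : R) : (forall z, continuity_pt f z) -> 0 < x ->
  (forall y, 0 <= y <= x -> B <= f y) -> B / n <= weighted_mean f x.
Proof.
  intros Hf Hx H.
  pose proof (weighted_mean_le (fun _ => 0) f x (- B) ltac:(intros; apply continuity_pt_const; easy) Hf Hx
    ltac:(intros y Hy; specialize (H y Hy); lra)) as H1.
  rewrite weighted_mean_zero in H1. unfold Rdiv in *. lra.
Qed.

Lemma weighted_mean_diff (f g : R -> R) (x B : R) :
  (forall z, continuity_pt f z) -> (forall z, continuity_pt g z) -> 0 < x ->
  (forall y, 0 <= y <= x -> Rabs (f y - g y) <= B) -> Rabs (weighted_mean f x - weighted_mean g x) <= B / n.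
Proof.
  intros Hf Hg Hx H.
  pose proof (weighted_mean_le f g x B Hf Hg Hx) as H1. pose proof (weighted_mean_le g f x B Hg Hf Hx) as H2.
  apply Rabs_le_between.
  assert (weighted_mean f x <= weighted_mean g x + B / n).
  { apply H1. intros y Hy. specialize (H y Hy). apply Rabs_le_between in H. lra. }
  assert (weighted_mean g x <= weighted_mean f x + B / n).
  { apply H2. intros y Hy. specialize (H y Hy). apply Rabs_le_between in H. lra. }
  lra.
Qed.

Lemma weighted_mean_derive (f : R -> R) (x : R) : (forall z, continuity_pt f z) -> 0 < x ->
  is_derive (weighted_mean f) x ((f x - n * weighted_mean f x) / (ep * x)).
Proof.
  intros Hf Hx. pose proof (powa_pos x (nu + 1) Hx) as H1. pose proof (powa_pos x nu Hx) as H2.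
  evar_last; [apply (is_derive_div (weighted_integral f) (fun x => powa x (nu + 1)) x)|].
  - now apply weighted_integral_derive.
  - now apply powa_derive.
  - lra.
  - simpl. unfold weighted_mean. rewrite powa_S in * by assumption. rewrite <- Hnue. field. repeat split; lra.
Qed.

(** The mean is a quotient by 0 for x <= 0 and its continuity there is not known, but the clamp
    keeps its power bounded and the factor [powa x (p1 + 1)] tends to 0. *)
Lemma clamped_field_continuous (f : R -> R) : (forall z, continuity_pt f z) ->
  forall x, continuity_pt (clamped_field f) x.
Proof.
  intros Hf x. unfold clamped_field.
  apply continuity_pt_mult; [|apply continuity_pt_const; easy].
  apply continuity_pt_opp. apply continuity_pt_minus.
  2:{ apply continuity_pt_mult; [apply continuity_pt_const; easy|].
      apply (continuity_pt_comp (fun x => clamp C (f x)) (fun x => powa x (q1 + 1))); [|apply powa_continuous; lra].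
      apply (continuity_pt_comp f (clamp C)); [apply Hf|apply clamp_continuous]. }
  destruct (Rle_lt_dec x 0) as [Hx|Hx].
  - set (M := powa C (p1 + 1)). assert (HM : 0 < M) by now apply powa_pos.
    apply continuity_pt_locally. intros e.
    destruct (powa_small (p1 + 1) (e / M)) as [d [Hd H]]; [lra|apply Rdiv_lt_0_compat; [apply cond_pos|assumption]|].
    exists (mkposreal d Hd). intros y Hy. assert (Rabs (y - x) < d) as Hb by exact Hy. apply Rabs_def2 in Hb.
    rewrite (powa_nonpos x), Rmult_0_l, Rminus_0_r by assumption.
    rewrite Rabs_pos_eq by (apply Rmult_le_pos; apply powa_nonneg).
    assert (powa (clamp C (weighted_mean f y)) (p1 + 1) <= M) by (apply powa_le; [lra|apply clamp_range; lra]).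
    apply Rle_lt_trans with (powa y (p1 + 1) * M); [apply Rmult_le_compat_l; [apply powa_nonneg|assumption]|].
    specialize (H y ltac:(lra)). apply Rmult_lt_compat_r with (r := M) in H; [|assumption].
    replace (e / M * M) with (pos e) in H by (field; lra). exact H.
  - apply continuity_pt_mult; [apply powa_continuous; lra|].
    apply (continuity_pt_comp (fun x => clamp C (weighted_mean f x)) (fun x => powa x (p1 + 1))); [|apply powa_continuous; lra].
    apply (continuity_pt_comp (weighted_mean f) (clamp C)); [|apply clamp_continuous].
    eapply is_derive_continuity_pt. now apply weighted_mean_derive.
Qed.

(** Both powers exceed 1, hence are Lipschitz on [0, C], and the mean moves by at most B / n <= B
    when the function moves by at most B on [0, z]. *)
Lemma clamped_field_causal (a : R) : 0 < a -> exists L, 0 < L /\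
  forall f g, (forall z, continuity_pt f z) -> (forall z, continuity_pt g z) ->
  forall z B, 0 <= z <= a -> (forall y, 0 <= y <= z -> Rabs (f y - g y) <= B) ->
  Rabs (clamped_field f z - clamped_field g z) <= L * B.
Proof.
  intros Ha.
  set (Lp := (p1 + 1) * powa C p1). set (Lq := (q1 + 1) * powa C q1). set (P := powa a (p1 + 1)).
  assert (HLp : 0 < Lp) by (apply Rmult_lt_0_compat; [lra|now apply powa_pos]).
  assert (HLq : 0 < Lq) by (apply Rmult_lt_0_compat; [lra|now apply powa_pos]).
  assert (HP : 0 < P) by now apply powa_pos.
  exists ((P * Lp + m * Lq) / ep). split.
  { apply Rdiv_lt_0_compat; [|assumption]. assert (0 < P * Lp) by now apply Rmult_lt_0_compat.
    assert (0 < m * Lq) by now apply Rmult_lt_0_compat. lra. }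
  intros f g Hf Hg z B Hz H.
  assert (HB : 0 <= B) by (eapply Rle_trans; [apply Rabs_pos|apply (H z); lra]).
  assert (Hlip : forall c u v, 0 < c -> Rabs (powa (clamp C u) (c + 1) - powa (clamp C v) (c + 1)) <= (c + 1) * powa C c * Rabs (u - v)).
  { intros c u v Hc. eapply Rle_trans; [apply powa_lipschitz with (C := C); [assumption|apply clamp_range; lra|apply clamp_range; lra]|].
    apply Rmult_le_compat_l; [apply Rmult_le_pos; [lra|apply powa_nonneg]|apply clamp_lipschitz]. }
  set (d1 := powa z (p1 + 1) * (powa (clamp C (weighted_mean f z)) (p1 + 1) - powa (clamp C (weighted_mean g z)) (p1 + 1))).
  set (d2 := powa (clamp C (f z)) (q1 + 1) - powa (clamp C (g z)) (q1 + 1)).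
  assert (D1 : Rabs d1 <= P * Lp * B).
  { unfold d1. rewrite Rabs_mult, (Rabs_pos_eq (powa z _)) by apply powa_nonneg.
    destruct (Rle_lt_dec z 0) as [Hz0|Hz0].
    - rewrite powa_nonpos, Rmult_0_l by assumption. apply Rmult_le_pos; [apply Rmult_le_pos; lra|lra].
    - rewrite Rmult_assoc. apply Rmult_le_compat; [apply powa_nonneg|apply Rabs_pos|apply powa_le; lra|].
      eapply Rle_trans; [now apply Hlip|]. apply Rmult_le_compat_l; [unfold Lp in *; lra|].
      eapply Rle_trans; [apply weighted_mean_diff; eassumption|].
      apply Rmult_le_reg_r with n; [lra|]. unfold Rdiv. rewrite Rmult_assoc, Rinv_l by lra. nra. }
  assert (D2 : Rabs d2 <= Lq * B).
  { eapply Rle_trans; [now apply Hlip|]. apply Rmult_le_compat_l; [unfold Lq in *; lra|]. apply H. lra. }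
  replace (clamped_field f z - clamped_field g z) with ((- d1 + m * d2) / ep) by (unfold clamped_field, d1, d2; field; lra).
  unfold Rdiv. rewrite Rabs_mult, (Rabs_pos_eq (/ ep)) by (left; now apply Rinv_0_lt_compat).
  replace ((P * Lp + m * Lq) * / ep * B) with ((P * Lp * B + m * (Lq * B)) * / ep) by ring.
  apply Rmult_le_compat_r; [left; now apply Rinv_0_lt_compat|].
  eapply Rle_trans; [apply Rabs_triang|]. rewrite Rabs_Ropp, Rabs_mult, (Rabs_pos_eq m) by lra.
  apply Rplus_le_compat; [assumption|]. apply Rmult_le_compat_l; lra.
Qed.

Lemma clamped_solution : exists f, (forall z, continuity_pt f z) /\ f 0 = 1 /\
  (forall x, 0 <= x -> f x = 1 + RInt (clamped_field f) 0 x).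
Proof.
  apply volterra_fixpoint; [exact clamped_field_continuous|exact clamped_field_causal].
Qed.

End Operator.

(** * The phase plane *)

(* Logarithmic coordinates: [x] and [l] stand for the logarithms of r^al u and of - r u'/u. *)
Definition p_minus_1 (al : R) := 2 / al.
Definition q_minus_1 (al : R) := 1 / (al + 1).
(* Exponents b, a of the Dulac function and g = b + 2 - a. They are determined by requiring that
   for m = |Mbar| the divergence has a critical zero at the stationary point. *)
Definition dulac_b (n al : R) := al * (2 * al - n) / ((al + 1) * n).
Definition dulac_g (n al : R) := n * (dulac_b n al + 1) / al.
Definition dulac_a (n al : R) := dulac_b n al + 2 - dulac_g n al.

(** The largest m for which the weighted arithmetic-geometric inequality, with weights p and 1,
    keeps [dulac_D] nonnegative. It is -Mbar, as [Mbar_eq] shows. *)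
Definition dulac_bound (n al : R) :=
  (p_minus_1 al + 2) / (dulac_b n al + 1 + q_minus_1 al)
  * exp (((p_minus_1 al + 1) * ln (dulac_a n al / (p_minus_1 al + 1)) + ln (dulac_b n al)) / (p_minus_1 al + 2)).

(** al < n means p > N/(N-2) and makes the constant al (n - al) of the isocline equation positive; n
    < 2 al means p < (N+2)/(N-2) and makes the Dulac exponents b and a positive. *)
Definition admissible (n al m : R) :=
  1 <= n /\ al < n /\ n < 2 * al /\ 0 < m /\ m <= dulac_bound n al.

Definition flow_x (al l : R) := al - exp l.
Definition flow_l (n al m x l : R) :=
  exp l - n + exp (p_minus_1 al * x - l) - m * exp (q_minus_1 al * (x + l)).

(* The value of s' on the isocline s = al; it vanishes exactly at X = X_M. *)
Definition isocline_rate (n al m x : R) :=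
  exp (p_minus_1 al * x) - m * exp ((1 + q_minus_1 al) * ln al) * exp (q_minus_1 al * x) - al * (n - al).

(** The primitive in l of exp((b+1) l) D that vanishes as l tends to -oo. *)
Definition dulac_J (n al m x l : R) :=
  dulac_a n al * exp ((dulac_b n al + 2) * l) / (dulac_b n al + 2)
  + exp (p_minus_1 al * x + dulac_b n al * l)
  - m * exp (q_minus_1 al * x + (dulac_b n al + 1 + q_minus_1 al) * l).

Definition dulac_D (n al m x l : R) :=
  dulac_a n al * exp l + dulac_b n al * exp (p_minus_1 al * x - l)
  - m * (dulac_b n al + 1 + q_minus_1 al) * exp (q_minus_1 al * (x + l)).

(** V divided by X^g. The first two terms are the primitive in l of s^(b+1) (s - al); times X^g, the
    other three are the primitive in x of X^g J(x, ln al) that vanishes at x = -oo. *)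
Definition lyap_bracket (n al m x l : R) :=
  exp ((dulac_b n al + 2) * l) / (dulac_b n al + 2) - al * exp ((dulac_b n al + 1) * l) / (dulac_b n al + 1)
  + dulac_a n al * exp ((dulac_b n al + 2) * ln al) / (dulac_g n al * (dulac_b n al + 2))
  + exp (dulac_b n al * ln al + p_minus_1 al * x) / (dulac_g n al + p_minus_1 al)
  - m * exp ((dulac_b n al + 1 + q_minus_1 al) * ln al + q_minus_1 al * x) / (dulac_g n al + q_minus_1 al).

Definition lyapunov (n al m x l : R) := exp (dulac_g n al * x) * lyap_bracket n al m x l.

Definition flow_s (n al m x l : R) :=
  exp l * exp l - n * exp l + exp (p_minus_1 al * x) - m * exp (q_minus_1 al * x + (1 + q_minus_1 al) * l).

(* The limit of [lyapunov] as s -> 0. *)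
Definition lyap_axis (n al m x : R) := exp (dulac_g n al * x) *
  (dulac_a n al * exp ((dulac_b n al + 2) * ln al) / (dulac_g n al * (dulac_b n al + 2))
  + exp (dulac_b n al * ln al + p_minus_1 al * x) / (dulac_g n al + p_minus_1 al)
  - m * exp ((dulac_b n al + 1 + q_minus_1 al) * ln al + q_minus_1 al * x) / (dulac_g n al + q_minus_1 al)).

(* The factor [k] is 1 for the time t = ln r, -1 for reversed time, and -1/(ep th) for the time
   th = r^(-ep) used near infinity. *)
Definition flow_at (n al m k : R) (xi lam : R -> R) (t : R) : Prop :=
  is_derive xi t (k * flow_x al (lam t)) /\ is_derive lam t (k * flow_l n al m (xi t) (lam t)).

(** The part of l' that disappears as x tends to -oo with l bounded; what remains, exp l - n, is the
    dynamics on the axis X = 0. *)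
Definition flow_rest (n al m x l : R) := exp (p_minus_1 al * x - l) - m * exp (q_minus_1 al * (x + l)).

(* In the variable th = r^(-ep), ep = [decay_rate n al], the functions chi = - r^(n+1) u' and
   phi = r^n u solve chi' = - (th^p phi^p - m chi^q) / ep and th phi' = (chi - n phi) / ep, so phi is
   a weighted mean of chi over [0, th] and the problem is regular at th = 0, that is r = oo. *)
Definition decay_rate (n al : R) := (n - al) * q_minus_1 al.
Definition mean_exponent (n al : R) := n / decay_rate n al - 1.

Section Flow.
Context {n al m : R}.
Hypothesis Hadm : admissible n al m.

Local Notation pm := (p_minus_1 al).
Local Notation qm := (q_minus_1 al).
Local Notation be := (dulac_b n al).
Local Notation ga := (dulac_g n al).
Local Notation aa := (dulac_a n al).
Local Notation la := (ln al).
Local Notation msup := (dulac_bound n al).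
Local Notation fxi := (flow_x al).
Local Notation flam := (flow_l n al m).
Local Notation FE := (isocline_rate n al m).
Local Notation JJ := (dulac_J n al m).
Local Notation DD := (dulac_D n al m).
Local Notation VB := (lyap_bracket n al m).
Local Notation VV := (lyapunov n al m).
Local Notation SS := (flow_s n al m).
Local Notation V0 := (lyap_axis n al m).
Local Notation flow := (flow_at n al m).
Local Notation rest := (flow_rest n al m).

Let Hn : 1 <= n. Proof. apply Hadm. Qed.
Let Haln : al < n. Proof. apply Hadm. Qed.
Let Hn2 : n < 2 * al. Proof. apply Hadm. Qed.
Let Hm0 : 0 < m. Proof. apply Hadm. Qed.
Let Hm : m <= msup. Proof. apply Hadm. Qed.

(** * The Dulac divergence and the derivative of V *)

Lemma p_minus_1_pos : 0 < pm. Proof. apply Rdiv_lt_0_compat; lra. Qed.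
Lemma q_minus_1_pos : 0 < qm. Proof. apply Rdiv_lt_0_compat; lra. Qed.
Lemma q_minus_1_lt_1 : qm < 1. Proof. apply Rmult_lt_reg_r with (al + 1); [lra|]. unfold q_minus_1. field_simplify; lra. Qed.
Lemma p_minus_1_of_q_minus_1 : pm = qm * (pm + 2). Proof. unfold p_minus_1, q_minus_1. field. lra. Qed.
Lemma dulac_b_pos : 0 < be. Proof. apply Rdiv_lt_0_compat; apply Rmult_lt_0_compat; lra. Qed.
Lemma dulac_a_eq : aa = (2 * al - n) * (n + al ^ 2) / (al * (al + 1) * n).
Proof. unfold dulac_a, dulac_g, dulac_b. field. lra. Qed.
Lemma dulac_a_pos : 0 < aa.
Proof. rewrite dulac_a_eq. apply Rdiv_lt_0_compat; repeat apply Rmult_lt_0_compat; try lra. nra. Qed.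
Lemma dulac_g_pos : 0 < ga.
Proof. pose proof dulac_b_pos. apply Rdiv_lt_0_compat; [apply Rmult_lt_0_compat|]; lra. Qed.
Lemma dulac_g_al : ga * al = n * (be + 1). Proof. unfold dulac_g. field. lra. Qed.
Lemma exp_ln_al : exp la = al. Proof. apply exp_ln. lra. Qed.

(** V_l = X^g s^(b+1) (s - al) cancels against the part X^g s^(b+1) l' of V_x along the flow, and
    J(x, ln al) - J(x, l) is the rest of V_x. The factor [k] lets the same computation serve forward
    time, reversed time and the time used near infinity. *)
Lemma lyapunov_derive (xi lam : R -> R) (k t : R) :
  is_derive xi t (k * fxi (lam t)) -> is_derive lam t (k * flam (xi t) (lam t)) ->
  is_derive (fun t => VV (xi t) (lam t)) t
    (k * (exp (ga * xi t) * ((al - exp (lam t)) * (JJ (xi t) la - JJ (xi t) (lam t))))).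
Proof.
  intros H1 H2.
  pose proof dulac_b_pos; pose proof dulac_g_pos; pose proof p_minus_1_pos; pose proof q_minus_1_pos; pose proof dulac_g_al as Hga; pose proof exp_ln_al as Hla.
  unfold lyapunov, lyap_bracket, dulac_J. auto_derive.
  - repeat split; try (now eexists; eassumption).
  - change (Derive (fun x => xi x) t) with (Derive xi t); change (Derive (fun x => lam x) t) with (Derive lam t).
    rewrite (is_derive_unique _ _ _ H1), (is_derive_unique _ _ _ H2).
    unfold flow_l, flow_x. set (x := xi t); set (l := lam t).
    replace ((be + 2) * l) with (be * l + l + l) by ring.
    replace ((be + 1) * l) with (be * l + l) by ring.
    replace ((be + 1 + qm) * l) with (be * l + l + qm * l) by ring.
    replace ((be + 2) * la) with (be * la + la + la) by ring.
    replace ((be + 1 + qm) * la) with (be * la + la + qm * la) by ring.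
    replace (pm * x - l) with (pm * x + - l) by ring.
    rewrite !Rmult_plus_distr_l, !exp_plus, exp_Ropp, Hla.
    pose proof (exp_pos l). set (L := exp l) in *.
    set (B := exp (be * l)). set (Q := exp (qm * l)). set (X := exp (pm * x)). set (Y := exp (qm * x)).
    set (Z := exp (ga * x)). set (B1 := exp (be * la)). set (Q1 := exp (qm * la)).
    unfold dulac_a. set (b := be) in *. set (g := ga) in *. clearbody b g.
    (* The identity holds for every b once g al = n (b + 1); eliminating n by this relation leaves a
       rational identity. *)
    replace n with (g * al / (b + 1)) by (rewrite Hga; field; lra).
    field. repeat split; nra.
Qed.

(** exp A and exp B are the two positive terms of D up to their weights. Because pm = qm (pm + 2),
    their weighted geometric mean is a multiple of exp(qm (x + l)), and m <= [dulac_bound] compares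
    the coefficients. The value of A - B identifies the only l at which equality can occur. *)
Lemma dulac_D_ge (x l : R) :
  exists A B, DD x l >= (pm + 1) * exp A + exp B - (pm + 2) * exp (((pm + 1) * A + B) / (pm + 2))
    /\ A - B = 2 * l - (pm * x + ln be - ln (aa / (pm + 1))).
Proof.
  pose proof dulac_b_pos; pose proof dulac_a_pos; pose proof p_minus_1_pos; pose proof q_minus_1_pos.
  exists (l + ln (aa / (pm + 1))), (pm * x - l + ln be). split; [|ring].
  assert (0 < aa / (pm + 1)) by (apply Rdiv_lt_0_compat; lra).
  rewrite !exp_plus, !exp_ln by assumption.
  replace (((pm + 1) * (l + ln (aa / (pm + 1))) + (pm * x - l + ln be)) / (pm + 2))
    with (qm * (x + l) + ((pm + 1) * ln (aa / (pm + 1)) + ln be) / (pm + 2))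
    by (unfold p_minus_1, q_minus_1; field; lra).
  rewrite exp_plus. unfold dulac_D.
  set (E := exp (qm * (x + l))). pose proof (exp_pos (qm * (x + l)) : 0 < E).
  set (F := exp (((pm + 1) * ln (aa / (pm + 1)) + ln be) / (pm + 2))).
  assert (Hmb : m * (be + 1 + qm) <= (pm + 2) * F).
  { replace ((pm + 2) * F) with (msup * (be + 1 + qm)) by (unfold dulac_bound; fold F; field; lra).
    apply Rmult_le_compat_r; lra. }
  replace ((pm + 1) * (exp l * (aa / (pm + 1)))) with (aa * exp l) by (field; lra).
  assert (m * (be + 1 + qm) * E <= (pm + 2) * F * E) by (apply Rmult_le_compat_r; lra).
  lra.
Qed.

Lemma dulac_D_nonneg (x l : R) : 0 <= DD x l.
Proof.
  destruct (dulac_D_ge x l) as [A [B [H _]]]. pose proof p_minus_1_pos.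
  destruct (weighted_amgm_exp (pm + 1) A B ltac:(lra)) as [H1 _].
  replace (pm + 1 + 1) with (pm + 2) in H1 by ring. lra.
Qed.

Lemma dulac_D_pos (x l : R) : l <> (pm * x + ln be - ln (aa / (pm + 1))) / 2 -> 0 < DD x l.
Proof.
  intros Hl. destruct (dulac_D_ge x l) as [A [B [H E]]]. pose proof p_minus_1_pos.
  destruct (weighted_amgm_exp (pm + 1) A B ltac:(lra)) as [_ H1].
  replace (pm + 1 + 1) with (pm + 2) in H1 by ring.
  assert (A <> B) by (intros ->; lra). specialize (H1 H2). lra.
Qed.

Lemma dulac_J_derive (x l : R) : is_derive (JJ x) l (exp ((be + 1) * l) * DD x l).
Proof.
  pose proof dulac_b_pos. unfold dulac_J, dulac_D. auto_derive; [exact I|].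
  replace ((be + 2) * l) with (be * l + l + l) by ring.
  replace ((be + 1) * l) with (be * l + l) by ring.
  replace (qm * x + (be + 1 + qm) * l) with (be * l + l + qm * l + qm * x) by ring.
  replace (pm * x - l) with (pm * x + - l) by ring.
  rewrite !Rmult_plus_distr_l, !exp_plus, exp_Ropp.
  pose proof (exp_pos l). field. lra.
Qed.

Lemma dulac_J_le (x l1 l2 : R) : l1 <= l2 -> JJ x l1 <= JJ x l2.
Proof.
  intros H. apply (nondecreasing_of_derive _ (fun l => exp ((be + 1) * l) * DD x l)); [assumption| |].
  - intros; apply dulac_J_derive.
  - intros. apply Rmult_le_pos; [left; apply exp_pos|apply dulac_D_nonneg].
Qed.

Lemma dulac_J_lt_aux (x l1 l2 c : R) : l1 < l2 -> (forall l, l1 <= l <= l2 -> l <> c -> 0 < DD x l) ->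
  c < l1 \/ l2 < c -> JJ x l1 < JJ x l2.
Proof.
  intros H HD Hc.
  destruct (mean_value (JJ x) (fun l => exp ((be + 1) * l) * DD x l) l1 l2) as [d [Hd E]]; [lra| |].
  - intros; apply dulac_J_derive.
  - assert (0 < exp ((be + 1) * d) * DD x d * (l2 - l1)); [|lra].
    apply Rmult_lt_0_compat; [apply Rmult_lt_0_compat|]; [apply exp_pos|apply HD; lra|lra].
Qed.

(** For given x the density can vanish only at [c]. Depending on the side of the midpoint on which
    [c] lies, one end piece of the interval avoids it and yields the strict increase. *)
Lemma dulac_J_lt (x l1 l2 : R) : l1 < l2 -> JJ x l1 < JJ x l2.
Proof.
  intros H. set (c := (pm * x + ln be - ln (aa / (pm + 1))) / 2).
  assert (HD : forall l, l <> c -> 0 < DD x l) by (intros; now apply dulac_D_pos).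
  destruct (Rle_lt_dec c ((l1 + l2) / 2)) as [Hc|Hc].
  - apply Rle_lt_trans with (JJ x (l1 / 3 + 2 * l2 / 3)); [apply dulac_J_le; lra|].
    apply (dulac_J_lt_aux x _ _ c); [lra|auto|lra].
  - apply Rlt_le_trans with (JJ x (l1 / 2 + l2 / 2)); [|apply dulac_J_le; lra].
    apply (dulac_J_lt_aux x _ _ c); [lra|auto|lra].
Qed.

Let Hpm : 0 < pm. Proof. exact p_minus_1_pos. Qed.
Let Hqm : 0 < qm. Proof. exact q_minus_1_pos. Qed.
Let Hbe : 0 < be. Proof. exact dulac_b_pos. Qed.
Let Hga : 0 < ga. Proof. exact dulac_g_pos. Qed.
Let Haa : 0 < aa. Proof. exact dulac_a_pos. Qed.

(** * The isocline s = al and the stationary point *)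

Lemma slope_derive (lam : R -> R) (x k t : R) :
  is_derive lam t (k * flam x (lam t)) ->
  is_derive (fun t => exp (lam t)) t (k * SS x (lam t)).
Proof.
  intros H. auto_derive; [now eexists; eassumption|].
  change (Derive (fun x => lam x) t) with (Derive lam t). rewrite (is_derive_unique _ _ _ H).
  unfold flow_l, flow_s. replace (pm * x - lam t) with (pm * x + - lam t) by ring.
  replace (qm * x + (1 + qm) * lam t) with (qm * (x + lam t) + lam t) by ring.
  rewrite !exp_plus, exp_Ropp. pose proof (exp_pos (lam t)). field. lra.
Qed.

Lemma flow_s_ln_al (x : R) : SS x la = FE x.
Proof.
  unfold flow_s, isocline_rate. rewrite !exp_plus, exp_ln_al. ring.
Qed.

(** The exponential in pm x is eliminated in favour of [isocline_rate], so that the sign of V on the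
    isocline can be read off from the sign of s' there. *)
Lemma lyapunov_ln_al (x : R) :
  VV x la = exp (ga * x) * exp (be * la) *
    (FE x / (ga + pm) - m * exp ((1 + qm) * la) * exp (qm * x) * (1 / (ga + qm) - 1 / (ga + pm))
     - al * (n - al) * (1 / ga - 1 / (ga + pm))).
Proof.
  pose proof dulac_g_al as Hg.
  unfold lyapunov, lyap_bracket, isocline_rate.
  replace ((be + 2) * la) with (be * la + la + la) by ring.
  replace ((be + 1) * la) with (be * la + la) by ring.
  replace ((be + 1 + qm) * la) with (be * la + (la + qm * la)) by ring.
  replace ((1 + qm) * la) with (la + qm * la) by ring.
  rewrite !exp_plus, !exp_ln_al.
  unfold dulac_a. set (b := be) in *. set (g := ga) in *. clearbody b g.
  replace n with (g * al / (b + 1)) by (rewrite Hg; field; lra).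
  field. repeat split; nra.
Qed.

Lemma q_minus_1_lt_p_minus_1 : qm < pm.
Proof. rewrite p_minus_1_of_q_minus_1. nra. Qed.

(** 1 / (ga + pm) is smaller than 1 / (ga + qm) and 1 / ga, so both remaining terms are negative. It
    gives V < 0 at the stationary point, and in contrapositive form s' > 0 wherever a trajectory
    with V > 0 meets s = al. *)
Lemma lyapunov_ln_al_neg (x : R) : FE x <= 0 -> VV x la < 0.
Proof.
  intros HF. rewrite lyapunov_ln_al. pose proof q_minus_1_lt_p_minus_1 as Hpq.
  assert (0 < exp (ga * x) * exp (be * la)) by (apply Rmult_lt_0_compat; apply exp_pos).
  assert (H1 : 1 / (ga + pm) < 1 / (ga + qm)) by (apply Rmult_lt_compat_l; [lra|apply Rinv_lt_contravar; nra]).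
  assert (H2 : 1 / (ga + pm) < 1 / ga) by (apply Rmult_lt_compat_l; [lra|apply Rinv_lt_contravar; nra]).
  assert (FE x / (ga + pm) <= 0).
  { assert (0 < / (ga + pm)) by (apply Rinv_0_lt_compat; lra). unfold Rdiv. nra. }
  assert (0 < m * exp ((1 + qm) * la) * exp (qm * x)) by (repeat apply Rmult_lt_0_compat; try apply exp_pos; lra).
  assert (0 < al * (n - al)) by (apply Rmult_lt_0_compat; lra).
  assert (0 < m * exp ((1 + qm) * la) * exp (qm * x) * (1 / (ga + qm) - 1 / (ga + pm)))
    by (apply Rmult_lt_0_compat; lra).
  assert (0 < al * (n - al) * (1 / ga - 1 / (ga + pm))) by (apply Rmult_lt_0_compat; lra).
  nra.
Qed.

(** After division by exp(qm x) the middle term is constant and, as qm < pm and al < n, the two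
    others are increasing. This is the monotonicity behind the uniqueness of X_M. *)
Lemma isocline_rate_quot_lt (x y : R) : x < y -> FE x * exp (- (qm * x)) < FE y * exp (- (qm * y)).
Proof.
  intros Hxy. pose proof q_minus_1_lt_p_minus_1.
  assert (E : forall z, FE z * exp (- (qm * z)) =
    exp ((pm - qm) * z) - m * exp ((1 + qm) * la) - al * (n - al) * exp (- (qm * z))).
  { intros z. unfold isocline_rate. replace ((pm - qm) * z) with (pm * z + - (qm * z)) by ring.
    rewrite exp_plus, exp_Ropp. pose proof (exp_pos (qm * z)). field. lra. }
  rewrite !E.
  assert (exp ((pm - qm) * x) < exp ((pm - qm) * y)) by (apply exp_increasing; nra).
  assert (exp (- (qm * y)) < exp (- (qm * x))) by (apply exp_increasing; nra).
  assert (0 < al * (n - al)) by (apply Rmult_lt_0_compat; lra).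
  nra.
Qed.

Lemma isocline_rate_continuity : continuity FE.
Proof. intros x. eapply is_derive_continuity_pt with (l := Derive FE x).
  apply Derive_correct. unfold isocline_rate. auto_derive. exact I. Qed.

Lemma exp_p_ge_square (x : R) : 0 <= x ->
  exp (qm * x) * exp (qm * x) <= exp (pm * x).
Proof.
  intros Hx. rewrite <- exp_plus. apply exp_le_compat. rewrite p_minus_1_of_q_minus_1.
  assert (0 <= qm * x * pm) by (apply Rmult_le_pos; [apply Rmult_le_pos|]; lra). replace (qm * (pm + 2) * x) with (qm * x * pm + 2 * (qm * x)) by ring. lra.
Qed.

Lemma isocline_rate_root : exists x0, FE x0 = 0.
Proof.
  pose proof q_minus_1_lt_p_minus_1.
  set (c := m * exp ((1 + qm) * la)). assert (Hc : 0 < c) by (apply Rmult_lt_0_compat; [lra|apply exp_pos]).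
  assert (Hd : 0 < al * (n - al)) by (apply Rmult_lt_0_compat; lra).
  destruct (exp_small pm 1 (al * (n - al)) Hpm ltac:(lra) Hd) as [x1 Hx1].
  specialize (Hx1 x1 (Rle_refl _)).
  (* With y = exp(qm x2) = w > 1, exp(pm x2) is at least y^2 = w y, which exceeds c y + al (n -
     al). *)
  set (w := 1 + c + al * (n - al)).
  set (x2 := ln w / qm).
  assert (Hw : exp (qm * x2) = w).
  { unfold x2. replace (qm * (ln w / qm)) with (ln w) by (field; lra). apply exp_ln. unfold w; lra. }
  assert (Hx2 : 0 <= x2).
  { unfold x2. apply Rmult_le_pos; [|left; apply Rinv_0_lt_compat; lra].
    rewrite <- ln_1. apply ln_le; unfold w; lra. }
  assert (H1 : FE x1 < 0).
  { unfold isocline_rate. fold c. pose proof (exp_pos (qm * x1)). nra. }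
  assert (H2 : 0 < FE x2).
  { pose proof (exp_p_ge_square x2 Hx2) as HQ. unfold isocline_rate. fold c. rewrite Hw in *. unfold w in *. nra. }
  destruct (IVT_gen FE x1 x2 0) as [x [_ Hx]].
  - exact isocline_rate_continuity.
  - rewrite Rmin_left, Rmax_right by lra. lra.
  - now exists x.
Qed.

(** * Sign and level sets of V *)

(** J is nondecreasing in l, and its only negative term vanishes as l tends to -oo. *)
Lemma dulac_J_ln_al_nonneg (x : R) : 0 <= JJ x la.
Proof.
  apply (nonneg_of_exp_bound (be + 1 + qm) (m * exp (qm * x)) la); [lra| |].
  - apply Rmult_le_pos; [lra|left; apply exp_pos].
  - intros l Hl. apply Rle_trans with (JJ x l); [|apply dulac_J_le; assumption].
    unfold dulac_J. rewrite (exp_plus (qm * x)).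
    pose proof (exp_pos (pm * x + be * l)).
    assert (0 < aa * exp ((be + 2) * l) / (be + 2))
      by (apply Rdiv_lt_0_compat; [apply Rmult_lt_0_compat; [lra|apply exp_pos]|lra]).
    lra.
Qed.

(** Its derivative is X^g J(x, ln al) >= 0, and its only negative term vanishes as x tends to
    -oo. *)
Lemma lyap_axis_nonneg (x : R) : 0 <= V0 x.
Proof.
  apply (nonneg_of_exp_bound (ga + qm) (m * exp ((be + 1 + qm) * la) / (ga + qm)) x); [lra| |].
  - apply Rmult_le_pos; [|left; apply Rinv_0_lt_compat; lra].
    apply Rmult_le_pos; [lra|left; apply exp_pos].
  - intros y Hy. apply Rle_trans with (V0 y).
    + unfold lyap_axis. replace ((ga + qm) * y) with (ga * y + qm * y) by ring. rewrite (exp_plus (ga * y)), (exp_plus _ (qm * y)).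
      assert (0 < aa * exp ((be + 2) * la) / (ga * (be + 2))).
      { apply Rdiv_lt_0_compat; apply Rmult_lt_0_compat; try apply exp_pos; lra. }
      assert (0 < exp (be * la + pm * y) / (ga + pm)) by (apply Rdiv_lt_0_compat; [apply exp_pos|lra]).
      pose proof (exp_pos (ga * y)).
      assert (0 < exp (ga * y) * (aa * exp ((be + 2) * la) / (ga * (be + 2)) + exp (be * la + pm * y) / (ga + pm)))
        by (apply Rmult_lt_0_compat; lra).
      unfold Rdiv in *. lra.
    + apply (nondecreasing_of_derive V0 (fun z => exp (ga * z) * JJ z la)); [assumption| |].
      * intros z _. unfold lyap_axis, dulac_J. auto_derive; [exact I|].
        rewrite !exp_plus. field. repeat split; nra.
      * intros z _. apply Rmult_le_pos; [left; apply exp_pos|apply dulac_J_ln_al_nonneg].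
Qed.

(** V minus its value on the axis has a single negative term, of order X^g s^(b+1). Hence V can be
    definitely negative only where this product is not small. *)
Lemma lyapunov_ge (x l : R) : - (al / (be + 1) * exp (ga * x + (be + 1) * l)) <= VV x l.
Proof.
  pose proof (lyap_axis_nonneg x). unfold lyap_axis in H. unfold lyapunov, lyap_bracket.
  rewrite exp_plus.
  assert (0 < exp ((be + 2) * l) / (be + 2)) by (apply Rdiv_lt_0_compat; [apply exp_pos|lra]).
  pose proof (exp_pos (ga * x)).
  assert (0 < exp (ga * x) * (exp ((be + 2) * l) / (be + 2))) by (apply Rmult_lt_0_compat; lra).
  unfold Rdiv in *. lra.
Qed.

Lemma lyap_bracket_ge (x l : R) :
  exp ((be + 1) * l) * (exp l / (be + 2) - al / (be + 1)) + exp (be * la) / (ga + pm) * exp (pm * x)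
  - m * exp ((be + 1 + qm) * la) / (ga + qm) * exp (qm * x) <= VB x l.
Proof.
  unfold lyap_bracket. replace ((be + 2) * l) with ((be + 1) * l + l) by ring. rewrite !exp_plus.
  assert (0 < aa * exp ((be + 2) * la) / (ga * (be + 2))).
  { apply Rdiv_lt_0_compat; apply Rmult_lt_0_compat; try apply exp_pos; lra. }
  unfold Rdiv in *. lra.
Qed.

Lemma lyap_bracket_neg (x l : R) : VV x l < 0 -> VB x l < 0.
Proof.
  unfold lyapunov. intros H. pose proof (exp_pos (ga * x)). nra.
Qed.

(** The logarithm on the left is the l at which the second factor changes sign: beyond it the
    product is nonnegative, before it each factor is estimated separately. *)
Lemma exp_bracket_ge (l : R) :
  - (al / (be + 1) * exp ((be + 1) * ln (al * (be + 2) / (be + 1))))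
  <= exp ((be + 1) * l) * (exp l / (be + 2) - al / (be + 1)).
Proof.
  assert (Hal : 0 < al) by lra.
  assert (Hr : 0 < al * (be + 2) / (be + 1)) by (apply Rdiv_lt_0_compat; nra).
  assert (Hab : 0 < al / (be + 1)) by (apply Rdiv_lt_0_compat; lra).
  pose proof (exp_pos ((be + 1) * l)). pose proof (exp_pos ((be + 1) * ln (al * (be + 2) / (be + 1)))).
  assert (0 < exp l / (be + 2)) by (apply Rdiv_lt_0_compat; [apply exp_pos|lra]).
  destruct (Rle_lt_dec (ln (al * (be + 2) / (be + 1))) l) as [Hl|Hl].
  - apply exp_le_compat in Hl. rewrite exp_ln in Hl by assumption.
    assert (al / (be + 1) <= exp l / (be + 2)).
    { apply Rmult_le_reg_r with (be + 2); [lra|]. unfold Rdiv in *.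
      rewrite (Rmult_assoc (exp l)), Rinv_l by lra. lra. }
    nra.
  - assert (exp ((be + 1) * l) <= exp ((be + 1) * ln (al * (be + 2) / (be + 1)))).
    { apply exp_le_compat. nra. }
    nra.
Qed.

(** x is bounded first, since for x > 0 the term in exp(pm x) is at least of the order of exp(qm
    x)^2 and beats the negative one. With x bounded, the term exp((b+2) l) bounds l. *)
Lemma lyapunov_neg_bounded : exists A, forall x l, VV x l < 0 -> x <= A /\ l <= A.
Proof.
  set (G := al / (be + 1) * exp ((be + 1) * ln (al * (be + 2) / (be + 1)))).
  assert (HG : 0 < G).
  { apply Rmult_lt_0_compat; [apply Rdiv_lt_0_compat; lra|apply exp_pos]. }
  set (c1 := exp (be * la) / (ga + pm)). set (c2 := m * exp ((be + 1 + qm) * la) / (ga + qm)).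
  assert (Hc1 : 0 < c1) by (apply Rdiv_lt_0_compat; [apply exp_pos|lra]).
  assert (Hc2 : 0 < c2) by (apply Rdiv_lt_0_compat; [apply Rmult_lt_0_compat; [lra|apply exp_pos]|lra]).
  (* For y = exp(qm x) > w > 1 one has c1 y^2 > (c1 + G + c2) y, which is incompatible with c1 y^2 <
     G + c2 y. *)
  set (w := 1 + (G + c2) / c1).
  assert (Hw : 1 < w).
  { assert (0 < (G + c2) / c1) by (apply Rdiv_lt_0_compat; lra). unfold w; lra. }
  assert (Hx : forall x l, VV x l < 0 -> exp (qm * x) <= w).
  { intros x l H. apply lyap_bracket_neg in H. pose proof (lyap_bracket_ge x l) as H1. pose proof (exp_bracket_ge l) as H2.
    fold G c1 c2 in H1, H2.
    destruct (Rle_lt_dec x 0) as [Hx|Hx].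
    - apply Rle_trans with 1; [|lra]. rewrite <- exp_0. apply exp_le_compat. nra.
    - pose proof (exp_p_ge_square x ltac:(lra)) as HQ.
      assert (H1w : 1 <= exp (qm * x)).
      { rewrite <- exp_0. apply exp_le_compat. nra. }
      apply Rnot_lt_le. intros Hlt. set (y := exp (qm * x)) in *.
      assert (Hcw : c1 * w = c1 + G + c2) by (unfold w; field; lra).
      assert (c1 * (y * y) <= c1 * exp (pm * x)) by (apply Rmult_le_compat_l; lra).
      assert (c1 * w < c1 * y) by (apply Rmult_lt_compat_l; lra).
      assert ((c1 + G + c2) * y < c1 * (y * y)) by (rewrite <- Hcw, <- Rmult_assoc; apply Rmult_lt_compat_r; lra).
      nra. }
  set (L := (be + 2) * (al / (be + 1) + c2 * w) + 1).
  assert (HL : 1 <= L).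
  { assert (0 < al / (be + 1)) by (apply Rdiv_lt_0_compat; lra).
    assert (0 < c2 * w) by (apply Rmult_lt_0_compat; lra). unfold L. nra. }
  assert (Hl : forall x l, VV x l < 0 -> exp l <= L).
  { intros x l H. specialize (Hx x l H). apply lyap_bracket_neg in H. pose proof (lyap_bracket_ge x l) as H1.
    fold c1 c2 in H1. apply Rnot_lt_le. intros Hlt.
    assert (0 < c1 * exp (pm * x)) by (apply Rmult_lt_0_compat; [lra|apply exp_pos]).
    assert (c2 * exp (qm * x) <= c2 * w) by (apply Rmult_le_compat_l; lra).
    assert (1 <= exp ((be + 1) * l)).
    { rewrite <- exp_0 at 1. apply exp_le_compat. apply Rmult_le_pos; [lra|].
      left. apply exp_lt_inv. rewrite exp_0. lra. }
    assert (c2 * w < exp l / (be + 2) - al / (be + 1)).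
    { assert (L / (be + 2) < exp l / (be + 2)) by (apply Rmult_lt_compat_r; [apply Rinv_0_lt_compat|]; lra).
      assert (L / (be + 2) = al / (be + 1) + c2 * w + / (be + 2)) by (unfold L; field; lra).
      assert (0 < / (be + 2)) by (apply Rinv_0_lt_compat; lra). lra. }
    assert (0 < c2 * w) by (apply Rmult_lt_0_compat; lra).
    nra. }
  exists (Rmax (ln w / qm) (ln L)). intros x l H. split.
  - eapply Rle_trans; [|apply Rmax_l]. specialize (Hx x l H).
    apply ln_le in Hx; [|apply exp_pos]. rewrite ln_exp in Hx.
    apply Rmult_le_reg_l with qm; [lra|]. replace (qm * (ln w / qm)) with (ln w) by (field; lra). exact Hx.
  - eapply Rle_trans; [|apply Rmax_r]. specialize (Hl x l H).
    apply ln_le in Hl; [|apply exp_pos]. rewrite ln_exp in Hl. exact Hl.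
Qed.

(** By [lyapunov_ge] the product X^g s^(b+1) is bounded below; as both factors are bounded above,
    each is bounded away from 0. *)
Lemma lyapunov_le_neg_bounded (d : R) : 0 < d ->
  exists A, forall x l, VV x l <= - d -> - A <= x /\ - A <= l.
Proof.
  intros Hd. destruct lyapunov_neg_bounded as [A HA].
  set (k := al / (be + 1)). assert (Hk : 0 < k) by (apply Rdiv_lt_0_compat; lra).
  destruct (exp_small ga (k * exp ((be + 1) * A)) d) as [A1 H1]; [lra| |lra|].
  { apply Rmult_le_pos; [lra|left; apply exp_pos]. }
  destruct (exp_small (be + 1) (k * exp (ga * A)) d) as [A2 H2]; [lra| |lra|].
  { apply Rmult_le_pos; [lra|left; apply exp_pos]. }
  exists (Rmax (- A1) (- A2)). intros x l HV.
  destruct (HA x l ltac:(lra)) as [Hx Hl].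
  pose proof (lyapunov_ge x l) as HG. fold k in HG. rewrite exp_plus in HG.
  assert (E1 : exp (ga * x) <= exp (ga * A)) by (apply exp_le_compat; nra).
  assert (E2 : exp ((be + 1) * l) <= exp ((be + 1) * A)) by (apply exp_le_compat; nra).
  pose proof (exp_pos (ga * x)). pose proof (exp_pos ((be + 1) * l)).
  split.
  - apply Rnot_lt_le. intros Hlt. pose proof (Rmax_l (- A1) (- A2)).
    specialize (H1 x ltac:(lra)).
    assert (k * (exp (ga * x) * exp ((be + 1) * l)) <= k * exp ((be + 1) * A) * exp (ga * x)).
    { rewrite Rmult_assoc. apply Rmult_le_compat_l; nra. }
    lra.
  - apply Rnot_lt_le. intros Hlt. pose proof (Rmax_r (- A1) (- A2)).
    specialize (H2 l ltac:(lra)).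
    assert (k * (exp (ga * x) * exp ((be + 1) * l)) <= k * exp (ga * A) * exp ((be + 1) * l)).
    { rewrite Rmult_assoc. apply Rmult_le_compat_l; nra. }
    lra.
Qed.

Lemma lyap_bracket_upper (A : R) : exists C, 0 < C /\ forall x l, x <= A -> l <= A -> VB x l <= C.
Proof.
  exists (exp ((be + 2) * A) / (be + 2) + aa * exp ((be + 2) * la) / (ga * (be + 2))
     + exp (be * la + pm * A) / (ga + pm)).
  assert (0 < aa * exp ((be + 2) * la) / (ga * (be + 2))).
  { apply Rdiv_lt_0_compat; apply Rmult_lt_0_compat; try apply exp_pos; lra. }
  split.
  - assert (0 < exp ((be + 2) * A) / (be + 2)) by (apply Rdiv_lt_0_compat; [apply exp_pos|lra]).
    assert (0 < exp (be * la + pm * A) / (ga + pm)) by (apply Rdiv_lt_0_compat; [apply exp_pos|lra]).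
    lra.
  - intros x l Hx Hl. unfold lyap_bracket.
    assert (exp ((be + 2) * l) / (be + 2) <= exp ((be + 2) * A) / (be + 2)).
    { apply Rmult_le_compat_r; [left; apply Rinv_0_lt_compat; lra|]. apply exp_le_compat. nra. }
    assert (exp (be * la + pm * x) / (ga + pm) <= exp (be * la + pm * A) / (ga + pm)).
    { apply Rmult_le_compat_r; [left; apply Rinv_0_lt_compat; lra|]. apply exp_le_compat. nra. }
    assert (0 < al * exp ((be + 1) * l) / (be + 1)).
    { apply Rdiv_lt_0_compat; [apply Rmult_lt_0_compat; [lra|apply exp_pos]|lra]. }
    assert (0 < m * exp ((be + 1 + qm) * la + qm * x) / (ga + qm)).
    { apply Rdiv_lt_0_compat; [apply Rmult_lt_0_compat; [lra|apply exp_pos]|lra]. }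
    lra.
Qed.

Lemma lyapunov_upper (A : R) : exists C, 0 < C /\ forall x l, x <= A -> l <= A -> VV x l <= C * exp (ga * x).
Proof.
  destruct (lyap_bracket_upper A) as [C [HC H]]. exists C. split; [assumption|]. intros x l Hx Hl.
  unfold lyapunov. rewrite Rmult_comm. apply Rmult_le_compat_r; [left; apply exp_pos|auto].
Qed.

Lemma lyapunov_bounded (A : R) : exists C, forall x l, x <= A -> l <= A -> Rabs (VV x l) <= C.
Proof.
  destruct (lyapunov_upper A) as [C [HC H]].
  exists (Rmax (C * exp (ga * A)) (al / (be + 1) * exp (ga * A + (be + 1) * A))).
  intros x l Hx Hl. apply Rabs_le_between.
  assert (0 < al / (be + 1)) by (apply Rdiv_lt_0_compat; lra).
  split.
  - eapply Rle_trans; [|apply lyapunov_ge]. apply Ropp_le_contravar.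
    eapply Rle_trans; [|apply Rmax_r]. apply Rmult_le_compat_l; [lra|]. apply exp_le_compat. nra.
  - eapply Rle_trans; [apply H; assumption|]. eapply Rle_trans; [|apply Rmax_l].
    apply Rmult_le_compat_l; [lra|]. apply exp_le_compat. nra.
Qed.

(** When X and s both tend to 0 the bracket tends to the positive constant [c], although V itself
    tends to 0. This gives the initial sign along a ground state. *)
Lemma lyapunov_pos_near_regular : exists A, forall x l, x <= A -> l <= A -> 0 < VV x l.
Proof.
  set (c := aa * exp ((be + 2) * la) / (ga * (be + 2))).
  assert (Hc : 0 < c).
  { apply Rdiv_lt_0_compat; apply Rmult_lt_0_compat; try apply exp_pos; lra. }
  destruct (exp_small (be + 1) (al / (be + 1)) (c / 2)) as [A1 H1]; [lra| |lra|].
  { left; apply Rdiv_lt_0_compat; lra. }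
  destruct (exp_small qm (m * exp ((be + 1 + qm) * la) / (ga + qm)) (c / 2)) as [A2 H2]; [lra| |lra|].
  { left; apply Rdiv_lt_0_compat; [apply Rmult_lt_0_compat; [lra|apply exp_pos]|lra]. }
  exists (Rmin A1 A2). intros x l Hx Hl. unfold lyapunov. apply Rmult_lt_0_compat; [apply exp_pos|].
  unfold lyap_bracket. fold c. rewrite (exp_plus _ (qm * x)).
  pose proof (Rmin_l A1 A2). pose proof (Rmin_r A1 A2).
  specialize (H1 l ltac:(lra)). specialize (H2 x ltac:(lra)).
  assert (0 < exp ((be + 2) * l) / (be + 2)) by (apply Rdiv_lt_0_compat; [apply exp_pos|lra]).
  assert (0 < exp (be * la + pm * x) / (ga + pm)) by (apply Rdiv_lt_0_compat; [apply exp_pos|lra]).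
  unfold Rdiv in *. lra.
Qed.

Lemma lyapunov_neg_near_stable : exists A e, 0 < e /\ forall x l, x <= A -> Rabs (l - ln n) < e -> VV x l < 0.
Proof.
  set (h := fun l => exp ((be + 2) * l) / (be + 2) - al * exp ((be + 1) * l) / (be + 1)
      + aa * exp ((be + 2) * la) / (ga * (be + 2))).
  assert (Hh : h (ln n) < 0).
  { assert (E : h (ln n) = - (aa / (ga * (be + 2)) * (exp ((be + 2) * ln n) - exp ((be + 2) * la)))).
    { unfold h. replace ((be + 2) * ln n) with ((be + 1) * ln n + ln n) by ring.
      rewrite exp_plus, exp_ln by lra.
      pose proof dulac_g_al as Hg.
      replace (al * exp ((be + 1) * ln n) / (be + 1)) with (n / ga * exp ((be + 1) * ln n)).
      2:{ replace (n / ga) with (al / (be + 1)); [field; lra|]. field_simplify_eq; lra. }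
      unfold dulac_a. field. lra. }
    rewrite E.
    assert (exp ((be + 2) * la) < exp ((be + 2) * ln n)).
    { apply exp_increasing. apply Rmult_lt_compat_l; [lra|]. apply ln_increasing; lra. }
    assert (0 < aa / (ga * (be + 2))) by (apply Rdiv_lt_0_compat; [lra|apply Rmult_lt_0_compat; lra]).
    nra. }
  destruct (continuity_pt_lt h (ln n) (h (ln n) / 2)) as [e [He H]]; [|lra|].
  { eapply is_derive_continuity_pt with (l := Derive h (ln n)). apply Derive_correct.
    unfold h. auto_derive. exact I. }
  destruct (exp_small pm (exp (be * la) / (ga + pm)) (- (h (ln n) / 2))) as [A HA]; [lra| |lra|].
  { left. apply Rdiv_lt_0_compat; [apply exp_pos|lra]. }
  exists A, e. split; [assumption|]. intros x l Hx Hl.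
  specialize (H l Hl). specialize (HA x Hx).
  assert (VB x l < 0).
  { unfold lyap_bracket. rewrite (exp_plus (be * la)).
    assert (0 < m * exp ((be + 1 + qm) * la + qm * x) / (ga + qm)).
    { apply Rdiv_lt_0_compat; [apply Rmult_lt_0_compat; [lra|apply exp_pos]|lra]. }
    unfold h in *. unfold Rdiv in *. lra. }
  unfold lyapunov. pose proof (exp_pos (ga * x)). nra.
Qed.

(** * Bounded trajectories that avoid X = 0 converge to the stationary point *)

Local Notation dV x l := (exp (ga * x) * ((al - exp l) * (JJ x la - JJ x l))).

Lemma lyapunov_rate_nonneg (x l : R) : 0 <= dV x l.
Proof.
  apply Rmult_le_pos; [left; apply exp_pos|]. pose proof exp_ln_al as Hal.
  destruct (Rle_lt_dec l la) as [H|H].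
  - pose proof (dulac_J_le x l la H). apply exp_le_compat in H. rewrite Hal in H. apply Rmult_le_pos; lra.
  - pose proof (dulac_J_le x la l ltac:(lra)). apply exp_increasing in H. rewrite Hal in H.
    replace ((al - exp l) * (JJ x la - JJ x l)) with ((exp l - al) * (JJ x l - JJ x la)) by ring.
    apply Rmult_le_pos; lra.
Qed.

Lemma dulac_J_continuity_x (l x : R) : continuity_pt (fun x => JJ x l) x.
Proof.
  eapply is_derive_continuity_pt with (l := Derive (fun x => JJ x l) x). apply Derive_correct.
  unfold dulac_J. auto_derive. exact I.
Qed.

Lemma dulac_J_gap (A l1 l2 : R) : 0 <= A -> l1 < l2 ->
  exists c, 0 < c /\ forall x, - A <= x <= A -> c <= JJ x l2 - JJ x l1.
Proof.
  intros HA Hl. destruct (continuity_ab_min (fun x => JJ x l2 - JJ x l1) (- A) A) as [x0 [H _]]; [lra| |].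
  - intros c _. apply continuity_pt_minus; apply dulac_J_continuity_x.
  - exists (JJ x0 l2 - JJ x0 l1). split; [pose proof (dulac_J_lt x0 l1 l2 Hl); lra|exact H].
Qed.

(** Monotonicity of J in l reduces the claim to the two levels s = al - e and s = al + e, so that
    compactness is needed in x only and l may be unbounded. *)
Lemma lyapunov_rate_gap (A e : R) : 0 <= A -> 0 < e < al ->
  exists c, 0 < c /\ forall x l, - A <= x <= A -> e <= Rabs (exp l - al) -> c <= dV x l.
Proof.
  intros HA He. pose proof exp_ln_al as Hal.
  assert (L1 : ln (al - e) < la) by (apply ln_increasing; lra).
  assert (L2 : la < ln (al + e)) by (apply ln_increasing; lra).
  destruct (dulac_J_gap A _ _ HA L1) as [c1 [Hc1 H1]]. destruct (dulac_J_gap A _ _ HA L2) as [c2 [Hc2 H2]].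
  set (c := Rmin c1 c2). assert (Hc : 0 < c) by (apply Rmin_glb_lt; assumption).
  exists (exp (- (ga * A)) * (e * c)). split.
  { apply Rmult_lt_0_compat; [apply exp_pos|apply Rmult_lt_0_compat; lra]. }
  intros x l Hx Hl. specialize (H1 x Hx). specialize (H2 x Hx).
  apply Rmult_le_compat; [left; apply exp_pos|apply Rmult_le_pos; lra| |].
  { apply exp_le_compat. nra. }
  pose proof (Rmin_l c1 c2). pose proof (Rmin_r c1 c2). fold c in H, H0.
  unfold Rabs in Hl. destruct (Rcase_abs (exp l - al)).
  - assert (l <= ln (al - e)).
    { rewrite <- (ln_exp l). apply ln_le; [apply exp_pos|lra]. }
    pose proof (dulac_J_le x _ _ H3). apply Rmult_le_compat; lra.
  - assert (ln (al + e) <= l).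
    { rewrite <- (ln_exp l). apply ln_le; lra. }
    pose proof (dulac_J_le x _ _ H3).
    replace ((al - exp l) * (JJ x la - JJ x l)) with ((exp l - al) * (JJ x l - JJ x la)) by ring.
    apply Rmult_le_compat; lra.
Qed.

Lemma flow_s_bounded (A : R) : exists L, 0 < L /\ forall x l, x <= A -> l <= A -> Rabs (SS x l) <= L.
Proof.
  exists (exp A * exp A + n * exp A + exp (pm * A) + m * exp (qm * A + (1 + qm) * A)).
  pose proof (exp_pos A). pose proof (exp_pos (pm * A)). pose proof (exp_pos (qm * A + (1 + qm) * A)).
  assert (0 < exp A * exp A) by (apply Rmult_lt_0_compat; lra).
  assert (0 < n * exp A) by (apply Rmult_lt_0_compat; lra).
  assert (0 < m * exp (qm * A + (1 + qm) * A)) by (apply Rmult_lt_0_compat; lra).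
  split; [lra|]. intros x l Hx Hl. unfold flow_s.
  assert (E1 : exp l <= exp A) by (now apply exp_le_compat).
  assert (E2 : exp (pm * x) <= exp (pm * A)) by (apply exp_le_compat, Rmult_le_compat_l; lra).
  assert (E3 : exp (qm * x + (1 + qm) * l) <= exp (qm * A + (1 + qm) * A)).
  { apply exp_le_compat, Rplus_le_compat; apply Rmult_le_compat_l; lra. }
  pose proof (exp_pos l). pose proof (exp_pos (pm * x)). pose proof (exp_pos (qm * x + (1 + qm) * l)).
  assert (exp l * exp l <= exp A * exp A) by (apply Rmult_le_compat; lra).
  assert (0 < exp l * exp l) by (apply Rmult_lt_0_compat; lra).
  assert (n * exp l <= n * exp A) by (apply Rmult_le_compat_l; lra).
  assert (0 < n * exp l) by (apply Rmult_lt_0_compat; lra).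
  assert (m * exp (qm * x + (1 + qm) * l) <= m * exp (qm * A + (1 + qm) * A)) by (apply Rmult_le_compat_l; lra).
  assert (0 < m * exp (qm * x + (1 + qm) * l)) by (apply Rmult_lt_0_compat; lra).
  apply Rabs_le_between. lra.
Qed.

Lemma isocline_rate_bounded_derive (A : R) : exists L, 0 < L /\ forall x, x <= A ->
  exists d, is_derive FE x d /\ Rabs d <= L.
Proof.
  set (c := m * exp ((1 + qm) * la)). assert (Hc : 0 < c) by (apply Rmult_lt_0_compat; [lra|apply exp_pos]).
  exists (pm * exp (pm * A) + c * (qm * exp (qm * A))).
  assert (0 < pm * exp (pm * A)) by (apply Rmult_lt_0_compat; [lra|apply exp_pos]).
  assert (0 < c * (qm * exp (qm * A))) by (apply Rmult_lt_0_compat; [lra|apply Rmult_lt_0_compat; [lra|apply exp_pos]]).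
  split; [lra|]. intros x Hx.
  exists (pm * exp (pm * x) - c * (qm * exp (qm * x))). split.
  - unfold isocline_rate. fold c. auto_derive; [exact I|]. ring.
  - assert (exp (pm * x) <= exp (pm * A)) by (apply exp_le_compat, Rmult_le_compat_l; lra).
    assert (exp (qm * x) <= exp (qm * A)) by (apply exp_le_compat, Rmult_le_compat_l; lra).
    assert (pm * exp (pm * x) <= pm * exp (pm * A)) by (apply Rmult_le_compat_l; lra).
    assert (c * (qm * exp (qm * x)) <= c * (qm * exp (qm * A))) by (repeat apply Rmult_le_compat_l; lra).
    assert (0 < pm * exp (pm * x)) by (apply Rmult_lt_0_compat; [lra|apply exp_pos]).
    assert (0 < c * (qm * exp (qm * x))) by (apply Rmult_lt_0_compat; [lra|apply Rmult_lt_0_compat; [lra|apply exp_pos]]).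
    apply Rabs_le_between. lra.
Qed.

Lemma flow_s_near_ln_al (A e : R) : 0 < e -> exists d, 0 < d /\
  forall x l, x <= A -> Rabs (exp l - al) < d -> Rabs (SS x l - FE x) < e.
Proof.
  intros He.
  set (M := m * exp (qm * A)). assert (HM : 0 < M) by (apply Rmult_lt_0_compat; [lra|apply exp_pos]).
  set (h := fun s => Rabs (s * s - n * s - (al * al - n * al)) + M * Rabs (exp ((1 + qm) * ln s) - exp ((1 + qm) * la))).
  assert (Hh : continuity_pt h al).
  { apply continuity_pt_plus; [|apply continuity_pt_mult; [apply continuity_pt_const; easy|]];
      apply (continuity_pt_comp _ Rabs); try apply Rcontinuity_abs;
      eapply is_derive_continuity_pt with (l := Derive _ al); apply Derive_correct; auto_derive; try lra; exact I. }
  assert (h al < e).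
  { unfold h. rewrite !Rminus_diag, Rabs_R0. lra. }
  destruct (continuity_pt_lt h al e Hh H) as [d [Hd Hd']].
  exists d. split; [assumption|]. intros x l Hx Hl. specialize (Hd' _ Hl).
  unfold h in Hd'. rewrite ln_exp in Hd'.
  eapply Rle_lt_trans; [|exact Hd'].
  rewrite <- flow_s_ln_al. unfold flow_s. rewrite !exp_ln_al.
  replace (exp l * exp l - n * exp l + exp (pm * x) - m * exp (qm * x + (1 + qm) * l) -
   (al * al - n * al + exp (pm * x) - m * exp (qm * x + (1 + qm) * la)))
   with ((exp l * exp l - n * exp l - (al * al - n * al)) +
     - (m * exp (qm * x) * (exp ((1 + qm) * l) - exp ((1 + qm) * la)))) by (rewrite !exp_plus; ring).
  eapply Rle_trans; [apply Rabs_triang|]. rewrite Rabs_Ropp, (Rabs_mult (m * exp (qm * x))).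
  apply Rplus_le_compat_l. apply Rmult_le_compat_r; [apply Rabs_pos|].
  rewrite Rabs_pos_eq by (apply Rmult_le_pos; [lra|left; apply exp_pos]).
  apply Rmult_le_compat_l; [lra|]. apply exp_le_compat, Rmult_le_compat_l; lra.
Qed.

(** Inverse continuity is read off from the increasing quotient of [isocline_rate_quot_lt]; the
    lower bound on x keeps the factor exp(-qm x) bounded. *)
Lemma isocline_rate_small_near (A x0 e : R) : FE x0 = 0 -> 0 < e -> exists d, 0 < d /\
  forall x, - A <= x -> Rabs (FE x) < d -> Rabs (x - x0) < e.
Proof.
  intros H0 He.
  set (g := fun x => FE x * exp (- (qm * x))).
  assert (Hg0 : g x0 = 0) by (unfold g; rewrite H0; ring).
  pose proof isocline_rate_quot_lt as Hinc. fold g in Hinc.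
  assert (Hg1 : 0 < g (x0 + e)) by (rewrite <- Hg0; apply Hinc; lra).
  assert (Hg2 : g (x0 - e) < 0) by (rewrite <- Hg0; apply Hinc; lra).
  set (d := Rmin (g (x0 + e)) (- g (x0 - e))).
  assert (Hd : 0 < d) by (apply Rmin_glb_lt; lra).
  pose proof (Rmin_l (g (x0 + e)) (- g (x0 - e))) as Hd1. pose proof (Rmin_r (g (x0 + e)) (- g (x0 - e))) as Hd2.
  fold d in Hd1, Hd2.
  exists (d * exp (- (qm * A))). split; [apply Rmult_lt_0_compat; [assumption|apply exp_pos]|].
  intros x Hx HF.
  assert (Hgx : Rabs (g x) < d).
  { unfold g. rewrite Rabs_mult, (Rabs_pos_eq (exp _)) by (left; apply exp_pos).
    apply Rlt_le_trans with (d * exp (- (qm * A)) * exp (- (qm * x))).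
    - apply Rmult_lt_compat_r; [apply exp_pos|assumption].
    - rewrite Rmult_assoc, <- exp_plus. rewrite <- (Rmult_1_r d) at 2. apply Rmult_le_compat_l; [lra|].
      rewrite <- exp_0. apply exp_le_compat. nra. }
  apply Rabs_def2 in Hgx.
  assert (Hmono : forall y z, y <= z -> g y <= g z).
  { intros y z [Hyz| ->]; [left; now apply Hinc|lra]. }
  apply Rabs_def1.
  - apply Rnot_le_lt. intros Hle. pose proof (Hmono (x0 + e) x ltac:(lra)). lra.
  - apply Rnot_le_lt. intros Hle. pose proof (Hmono x (x0 - e) ltac:(lra)). lra.
Qed.

Section Compact_trajectory.
Variables (k T A x0 : R) (xi lam : R -> R).
Hypothesis Hk : k * k = 1.
Hypothesis Hflow : forall t, T <= t -> flow_at n al m k xi lam t.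
Hypothesis Hxi : forall t, T <= t -> - A <= xi t <= A.
Hypothesis Hlam : forall t, T <= t -> lam t <= A.

Let HA : 0 <= A.
Proof. specialize (Hxi T ltac:(lra)). lra. Qed.

(** The sign [k] is 1 or -1, and k^2 = 1 makes W nondecreasing in either direction of time. *)
Let W t := k * VV (xi t) (lam t).

Let Hk_abs : Rabs k = 1.
Proof. unfold Rabs. destruct Rcase_abs; nra. Qed.

Lemma signed_lyapunov_derive (t : R) : T <= t -> is_derive W t (dV (xi t) (lam t)).
Proof.
  intros Ht. destruct (Hflow t Ht) as [H1 H2]. unfold W.
  pose proof (lyapunov_derive xi lam k t H1 H2) as H.
  evar_last; [apply (is_derive_scal (fun t => VV (xi t) (lam t)) t k _ H)|].
  rewrite <- Rmult_assoc, Hk. apply Rmult_1_l.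
Qed.

Lemma signed_lyapunov_mono (s t : R) : T <= s <= t -> W s <= W t.
Proof.
  intros Hst. apply (nondecreasing_of_derive W (fun t => dV (xi t) (lam t))); [lra| |].
  - intros z Hz. apply signed_lyapunov_derive. lra.
  - intros. apply lyapunov_rate_nonneg.
Qed.

Lemma trajectory_slope_lipschitz : exists L, 0 < L /\ forall s t, T <= s <= t ->
  Rabs (exp (lam t) - exp (lam s)) <= L * (t - s).
Proof.
  destruct (flow_s_bounded A) as [L [HL HS]]. exists L. split; [assumption|]. intros s t Hst.
  destruct (mean_value (fun t => exp (lam t)) (fun t => k * SS (xi t) (lam t)) s t) as [c [Hc E]]; [lra| |].
  - intros z Hz. apply (slope_derive lam (xi z)). apply Hflow. lra.
  - rewrite E, !Rabs_mult, Hk_abs, (Rabs_pos_eq (t - s)) by lra. rewrite Rmult_1_l.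
    apply Rmult_le_compat_r; [lra|]. apply HS; [apply Hxi|apply Hlam]; lra.
Qed.

(* Each visit to |s - al| >= e raises V by a fixed amount, because s is Lipschitz in time. *)
Lemma trajectory_slope_limit (e : R) : 0 < e ->
  exists T', T <= T' /\ forall t, T' <= t -> Rabs (exp (lam t) - al) < e.
Proof.
  intros He0. set (e1 := Rmin e al / 2).
  assert (He1 : 0 < e1 < al /\ 2 * e1 <= e).
  { pose proof (Rmin_l e al). pose proof (Rmin_r e al). assert (0 < Rmin e al) by (apply Rmin_glb_lt; lra).
    unfold e1. lra. }
  destruct (lyapunov_rate_gap A e1 HA (proj1 He1)) as [c [Hc Hgap]].
  destruct trajectory_slope_lipschitz as [L [HL Hlip]].
  set (tau := e1 / L). assert (Htau : 0 < tau) by (apply Rdiv_lt_0_compat; lra).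
  destruct (lyapunov_bounded A) as [B HB].
  set (E := fun w => exists t, T <= t /\ w = W t).
  destruct (completeness E) as [S [Sub Slub]].
  { exists B. intros w [t [Ht ->]]. unfold W. apply Rle_trans with (Rabs (k * VV (xi t) (lam t))); [apply Rle_abs|].
    rewrite Rabs_mult, Hk_abs, Rmult_1_l. apply HB; [apply Hxi|apply Hlam]; lra. }
  { exists (W T). exists T. split; [lra|reflexivity]. }
  assert (HT' : exists T', T <= T' /\ S - c * tau < W T').
  { destruct (excluded_middle_informative (exists T', T <= T' /\ S - c * tau < W T')) as [|Hno]; [assumption|exfalso].
    assert (S <= S - c * tau).
    { apply Slub. intros w [t [Ht ->]]. apply Rnot_lt_le. intros Hlt. apply Hno. now exists t. }
    assert (0 < c * tau) by (apply Rmult_lt_0_compat; lra). lra. }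
  destruct HT' as [T' [HTT' HW]]. exists T'. split; [assumption|]. intros t Ht.
  apply Rnot_le_lt. intros Hbad.
  assert (HWt : W t + c * tau <= W (t + tau)).
  { destruct (mean_value W (fun t => dV (xi t) (lam t)) t (t + tau)) as [z [Hz EW]]; [lra| |].
    - intros z Hz. apply signed_lyapunov_derive. lra.
    - assert (c <= dV (xi z) (lam z)).
      { apply Hgap; [apply Hxi; lra|].
        assert (Rabs (exp (lam z) - exp (lam t)) <= e1).
        { eapply Rle_trans; [apply Hlip; lra|].
          replace e1 with (L * tau) by (unfold tau; field; lra). apply Rmult_le_compat_l; lra. }
        pose proof (Rabs_triang_inv (exp (lam t) - al) (exp (lam t) - exp (lam z))) as H1.
        replace (exp (lam t) - al - (exp (lam t) - exp (lam z))) with (exp (lam z) - al) in H1 by ring.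
        rewrite (Rabs_minus_sym (exp (lam t)) (exp (lam z))) in H1. lra. }
      replace (t + tau - t) with tau in EW by ring.
      assert (c * tau <= dV (xi z) (lam z) * tau) by (apply Rmult_le_compat_r; lra). lra. }
  assert (W (t + tau) <= S) by (apply Sub; exists (t + tau); split; [lra|reflexivity]).
  pose proof (signed_lyapunov_mono T' t ltac:(lra)). lra.
Qed.

(** Once s is close to al, its increment over a unit of time is small, so s' is small at some
    intermediate c, and there s' is close to the isocline rate. As x' = al - s is small too, x
    hardly moves between t and c, and the estimate passes to t. *)
Lemma trajectory_isocline_limit (e : R) : 0 < e ->
  exists T', T <= T' /\ forall t, T' <= t -> Rabs (FE (xi t)) < e.
Proof.
  intros He.
  destruct (flow_s_near_ln_al A (e / 4) ltac:(lra)) as [d [Hd HSS]].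
  destruct (isocline_rate_bounded_derive A) as [D [HD HFD]].
  set (e1 := Rmin d (Rmin (e / 8) (e / (4 * D)))).
  assert (He1 : 0 < e1).
  { repeat apply Rmin_glb_lt; try lra. apply Rdiv_lt_0_compat; lra. }
  assert (Hb : e1 <= d /\ e1 <= e / 8 /\ e1 <= e / (4 * D)).
  { unfold e1. split; [apply Rmin_l|]. split; (eapply Rle_trans; [apply Rmin_r|]); [apply Rmin_l|apply Rmin_r]. }
  destruct (trajectory_slope_limit e1 He1) as [T' [HTT' Hs]].
  exists T'. split; [assumption|]. intros t Ht.
  destruct (mean_value (fun t => exp (lam t)) (fun t => k * SS (xi t) (lam t)) t (t + 1)) as [c [Hc E]]; [lra| |].
  { intros z Hz. apply (slope_derive lam (xi z)). apply Hflow. lra. }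
  replace (t + 1 - t) with 1 in E by ring. rewrite Rmult_1_r in E.
  assert (H1 : Rabs (SS (xi c) (lam c)) < e / 4).
  { replace (Rabs (SS (xi c) (lam c))) with (Rabs (k * SS (xi c) (lam c))) by (rewrite Rabs_mult, Hk_abs; ring).
    rewrite <- E. pose proof (Rabs_def2 _ _ (Hs t Ht)). pose proof (Rabs_def2 _ _ (Hs (t + 1) ltac:(lra))).
    apply Rabs_def1; lra. }
  assert (H2 : Rabs (SS (xi c) (lam c) - FE (xi c)) < e / 4).
  { apply HSS; [apply Hxi; lra|]. specialize (Hs c ltac:(lra)). lra. }
  assert (H3 : Rabs (FE (xi c) - FE (xi t)) <= e / 4).
  { destruct (mean_value (fun t => FE (xi t)) (fun t => Derive FE (xi t) * (k * fxi (lam t))) t c) as [z [Hz Ez]]; [lra| |].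
    - intros z Hz. destruct (HFD (xi z) ltac:(apply Hxi; lra)) as [dz [Hdz _]].
      evar_last; [apply (is_derive_comp FE xi z dz (k * fxi (lam z)))|].
      + exact Hdz.
      + apply Hflow. lra.
      + rewrite (is_derive_unique _ _ _ Hdz). apply Rmult_comm.
    - rewrite Ez. destruct (HFD (xi z) ltac:(apply Hxi; lra)) as [dz [Hdz Hdz']].
      rewrite (is_derive_unique _ _ _ Hdz). rewrite !Rabs_mult, Hk_abs, (Rabs_pos_eq (c - t)) by lra.
      unfold flow_x. rewrite (Rabs_minus_sym al).
      specialize (Hs z ltac:(lra)).
      pose proof (Rabs_pos dz). pose proof (Rabs_pos (exp (lam z) - al)).
      assert (Rabs dz * (1 * Rabs (exp (lam z) - al)) <= D * (e / (4 * D))) by (apply Rmult_le_compat; lra).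
      replace (D * (e / (4 * D))) with (e / 4) in * by (field; lra).
      assert (0 <= Rabs dz * (1 * Rabs (exp (lam z) - al))) by (apply Rmult_le_pos; lra).
      rewrite <- (Rmult_1_r (e / 4)). apply Rmult_le_compat; lra. }
  apply Rabs_def2 in H1. apply Rabs_def2 in H2. apply Rabs_le_between in H3. apply Rabs_def1; lra.
Qed.

Lemma trajectory_x_limit (e : R) : FE x0 = 0 -> 0 < e ->
  exists T', T <= T' /\ forall t, T' <= t -> Rabs (xi t - x0) < e.
Proof.
  intros H0 He. destruct (isocline_rate_small_near A x0 e H0 He) as [d [Hd Hd']].
  destruct (trajectory_isocline_limit d Hd) as [T' [HT H]]. exists T'. split; [assumption|].
  intros t Ht. apply Hd'; [apply Hxi; lra|auto].
Qed.

End Compact_trajectory.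

Lemma trajectory_limit (k T A x0 : R) (xi lam : R -> R) :
  k * k = 1 -> (forall t, T <= t -> flow k xi lam t) ->
  (forall t, T <= t -> - A <= xi t <= A) -> (forall t, T <= t -> lam t <= A) ->
  FE x0 = 0 -> forall e, 0 < e -> exists T', T <= T' /\ forall t, T' <= t ->
    Rabs (xi t - x0) < e /\ Rabs (lam t - la) < e.
Proof.
  intros Hk Hf Hx Hl H0 e He.
  destruct (trajectory_x_limit k T A x0 xi lam Hk Hf Hx Hl e H0 He) as [T1 [HT1 H1]].
  destruct (ln_near e He al ltac:(lra)) as [d [Hd Hd']].
  destruct (trajectory_slope_limit k T A xi lam Hk Hf Hx Hl d Hd) as [T2 [HT2 H2]].
  exists (Rmax T1 T2). pose proof (Rmax_l T1 T2). pose proof (Rmax_r T1 T2).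
  split; [lra|]. intros t Ht. split; [apply H1|apply Hd', H2]; lra.
Qed.

(** * No trajectory leaves the origin with s tending to 0 *)

Lemma lyapunov_forward (T t : R) (xi lam : R -> R) : T <= t ->
  (forall t, T <= t -> flow 1 xi lam t) -> VV (xi T) (lam T) <= VV (xi t) (lam t).
Proof.
  intros HTt Hf.
  pose proof (signed_lyapunov_mono 1 T xi lam ltac:(lra) Hf T t ltac:(lra)). simpl in H. lra.
Qed.

Lemma lyapunov_neg_near_ln_al (x0 : R) : FE x0 = 0 ->
  exists e, 0 < e /\ forall x l, Rabs (x - x0) < e -> Rabs (l - la) < e -> VV x l < 0.
Proof.
  intros H0.
  set (g := fun l => exp ((be + 2) * l) / (be + 2) - al * exp ((be + 1) * l) / (be + 1)
      + aa * exp ((be + 2) * la) / (ga * (be + 2))).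
  set (h := fun x => exp (be * la + pm * x) / (ga + pm) - m * exp ((be + 1 + qm) * la + qm * x) / (ga + qm)).
  (* The bracket separates into a function of l and a function of x, so continuity in one variable
     suffices. *)
  assert (EV : forall x l, VV x l = exp (ga * x) * (g l + h x)).
  { intros. unfold lyapunov, lyap_bracket, g, h. f_equal. lra. }
  assert (Hneg : g la + h x0 < 0).
  { pose proof (lyapunov_ln_al_neg x0 ltac:(lra)) as H. rewrite EV in H. pose proof (exp_pos (ga * x0)). nra. }
  destruct (continuity_pt_lt g la (g la - (g la + h x0) / 2)) as [d1 [Hd1 H1]]; [|lra|].
  { eapply is_derive_continuity_pt with (l := Derive g la). apply Derive_correct. unfold g. auto_derive. exact I. }
  destruct (continuity_pt_lt h x0 (h x0 - (g la + h x0) / 2)) as [d2 [Hd2 H2]]; [|lra|].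
  { eapply is_derive_continuity_pt with (l := Derive h x0). apply Derive_correct. unfold h. auto_derive. exact I. }
  exists (Rmin d1 d2). split; [now apply Rmin_glb_lt|]. intros x l Hx Hl.
  pose proof (Rmin_l d1 d2). pose proof (Rmin_r d1 d2).
  specialize (H1 l ltac:(lra)). specialize (H2 x ltac:(lra)).
  rewrite EV. pose proof (exp_pos (ga * x)). nra.
Qed.

(** exp(pm x) grows at least like the square of exp(qm x), while the other terms are controlled by s
    <= al. A trajectory with s <= al therefore cannot remain at large X. *)
Lemma flow_s_large : exists B, forall x l, B <= x -> exp l <= al -> 1 <= SS x l.
Proof.
  set (c := m * exp ((1 + qm) * la)). assert (Hc : 0 < c) by (apply Rmult_lt_0_compat; [lra|apply exp_pos]).
  assert (Hnal : 0 < n * al) by (apply Rmult_lt_0_compat; lra).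
  set (w := 2 + c + n * al). exists (ln w / qm). intros x l Hx Hl.
  assert (Hw : w <= exp (qm * x)).
  { rewrite <- (exp_ln w) by (unfold w; lra). apply exp_le_compat.
    apply Rmult_le_compat_l with (r := qm) in Hx; [|lra].
    replace (qm * (ln w / qm)) with (ln w) in Hx by (field; lra). exact Hx. }
  assert (Hx0 : 0 <= x).
  { eapply Rle_trans; [|exact Hx]. apply Rmult_le_pos; [|left; apply Rinv_0_lt_compat; lra].
    rewrite <- ln_1. apply ln_le; unfold w; lra. }
  pose proof (exp_p_ge_square x Hx0) as HQ.
  assert (Hl' : exp ((1 + qm) * l) <= exp ((1 + qm) * la)).
  { apply exp_le_compat, Rmult_le_compat_l; [lra|]. rewrite <- (ln_exp l). apply ln_le; [apply exp_pos|assumption]. }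
  unfold flow_s. rewrite exp_plus.
  assert (Hmc : m * exp ((1 + qm) * l) <= c) by (apply Rmult_le_compat_l; lra).
  set (y := exp (qm * x)) in *. set (z := exp ((1 + qm) * l)) in *.
  assert (m * z * y <= c * y) by (apply Rmult_le_compat_r; [left; apply exp_pos|lra]).
  assert (n * exp l <= n * al) by (apply Rmult_le_compat_l; lra).
  pose proof (exp_pos l). assert (0 < exp l * exp l) by (apply Rmult_lt_0_compat; lra).
  assert ((2 + n * al) * 1 <= (2 + n * al) * y) by (apply Rmult_le_compat_l; unfold w in *; lra).
  assert (w * y <= y * y) by (apply Rmult_le_compat_r; unfold w in *; lra).
  unfold w in *. lra.
Qed.

(* For bounded X one has s' >= s^2 / 2 as soon as s is large. *)
Lemma slope_blow_up (T A : R) (xi lam : R -> R) :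
  (forall t, T <= t -> flow 1 xi lam t) -> (forall t, T <= t -> xi t <= A) ->
  exists B, forall t, T <= t -> lam t <= B.
Proof.
  intros Hf Hx. pose proof q_minus_1_lt_1 as Hq1.
  set (c := 4 * m * exp (qm * A)). assert (Hc : 0 < c) by (apply Rmult_lt_0_compat; [lra|apply exp_pos]).
  set (B := Rmax (ln (4 * n)) (ln c / (1 - qm))). exists B. intros t0 Ht0. apply Rnot_lt_le. intros Hbad.
  assert (HSS : forall x l, x <= A -> B <= l -> exp l * exp l / 2 <= SS x l).
  { intros x l Hxa Hl.
    pose proof (Rmax_l (ln (4 * n)) (ln c / (1 - qm))). pose proof (Rmax_r (ln (4 * n)) (ln c / (1 - qm))). fold B in H, H0.
    assert (H4 : 4 * n <= exp l).
    { rewrite <- (exp_ln (4 * n)) by lra. apply exp_le_compat. lra. }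
    assert (H5 : c * exp ((1 + qm) * l) <= exp l * exp l).
    { rewrite <- exp_plus. rewrite <- (exp_ln c Hc), <- exp_plus. apply exp_le_compat.
      assert (ln c <= l * (1 - qm)); [|lra].
      apply Rmult_le_reg_r with (/ (1 - qm)); [apply Rinv_0_lt_compat; lra|].
      rewrite Rmult_assoc, Rinv_r by lra. unfold Rdiv in *. lra. }
    unfold flow_s. rewrite exp_plus. pose proof (exp_pos (pm * x)). pose proof (exp_pos l).
    assert (exp (qm * x) <= exp (qm * A)) by (apply exp_le_compat, Rmult_le_compat_l; lra).
    assert (m * (exp (qm * x) * exp ((1 + qm) * l)) <= c / 4 * exp ((1 + qm) * l)).
    { rewrite <- Rmult_assoc. apply Rmult_le_compat_r; [left; apply exp_pos|]. unfold c. nra. }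
    nra. }
  assert (Hstay : forall t, t0 <= t -> exp B < exp (lam t)).
  { apply (barrier (fun t => exp (lam t)) (fun t => 1 * SS (xi t) (lam t))).
    - now apply exp_increasing.
    - intros t Ht. apply (slope_derive lam (xi t)). apply Hf. lra.
    - intros t Ht E. apply exp_inv in E.
      pose proof (HSS (xi t) (lam t) ltac:(apply Hx; lra) ltac:(lra)).
      pose proof (exp_pos (lam t)). assert (0 < exp (lam t) * exp (lam t)) by (apply Rmult_lt_0_compat; lra). lra. }
  (* s' >= s^2 / 2 gives (1/s)' <= -1/2, so the positive quantity 1/s would have to reach 0 within
     time 2 / s(t0). *)
  set (tau := 2 * exp (- lam t0)). assert (Htau : 0 < tau) by (pose proof (exp_pos (- lam t0)); unfold tau; lra).
  destruct (mean_value (fun t => exp (- lam t)) (fun t => - (exp (- lam t) * flam (xi t) (lam t))) t0 (t0 + tau))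
    as [c0 [Hc0 E]]; [lra| |].
  { intros t Ht. destruct (Hf t ltac:(lra)) as [_ H].
    auto_derive; [now eexists; eassumption|].
    change (Derive (fun x => lam x) t) with (Derive lam t). rewrite (is_derive_unique _ _ _ H). ring. }
  assert (H1 : 1 / 2 <= exp (- lam c0) * flam (xi c0) (lam c0)).
  { assert (Hs : SS (xi c0) (lam c0) = exp (lam c0) * flam (xi c0) (lam c0)).
    { destruct (Hf c0 ltac:(lra)) as [_ H].
      pose proof (is_derive_unique _ _ _ (slope_derive lam (xi c0) 1 c0 H)) as E1.
      assert (E2 : Derive (fun t => exp (lam t)) c0 = exp (lam c0) * flam (xi c0) (lam c0)).
      { apply is_derive_unique. auto_derive; [now eexists; eassumption|].
        change (Derive (fun x => lam x) c0) with (Derive lam c0). rewrite (is_derive_unique _ _ _ H). ring. }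
      pose proof (eq_trans (eq_sym E1) E2). lra. }
    assert (HB : B <= lam c0) by (left; apply exp_lt_inv, Hstay; lra).
    pose proof (HSS (xi c0) (lam c0) ltac:(apply Hx; lra) HB) as H2.
    rewrite Hs in H2. rewrite exp_Ropp. pose proof (exp_pos (lam c0)).
    apply Rmult_le_reg_l with (exp (lam c0) * exp (lam c0)); [apply Rmult_lt_0_compat; lra|].
    field_simplify; [|lra]. lra. }
  pose proof (exp_pos (- lam (t0 + tau))) as H3.
  replace (t0 + tau - t0) with tau in E by ring. unfold tau at 2 in E.
  pose proof (exp_pos (- lam t0)). nra.
Qed.

Lemma x_decreasing_of_slope (T t : R) (xi lam : R -> R) : T <= t ->
  (forall t, T <= t -> flow 1 xi lam t) -> (forall t, T <= t -> al <= exp (lam t)) -> xi t <= xi T.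
Proof.
  intros Ht Hf Hs. apply (nonincreasing_of_derive xi (fun t => 1 * fxi (lam t))); [assumption| |].
  - intros z Hz. apply Hf. lra.
  - intros z Hz. specialize (Hs z ltac:(lra)). unfold flow_x. lra.
Qed.

Lemma no_regular_trajectory (xi lam : R -> R) :
  (forall t, flow 1 xi lam t) -> (forall A, exists t, xi t <= A /\ lam t <= A) -> False.
Proof.
  intros Hf Hreg.
  destruct lyapunov_pos_near_regular as [A0 HA0]. destruct (Hreg A0) as [t0 [Hx0 Hl0]].
  set (d := VV (xi t0) (lam t0)). assert (Hd : 0 < d) by now apply HA0.
  assert (HV : forall t, t0 <= t -> d <= VV (xi t) (lam t)).
  { intros t Ht. apply lyapunov_forward; auto. }
  (* If s ever exceeds al it stays above, because V > 0 makes s' positive on s = al, and X decreases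
     from then on. Otherwise s <= al forever; X beyond the level of [flow_s_large] would then not
     decrease, and s would gain at least al during time al, which takes it past al. *)
  assert (HB : exists T A, t0 <= T /\ forall t, T <= t -> xi t <= A).
  { destruct (excluded_middle_informative (exists t1, t0 <= t1 /\ al < exp (lam t1))) as [[t1 [Ht1 Hs1]]|Hno].
    - exists t1, (xi t1). split; [assumption|]. intros t Ht. apply (x_decreasing_of_slope t1 t xi lam Ht); [auto|].
      intros z Hz. left. revert z Hz.
      apply (barrier (fun t => exp (lam t)) (fun t => 1 * SS (xi t) (lam t))); [assumption| |].
      + intros z Hz. apply (slope_derive lam (xi z)). apply Hf.
      + intros z Hz E. specialize (HV z ltac:(lra)).
        assert (E' : lam z = la) by (rewrite <- E; symmetry; apply ln_exp). rewrite E' in *.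
        rewrite flow_s_ln_al. apply Rnot_le_lt. intros HF. rewrite Rmult_1_l in HF.
        pose proof (lyapunov_ln_al_neg _ HF). lra.
    - assert (Hle : forall t, t0 <= t -> exp (lam t) <= al).
      { intros t Ht. apply Rnot_lt_le. intros Hlt. apply Hno. now exists t. }
      destruct flow_s_large as [B HBS].
      destruct (excluded_middle_informative (exists t1, t0 <= t1 /\ B < xi t1)) as [[t1 [Ht1 Hs1]]|Hno2].
      + exfalso.
        assert (Hmono : forall t, t1 <= t -> B <= xi t).
        { intros t Ht. apply Rle_trans with (xi t1); [lra|].
          apply (nondecreasing_of_derive xi (fun t => 1 * fxi (lam t))); [assumption| |].
          - intros z Hz. apply Hf.
          - intros z Hz. specialize (Hle z ltac:(lra)). unfold flow_x. lra. }
        destruct (mean_value (fun t => exp (lam t)) (fun t => 1 * SS (xi t) (lam t)) t1 (t1 + al)) as [c [Hc E]]; [lra| |].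
        { intros z Hz. apply (slope_derive lam (xi z)). apply Hf. }
        pose proof (HBS (xi c) (lam c) (Hmono c ltac:(lra)) (Hle c ltac:(lra))).
        pose proof (exp_pos (lam t1)). pose proof (Hle (t1 + al) ltac:(lra)). nra.
      + exists t0, B. split; [lra|]. intros t Ht. apply Rnot_lt_le. intros Hlt. apply Hno2. now exists t. }
  destruct HB as [T [A1 [HT HA1]]].
  destruct (slope_blow_up T A1 xi lam) as [A2 HA2]; [auto|assumption|].
  set (A3 := Rmax A1 A2).
  assert (HA3 : forall t, T <= t -> xi t <= A3 /\ lam t <= A3).
  { intros t Ht. split; [eapply Rle_trans; [apply HA1, Ht|apply Rmax_l]|eapply Rle_trans; [apply HA2, Ht|apply Rmax_r]]. }
  destruct (lyapunov_upper A3) as [C [HC HVC]].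
  destruct (exp_small ga C d Hga ltac:(lra) Hd) as [A4 HA4].
  (* The lower bound on x comes from d <= V <= C exp(ga x), which excludes x <= [A4]. *)
  set (A := Rmax A3 (- A4)).
  assert (Hbd : forall t, T <= t -> - A <= xi t <= A /\ lam t <= A).
  { intros t Ht. destruct (HA3 t Ht) as [H1 H2]. pose proof (Rmax_l A3 (- A4)). pose proof (Rmax_r A3 (- A4)).
    fold A in H, H0. repeat split; try lra.
    apply Rnot_lt_le. intros Hlt. specialize (HA4 (xi t) ltac:(lra)).
    specialize (HVC _ _ H1 H2). specialize (HV t ltac:(lra)). lra. }
  destruct isocline_rate_root as [x0 HF0].
  destruct (lyapunov_neg_near_ln_al x0 HF0) as [e [He Hneg]].
  destruct (trajectory_limit 1 T A x0 xi lam ltac:(lra) ltac:(auto) ltac:(apply Hbd) ltac:(apply Hbd) HF0 e He)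
    as [T' [HT' Hlim]].
  destruct (Hlim T' ltac:(lra)) as [H1 H2]. specialize (Hneg _ _ H1 H2). specialize (HV T' ltac:(lra)). lra.
Qed.

(** * Uniqueness of the trajectory entering the origin with s tending to n *)

Lemma flow_l_rest (x l : R) : flam x l = exp l - n + rest x l.
Proof. unfold flow_l, flow_rest. ring. Qed.

Lemma rest_lipschitz (M1 M2 x1 l1 x2 l2 : R) :
  pm * x1 - l1 <= M1 -> pm * x2 - l2 <= M1 -> qm * (x1 + l1) <= M2 -> qm * (x2 + l2) <= M2 ->
  Rabs (rest x1 l1 - rest x2 l2) <=
  ((pm + 1) * exp M1 + m * qm * exp M2) * (Rabs (x1 - x2) + Rabs (l1 - l2)).
Proof.
  intros H1 H2 H3 H4. unfold flow_rest.
  pose proof (exp_lipschitz _ _ _ H1 H2) as E1. pose proof (exp_lipschitz _ _ _ H3 H4) as E2.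
  set (dx := Rabs (x1 - x2)). set (dl := Rabs (l1 - l2)).
  assert (D1 : Rabs (pm * x1 - l1 - (pm * x2 - l2)) <= pm * dx + dl).
  { replace (pm * x1 - l1 - (pm * x2 - l2)) with (pm * (x1 - x2) + - (l1 - l2)) by ring.
    eapply Rle_trans; [apply Rabs_triang|]. rewrite Rabs_Ropp, Rabs_mult, (Rabs_pos_eq pm) by lra. apply Rle_refl. }
  assert (D2 : Rabs (qm * (x1 + l1) - qm * (x2 + l2)) <= qm * (dx + dl)).
  { replace (qm * (x1 + l1) - qm * (x2 + l2)) with (qm * ((x1 - x2) + (l1 - l2))) by ring.
    rewrite Rabs_mult, (Rabs_pos_eq qm) by lra. apply Rmult_le_compat_l; [lra|]. apply Rabs_triang. }
  pose proof (exp_pos M1). pose proof (exp_pos M2).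
  assert (0 <= dx) by apply Rabs_pos. assert (0 <= dl) by apply Rabs_pos.
  replace (exp (pm * x1 - l1) - m * exp (qm * (x1 + l1)) - (exp (pm * x2 - l2) - m * exp (qm * (x2 + l2))))
    with ((exp (pm * x1 - l1) - exp (pm * x2 - l2)) + - (m * (exp (qm * (x1 + l1)) - exp (qm * (x2 + l2))))) by ring.
  eapply Rle_trans; [apply Rabs_triang|]. rewrite Rabs_Ropp, Rabs_mult, (Rabs_pos_eq m) by lra.
  assert (F1 : exp M1 * Rabs (pm * x1 - l1 - (pm * x2 - l2)) <= exp M1 * (pm * dx + dl)) by (apply Rmult_le_compat_l; lra).
  assert (F2 : m * Rabs (exp (qm * (x1 + l1)) - exp (qm * (x2 + l2))) <= m * (exp M2 * (qm * (dx + dl)))).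
  { apply Rmult_le_compat_l; [lra|]. eapply Rle_trans; [exact E2|]. apply Rmult_le_compat_l; lra. }
  assert (0 <= exp M1 * dx) by (apply Rmult_le_pos; lra).
  assert (0 <= exp M1 * (pm * dl)) by (apply Rmult_le_pos; [|apply Rmult_le_pos]; lra).
  replace (((pm + 1) * exp M1 + m * qm * exp M2) * (dx + dl))
    with (exp M1 * (pm * dx + dl) + exp M1 * dx + exp M1 * (pm * dl) + m * (exp M2 * (qm * (dx + dl)))) by ring.
  lra.
Qed.

Lemma stable_x_small (c : R) (xi : R -> R) (A : R) :
  (forall e, 0 < e -> exists T, forall t, T <= t -> Rabs (xi t + (n - al) * t - c) < e) ->
  exists T, forall t, T <= t -> xi t <= A.
Proof.
  intros H. destruct (H 1 ltac:(lra)) as [T HT]. exists (Rmax T ((c + 1 - A) / (n - al))).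
  intros t Ht. pose proof (Rmax_l T ((c + 1 - A) / (n - al))). pose proof (Rmax_r T ((c + 1 - A) / (n - al))).
  specialize (HT t ltac:(lra)). apply Rabs_def2 in HT.
  assert (c + 1 - A <= (n - al) * t); [|lra].
  apply Rmult_le_reg_r with (/ (n - al)); [apply Rinv_0_lt_compat; lra|].
  replace ((n - al) * t * / (n - al)) with t by (field; lra). unfold Rdiv in *. lra.
Qed.

(** For X small both levels s = n - e and s = n + e repel. If s were ever beyond one of them it
    would stay there, and x + (n - al) t would drift at rate at least e, against its convergence. *)
Lemma stable_slope (c : R) (xi lam : R -> R) :
  (forall t, flow 1 xi lam t) ->
  (forall e, 0 < e -> exists T, forall t, T <= t -> Rabs (xi t + (n - al) * t - c) < e) ->
  forall e, 0 < e -> exists T, forall t, T <= t -> Rabs (lam t - ln n) < e.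
Proof.
  intros Hf Hc e0 He0.
  destruct (ln_near e0 He0 n ltac:(lra)) as [d [Hd Hd']].
  set (e := Rmin (d / 2) (n / 2)).
  assert (He : 0 < e /\ e <= d / 2 /\ e <= n / 2).
  { unfold e. split; [apply Rmin_glb_lt; lra|]. split; [apply Rmin_l|apply Rmin_r]. }
  destruct (Hc 1 ltac:(lra)) as [T1 HT1].
  destruct (exp_small pm 1 (n / 2 * e)) as [A1 HA1]; [lra|lra|apply Rmult_lt_0_compat; lra|].
  destruct (exp_small qm (m * exp ((1 + qm) * ln (n + e))) (n * e)) as [A2 HA2];
    [lra|apply Rmult_le_pos; [lra|left; apply exp_pos]|apply Rmult_lt_0_compat; lra|].
  destruct (stable_x_small c xi (Rmin A1 A2) Hc) as [T2 HT2].
  exists (Rmax T1 T2). intros t0 Ht0. pose proof (Rmax_l T1 T2). pose proof (Rmax_r T1 T2).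
  apply Hd'.
  assert (Hd1 : forall t, is_derive (fun t => xi t + (n - al) * t) t (1 * fxi (lam t) + (n - al))).
  { intros t. destruct (Hf t) as [Hx _]. auto_derive; [now eexists; eassumption|].
    change (Derive (fun x => xi x) t) with (Derive xi t). rewrite (is_derive_unique _ _ _ Hx). ring. }
  assert (Hds : forall t, is_derive (fun t => exp (lam t)) t (1 * SS (xi t) (lam t))).
  { intros t. apply (slope_derive lam (xi t)). apply Hf. }
  assert (Hx12 : forall t, t0 <= t -> xi t <= A1 /\ xi t <= A2).
  { intros t Ht. specialize (HT2 t ltac:(lra)). pose proof (Rmin_l A1 A2). pose proof (Rmin_r A1 A2). lra. }
  (* Being within 1 of [c], the quantity varies by less than 2, whereas a drift at rate [e] during
     [tau] amounts to 3. *)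
  set (tau := 3 / e). assert (Htau : 0 < tau) by (apply Rdiv_lt_0_compat; lra).
  assert (Het : e * tau = 3) by (unfold tau; field; lra).
  pose proof (Rabs_def2 _ _ (HT1 t0 ltac:(lra))) as B1.
  pose proof (Rabs_def2 _ _ (HT1 (t0 + tau) ltac:(lra))) as B2.
  destruct (mean_value _ _ t0 (t0 + tau) ltac:(lra) (fun t _ => Hd1 t)) as [z [Hz Ez]].
  simpl in Ez. replace (t0 + tau - t0) with tau in Ez by ring. unfold flow_x in Ez.
  apply Rnot_le_lt. intros Hbad.
  unfold Rabs in Hbad. destruct (Rcase_abs (exp (lam t0) - n)) as [Hs|Hs].
  - assert (Hst : forall t, t0 <= t -> exp (lam t) < n - e).
    { apply (barrier_below (fun t => exp (lam t)) (fun t => 1 * SS (xi t) (lam t))); [lra|auto|].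
      intros t Ht E. destruct (Hx12 t Ht) as [H1 _]. specialize (HA1 _ H1).
      unfold flow_s. rewrite E.
      assert (0 < m * exp (qm * xi t + (1 + qm) * lam t)) by (apply Rmult_lt_0_compat; [lra|apply exp_pos]).
      assert (n / 2 * e <= (n - e) * e) by (apply Rmult_le_compat_r; lra). lra. }
    specialize (Hst z ltac:(lra)).
    assert (e * tau <= (1 * (al - exp (lam z)) + (n - al)) * tau) by (apply Rmult_le_compat_r; lra). lra.
  - assert (Hst : forall t, t0 <= t -> n + e < exp (lam t)).
    { apply (barrier (fun t => exp (lam t)) (fun t => 1 * SS (xi t) (lam t))); [lra|auto|].
      intros t Ht E. destruct (Hx12 t Ht) as [_ H1]. specialize (HA2 _ H1).
      assert (El : lam t = ln (n + e)) by (rewrite <- E; symmetry; apply ln_exp).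
      unfold flow_s. rewrite E, El, exp_plus.
      pose proof (exp_pos (pm * xi t)).
      assert (n * e <= (n + e) * e) by (apply Rmult_le_compat_r; lra). lra. }
    specialize (Hst z ltac:(lra)).
    assert ((1 * (al - exp (lam z)) + (n - al)) * tau <= - e * tau) by (apply Rmult_le_compat_r; lra). lra.
Qed.

(* The cone [|x1 - x2| < 8 |l1 - l2|] is invariant and [l1 - l2] expands in it, because the
   saddle at [x = -oo, s = n] is unstable in the [s]-direction. *)
Lemma stable_unique_slope (T : R) (x1 l1 x2 l2 : R -> R) :
  (forall t, T <= t -> flow 1 x1 l1 t) -> (forall t, T <= t -> flow 1 x2 l2 t) ->
  x1 T = x2 T ->
  (forall t, T <= t -> Rabs (l1 t - ln n) < ln 2) -> (forall t, T <= t -> Rabs (l2 t - ln n) < ln 2) ->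
  (forall e, 0 < e -> exists t, T <= t /\ Rabs (l1 t - l2 t) < e) ->
  (forall t, T <= t ->
     Rabs (rest (x1 t) (l1 t) - rest (x2 t) (l2 t)) <= n / 72 * (Rabs (x1 t - x2 t) + Rabs (l1 t - l2 t))) ->
  l1 T = l2 T.
Proof.
  intros F1 F2 Hx Hl1 Hl2 Hlim Hr.
  destruct (Req_dec (l1 T) (l2 T)) as [|Hne]; [assumption|exfalso].
  set (L := fun t => (l1 t - l2 t) * (l1 t - l2 t) - (x1 t - x2 t) * (x1 t - x2 t) / 64).
  set (dL := fun t => 2 * (l1 t - l2 t) * ((exp (l1 t) - exp (l2 t)) + (rest (x1 t) (l1 t) - rest (x2 t) (l2 t)))
                      + (x1 t - x2 t) * (exp (l1 t) - exp (l2 t)) / 32).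
  assert (HLT : 0 < L T).
  { unfold L. rewrite Hx. assert (0 < Rsqr (l1 T - l2 T)) by (apply Rsqr_pos_lt; lra). unfold Rsqr in H. lra. }
  assert (HL : forall t, T <= t -> L T / 2 < L t).
  { apply (barrier L dL); [lra| |].
    - intros t Ht. destruct (F1 t Ht) as [G1 G2]. destruct (F2 t Ht) as [G3 G4]. unfold L.
      auto_derive; [repeat split; now eexists; eassumption|].
      change (Derive (fun x => x1 x) t) with (Derive x1 t); change (Derive (fun x => l1 x) t) with (Derive l1 t).
      change (Derive (fun x => x2 x) t) with (Derive x2 t); change (Derive (fun x => l2 x) t) with (Derive l2 t).
      rewrite (is_derive_unique _ _ _ G1), (is_derive_unique _ _ _ G2), (is_derive_unique _ _ _ G3), (is_derive_unique _ _ _ G4).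
      rewrite !flow_l_rest. unfold flow_x, dL. field.
    - intros t Ht E. specialize (Hr t Ht). unfold dL.
      set (R := rest (x1 t) (l1 t) - rest (x2 t) (l2 t)) in *.
      destruct (exp_diff (l1 t) (l2 t)) as [c [Hc Ec]]. rewrite Ec.
      assert (Hcb : n / 2 <= exp c <= 2 * n).
      { pose proof (Rabs_def2 _ _ (Hl1 t Ht)). pose proof (Rabs_def2 _ _ (Hl2 t Ht)).
        assert (Hc2 : ln n - ln 2 <= c <= ln n + ln 2).
        { unfold Rmin, Rmax in Hc. destruct Rle_dec; lra. }
        rewrite <- ln_div in Hc2 by lra. rewrite <- ln_mult in Hc2 by lra.
        rewrite <- (exp_ln (n / 2)) at 1 by lra. rewrite (Rmult_comm 2), <- (exp_ln (n * 2)) by lra.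
        split; apply exp_le_compat; lra. }
      set (e := l1 t - l2 t) in *. set (dx := x1 t - x2 t) in *.
      assert (HE : e * e - dx * dx / 64 > 0) by (change (e * e - dx * dx / 64) with (L t); lra).
      assert (Hdx : Rabs dx < 8 * Rabs e).
      { rewrite <- (Rabs_pos_eq 8), <- Rabs_mult by lra. apply Rsqr_lt_abs_0. unfold Rsqr. lra. }
      assert (Hsq : 0 <= e * e) by apply Rle_0_sqr.
      assert (He0 : 0 < Rabs e) by (pose proof (Rabs_pos dx); lra).
      assert (Hee : Rabs e * Rabs e = e * e) by (rewrite <- Rabs_mult; apply Rabs_pos_eq; lra).
      (* In the cone, |dx| + |e| <= 9 |e|, which turns the Lipschitz constant n/72 into n/8. *)
      assert (B1 : Rabs (e * R) <= n / 8 * (e * e)).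
      { rewrite Rabs_mult, <- Hee.
        assert (Rabs R <= n / 8 * Rabs e).
        { eapply Rle_trans; [exact Hr|]. assert (n / 72 * (Rabs dx + Rabs e) <= n / 72 * (9 * Rabs e)); [|lra].
          apply Rmult_le_compat_l; lra. }
        assert (Rabs e * Rabs R <= Rabs e * (n / 8 * Rabs e)) by (apply Rmult_le_compat_l; lra). lra. }
      assert (B2 : Rabs (dx * (exp c * e)) <= 16 * n * (e * e)).
      { rewrite !Rabs_mult, <- Hee, (Rabs_pos_eq (exp c)) by lra.
        assert (exp c * Rabs e <= 2 * n * Rabs e) by (apply Rmult_le_compat_r; lra).
        assert (0 <= exp c * Rabs e) by (apply Rmult_le_pos; lra).
        assert (Rabs dx * (exp c * Rabs e) <= (8 * Rabs e) * (2 * n * Rabs e)).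
        { apply Rmult_le_compat; try lra. apply Rabs_pos. }
        lra. }
      apply Rabs_le_between in B1. apply Rabs_le_between in B2.
      assert (B3 : n / 2 * (e * e) <= exp c * (e * e)) by (apply Rmult_le_compat_r; lra).
      assert (0 < n * (e * e)) by (rewrite <- Hee; repeat apply Rmult_lt_0_compat; lra).
      (* The expansion contributes at least n e^2, the remainder at least -n e^2 / 4 and the x-part
         at least -n e^2 / 2, so the derivative is positive. *)
      replace (2 * e * (exp c * e + R)) with (2 * (exp c * (e * e)) + 2 * (e * R)) by ring.
      lra. }
  destruct (Hlim (sqrt (L T / 2))) as [t [Ht Hsm]]; [apply sqrt_lt_R0; lra|].
  specialize (HL t Ht).
  assert (L t <= Rabs (l1 t - l2 t) * Rabs (l1 t - l2 t)).
  { rewrite <- Rabs_mult, Rabs_pos_eq by apply Rle_0_sqr. unfold L.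
    pose proof (Rle_0_sqr (x1 t - x2 t)) as Hq. unfold Rsqr in Hq. lra. }
  assert (Rabs (l1 t - l2 t) * Rabs (l1 t - l2 t) < L T / 2).
  { rewrite <- (sqrt_sqrt (L T / 2)) by lra. pose proof (Rabs_pos (l1 t - l2 t)). nra. }
  lra.
Qed.

(** Gronwall for the squared distance: on the compact interval between T and t all exponents are
    bounded, so the field is Lipschitz along both trajectories. *)
Lemma flow_unique (x1 l1 x2 l2 : R -> R) (T t : R) :
  (forall t, flow 1 x1 l1 t) -> (forall t, flow 1 x2 l2 t) ->
  x1 T = x2 T -> l1 T = l2 T -> x1 t = x2 t /\ l1 t = l2 t.
Proof.
  intros F1 F2 Hx Hl.
  set (a := Rmin T t). set (b := Rmax T t).
  assert (Hab : a <= T <= b /\ a <= t <= b).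
  { unfold a, b, Rmin, Rmax. destruct Rle_dec; lra. }
  assert (Hbd : forall f, (forall z, ex_derive f z) -> exists M, forall z, a <= z <= b -> f z <= M).
  { intros f Hf. destruct (continuity_ab_maj f a b) as [z0 [Hz0 _]]; [lra| |now exists (f z0)].
    intros z _. eapply is_derive_continuity_pt, Derive_correct, Hf. }
  assert (E1 : forall z, ex_derive x1 z) by (intros z; destruct (F1 z) as [D _]; eexists; exact D).
  assert (E2 : forall z, ex_derive x2 z) by (intros z; destruct (F2 z) as [D _]; eexists; exact D).
  assert (E3 : forall z, ex_derive l1 z) by (intros z; destruct (F1 z) as [_ D]; eexists; exact D).
  assert (E4 : forall z, ex_derive l2 z) by (intros z; destruct (F2 z) as [_ D]; eexists; exact D).
  destruct (Hbd (fun z => pm * x1 z - l1 z)) as [A1 HA1]; [intros z; auto_derive; auto|].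
  destruct (Hbd (fun z => pm * x2 z - l2 z)) as [A2 HA2]; [intros z; auto_derive; auto|].
  destruct (Hbd (fun z => qm * (x1 z + l1 z))) as [A3 HA3]; [intros z; auto_derive; auto|].
  destruct (Hbd (fun z => qm * (x2 z + l2 z))) as [A4 HA4]; [intros z; auto_derive; auto|].
  destruct (Hbd l1 E3) as [A5 HA5]. destruct (Hbd l2 E4) as [A6 HA6].
  set (M1 := Rmax A1 A2). set (M2 := Rmax A3 A4). set (M3 := exp (Rmax A5 A6)).
  set (C := (pm + 1) * exp M1 + m * qm * exp M2).
  assert (HC : 0 < C).
  { assert (0 < (pm + 1) * exp M1) by (apply Rmult_lt_0_compat; [lra|apply exp_pos]).
    assert (0 < m * qm * exp M2) by (apply Rmult_lt_0_compat; [apply Rmult_lt_0_compat; lra|apply exp_pos]).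
    unfold C; lra. }
  assert (HM3 : 0 < M3) by apply exp_pos.
  set (G := fun z => (x1 z - x2 z) * (x1 z - x2 z) + (l1 z - l2 z) * (l1 z - l2 z)).
  set (dG := fun z => - (2 * ((x1 z - x2 z) * (exp (l1 z) - exp (l2 z)))) +
     2 * ((l1 z - l2 z) * ((exp (l1 z) - exp (l2 z)) + (rest (x1 z) (l1 z) - rest (x2 z) (l2 z))))).
  assert (HG : G t = 0).
  { apply (gronwall_zero G dG (4 * M3 + 4 * C) a b T); try tauto.
    - intros z _. destruct (F1 z) as [G1 G2]. destruct (F2 z) as [G3 G4]. unfold G.
      auto_derive; [repeat split; auto|].
      change (Derive (fun x => x1 x) z) with (Derive x1 z); change (Derive (fun x => l1 x) z) with (Derive l1 z).
      change (Derive (fun x => x2 x) z) with (Derive x2 z); change (Derive (fun x => l2 x) z) with (Derive l2 z).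
      rewrite (is_derive_unique _ _ _ G1), (is_derive_unique _ _ _ G2), (is_derive_unique _ _ _ G3), (is_derive_unique _ _ _ G4).
      rewrite !flow_l_rest. unfold flow_x, dG. ring.
    - intros z _. pose proof (Rle_0_sqr (x1 z - x2 z)). pose proof (Rle_0_sqr (l1 z - l2 z)). unfold Rsqr, G in *. lra.
    - intros z Hz. unfold dG, G.
      assert (HE : Rabs (exp (l1 z) - exp (l2 z)) <= M3 * Rabs (l1 z - l2 z)).
      { apply exp_lipschitz; [eapply Rle_trans; [apply HA5, Hz|apply Rmax_l]|eapply Rle_trans; [apply HA6, Hz|apply Rmax_r]]. }
      assert (HR : Rabs (rest (x1 z) (l1 z) - rest (x2 z) (l2 z)) <= C * (Rabs (x1 z - x2 z) + Rabs (l1 z - l2 z))).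
      { apply rest_lipschitz; [eapply Rle_trans; [apply HA1, Hz|apply Rmax_l]|eapply Rle_trans; [apply HA2, Hz|apply Rmax_r]
          |eapply Rle_trans; [apply HA3, Hz|apply Rmax_l]|eapply Rle_trans; [apply HA4, Hz|apply Rmax_r]]. }
      set (E := exp (l1 z) - exp (l2 z)) in *. set (R := rest (x1 z) (l1 z) - rest (x2 z) (l2 z)) in *.
      set (u := x1 z - x2 z) in *. set (v := l1 z - l2 z) in *.
      assert (Hu : Rabs u * Rabs u = u * u) by (rewrite <- Rabs_mult; apply Rabs_pos_eq, Rle_0_sqr).
      assert (Hv : Rabs v * Rabs v = v * v) by (rewrite <- Rabs_mult; apply Rabs_pos_eq, Rle_0_sqr).
      pose proof (Rabs_pos u). pose proof (Rabs_pos v).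
      set (p := Rabs u) in *. set (w := Rabs v) in *.
      assert (K1 : Rabs (u * E) <= p * (M3 * w)) by (rewrite Rabs_mult; apply Rmult_le_compat_l; lra).
      assert (K2 : Rabs (v * (E + R)) <= w * (M3 * w + C * (p + w))).
      { rewrite Rabs_mult. apply Rmult_le_compat_l; [lra|]. eapply Rle_trans; [apply Rabs_triang|]. lra. }
      assert (K3 : 2 * (p * w) <= u * u + v * v).
      { rewrite <- Hu, <- Hv. pose proof (Rle_0_sqr (p - w)). unfold Rsqr in *. lra. }
      apply Rabs_le_between in K1. apply Rabs_le_between in K2.
      assert (K4 : 2 * (p * (M3 * w)) + 2 * (w * (M3 * w + C * (p + w))) <= (4 * M3 + 4 * C) * (u * u + v * v)).
      { replace (2 * (p * (M3 * w)) + 2 * (w * (M3 * w + C * (p + w))))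
          with (M3 * (2 * (p * w)) + 2 * (M3 * (w * w)) + C * (2 * (p * w)) + 2 * (C * (w * w))) by ring.
        rewrite Hv.
        assert (0 <= u * u) by (rewrite <- Hu; apply Rmult_le_pos; lra).
        assert (0 <= v * v) by (rewrite <- Hv; apply Rmult_le_pos; lra).
        assert (M3 * (2 * (p * w)) <= M3 * (u * u + v * v)) by (apply Rmult_le_compat_l; lra).
        assert (C * (2 * (p * w)) <= C * (u * u + v * v)) by (apply Rmult_le_compat_l; lra).
        assert (0 <= M3 * (u * u)) by (apply Rmult_le_pos; lra).
        assert (0 <= C * (u * u)) by (apply Rmult_le_pos; lra).
        assert (0 <= M3 * (v * v)) by (apply Rmult_le_pos; lra).
        assert (0 <= C * (v * v)) by (apply Rmult_le_pos; lra).
        lra. }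
      apply Rabs_le_between. lra.
    - unfold G. rewrite Hx, Hl. ring. }
  unfold G in HG. pose proof (Rle_0_sqr (x1 t - x2 t)) as Q1. pose proof (Rle_0_sqr (l1 t - l2 t)) as Q2.
  unfold Rsqr in *. split; apply Rminus_diag_uniq, Rsqr_0_uniq; unfold Rsqr; lra.
Qed.

Lemma flow_shift (k h t : R) (xi lam : R -> R) :
  flow k xi lam (t + h) -> flow k (fun t => xi (t + h)) (fun t => lam (t + h)) t.
Proof.
  intros [H1 H2]. split.
  - evar_last; [apply (is_derive_comp xi (fun t => t + h) t _ 1 H1)|]; [auto_derive; [exact I|ring]|apply Rmult_1_l].
  - evar_last; [apply (is_derive_comp lam (fun t => t + h) t _ 1 H2)|]; [auto_derive; [exact I|ring]|apply Rmult_1_l].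
Qed.

(** Each of the two terms of the Lipschitz constant carries a positive power of X, and [A] makes
    each smaller than n/144. *)
Lemma rest_contraction : exists A, forall x1 l1 x2 l2, x1 <= A -> x2 <= A ->
  Rabs (l1 - ln n) < ln 2 -> Rabs (l2 - ln n) < ln 2 ->
  Rabs (rest x1 l1 - rest x2 l2) <= n / 72 * (Rabs (x1 - x2) + Rabs (l1 - l2)).
Proof.
  destruct (exp_small pm ((pm + 1) * exp (ln 2 - ln n)) (n / 144)) as [A1 H1];
    [lra|apply Rmult_le_pos; [lra|left; apply exp_pos]|lra|].
  destruct (exp_small qm (m * qm * exp (qm * (ln n + ln 2))) (n / 144)) as [A2 H2];
    [lra|apply Rmult_le_pos; [apply Rmult_le_pos; lra|left; apply exp_pos]|lra|].
  set (A := Rmin A1 A2). exists A. intros x1 l1 x2 l2 Hx1 Hx2 Hl1 Hl2.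
  specialize (H1 A (Rmin_l _ _)). specialize (H2 A (Rmin_r _ _)).
  apply Rabs_def2 in Hl1. apply Rabs_def2 in Hl2.
  assert (Hp1 : pm * x1 <= pm * A) by (apply Rmult_le_compat_l; lra).
  assert (Hp2 : pm * x2 <= pm * A) by (apply Rmult_le_compat_l; lra).
  eapply Rle_trans; [apply (rest_lipschitz (ln 2 - ln n + pm * A) (qm * (ln n + ln 2) + qm * A))|].
  - lra.
  - lra.
  - rewrite <- Rmult_plus_distr_l. apply Rmult_le_compat_l; lra.
  - rewrite <- Rmult_plus_distr_l. apply Rmult_le_compat_l; lra.
  - rewrite (exp_plus (ln 2 - ln n)), (exp_plus (qm * (ln n + ln 2))).
    apply Rmult_le_compat_r; [|lra].
    pose proof (Rabs_pos (x1 - x2)). pose proof (Rabs_pos (l1 - l2)). lra.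
Qed.

(** The trajectory that is ahead at T is followed until its x reaches that of the other, by the
    intermediate value theorem since it tends to -oo. The delay h is nonnegative, so the bounds
    valid after T survive the shift; this is why the contraction hypothesis has two independent
    times. *)
Lemma stable_unique_aux (T : R) (x1 l1 x2 l2 : R -> R) (c1 : R) :
  (forall t, flow 1 x1 l1 t) -> (forall t, flow 1 x2 l2 t) ->
  (forall e, 0 < e -> exists T, forall t, T <= t -> Rabs (x1 t + (n - al) * t - c1) < e) ->
  (forall e, 0 < e -> exists T, forall t, T <= t -> Rabs (l1 t - ln n) < e) ->
  (forall e, 0 < e -> exists T, forall t, T <= t -> Rabs (l2 t - ln n) < e) ->
  (forall t s, T <= t -> T <= s -> Rabs (l1 t - ln n) < ln 2 /\ Rabs (l2 t - ln n) < ln 2 /\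
     Rabs (rest (x1 s) (l1 s) - rest (x2 t) (l2 t)) <= n / 72 * (Rabs (x1 s - x2 t) + Rabs (l1 s - l2 t))) ->
  x2 T <= x1 T -> exists h, forall t, x2 t = x1 (t + h) /\ l2 t = l1 (t + h).
Proof.
  intros F1 F2 H1 S1 S2 HT Hle.
  destruct (stable_x_small c1 x1 (x2 T) H1) as [T3 HT3].
  set (T4 := Rmax T T3).
  assert (Hc1 : forall z, continuity_pt x1 z) by (intros z; destruct (F1 z) as [D _]; exact (is_derive_continuity_pt _ _ _ D)).
  pose proof (HT3 T4 (Rmax_r _ _)) as H4. pose proof (Rmax_l T T3) as HTT4. fold T4 in HTT4.
  destruct (IVT_gen x1 T T4 (x2 T)) as [T1 [HT1 ET1]].
  { exact Hc1. }
  { rewrite Rmin_right, Rmax_left by lra. lra. }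
  rewrite Rmin_left, Rmax_right in HT1 by assumption.
  set (h := T1 - T). exists h.
  assert (F1h : forall t, flow 1 (fun t => x1 (t + h)) (fun t => l1 (t + h)) t).
  { intros t. apply flow_shift, F1. }
  assert (Ex : x2 T = x1 (T + h)) by (unfold h; replace (T + (T1 - T)) with T1 by ring; symmetry; exact ET1).
  assert (El : l2 T = l1 (T + h)).
  { symmetry. apply (stable_unique_slope T (fun t => x1 (t + h)) (fun t => l1 (t + h)) x2 l2); auto.
    - intros t Ht. apply (HT (t + h) T); unfold h; lra.
    - intros t Ht. apply (HT t T); lra.
    - intros e He. destruct (S1 (e / 2) ltac:(lra)) as [T5 H5]. destruct (S2 (e / 2) ltac:(lra)) as [T6 H6].
      set (t := Rmax T (Rmax T5 T6)).
      pose proof (Rmax_l T (Rmax T5 T6)). pose proof (Rmax_r T (Rmax T5 T6)).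
      pose proof (Rmax_l T5 T6). pose proof (Rmax_r T5 T6). fold t in H, H0.
      exists t. split; [lra|].
      pose proof (Rabs_def2 _ _ (H5 (t + h) ltac:(unfold h; lra))). pose proof (Rabs_def2 _ _ (H6 t ltac:(lra))).
      apply Rabs_def1; lra.
    - intros t Ht. apply HT; unfold h; lra. }
  intros t. apply (flow_unique x2 l2 (fun t => x1 (t + h)) (fun t => l1 (t + h)) T t); auto.
Qed.

Lemma stable_unique (x1 l1 x2 l2 : R -> R) (c1 c2 : R) :
  (forall t, flow 1 x1 l1 t) -> (forall t, flow 1 x2 l2 t) ->
  (forall e, 0 < e -> exists T, forall t, T <= t -> Rabs (x1 t + (n - al) * t - c1) < e) ->
  (forall e, 0 < e -> exists T, forall t, T <= t -> Rabs (x2 t + (n - al) * t - c2) < e) ->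
  exists h, forall t, x2 t = x1 (t + h) /\ l2 t = l1 (t + h).
Proof.
  intros F1 F2 H1 H2.
  pose proof (stable_slope c1 x1 l1 F1 H1) as S1. pose proof (stable_slope c2 x2 l2 F2 H2) as S2.
  assert (Hln2 : 0 < ln 2) by (rewrite <- ln_1; apply ln_increasing; lra).
  destruct (S1 _ Hln2) as [T1 HT1]. destruct (S2 _ Hln2) as [T2 HT2].
  destruct rest_contraction as [A HA].
  destruct (stable_x_small c1 x1 A H1) as [T3 HT3]. destruct (stable_x_small c2 x2 A H2) as [T4 HT4].
  set (T := Rmax (Rmax T1 T2) (Rmax T3 T4)).
  assert (HT : T1 <= T /\ T2 <= T /\ T3 <= T /\ T4 <= T).
  { pose proof (Rmax_l (Rmax T1 T2) (Rmax T3 T4)). pose proof (Rmax_r (Rmax T1 T2) (Rmax T3 T4)).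
    pose proof (Rmax_l T1 T2). pose proof (Rmax_r T1 T2). pose proof (Rmax_l T3 T4). pose proof (Rmax_r T3 T4).
    unfold T. lra. }
  destruct (Rle_lt_dec (x2 T) (x1 T)) as [Hle|Hlt].
  - apply (stable_unique_aux T x1 l1 x2 l2 c1); auto.
    intros t s Ht Hs. split; [apply HT1; lra|]. split; [apply HT2; lra|].
    apply HA; [apply HT3; lra|apply HT4; lra|apply HT1; lra|apply HT2; lra].
  - destruct (stable_unique_aux T x2 l2 x1 l1 c2) as [h Hh]; auto; [|lra|].
    + intros t s Ht Hs. split; [apply HT2; lra|]. split; [apply HT1; lra|].
      apply HA; [apply HT4; lra|apply HT3; lra|apply HT2; lra|apply HT1; lra].
    + exists (- h). intros t. destruct (Hh (t + - h)) as [E1 E2].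
      replace (t + - h + h) with t in * by ring. now split.
Qed.

(** * Construction of the stable trajectory from r = infinity *)

Local Notation ep := (decay_rate n al).
Local Notation nu := (mean_exponent n al).

Let Hep : 0 < ep. Proof. apply Rmult_lt_0_compat; lra. Qed.
Let Hnu : 0 < nu.
Proof.
  pose proof q_minus_1_lt_1.
  assert (ep < n) by (unfold decay_rate; nra). apply Rlt_Rminus.
  apply Rmult_lt_reg_r with ep; [assumption|]. unfold Rdiv. rewrite Rmult_assoc, Rinv_l by lra. lra.
Qed.
Let Hnue : (nu + 1) * ep = n. Proof. unfold mean_exponent. field. lra. Qed.

(** Bounds the field while th <= 1 and the arguments of the powers stay below 2; during [small_time]
    it moves chi by at most 1/4. *)
Definition field_bound := (powa 2 (pm + 1) + m * powa 2 (qm + 1)) / ep.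
Definition small_time := Rmin 1 (1 / (4 * field_bound)).

Let HFB : 0 < field_bound.
Proof.
  apply Rdiv_lt_0_compat; [|assumption].
  assert (0 < powa 2 (pm + 1)) by (apply powa_pos; lra).
  assert (0 < m * powa 2 (qm + 1)) by (apply Rmult_lt_0_compat; [|apply powa_pos]; lra). lra.
Qed.

Let Hst : 0 < small_time <= 1 /\ field_bound * small_time <= 1 / 4.
Proof.
  unfold small_time.
  assert (0 < 1 / (4 * field_bound)) by (apply Rdiv_lt_0_compat; lra).
  split; [split; [apply Rmin_glb_lt; lra|apply Rmin_l]|].
  apply Rle_trans with (field_bound * (1 / (4 * field_bound))); [|right; field; lra].
  apply Rmult_le_compat_l; [lra|apply Rmin_r].
Qed.

Section Solution.
Variables (C : R) (f : R -> R).
Hypothesis HC : 2 < C.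
Hypothesis f_continuous : forall z, continuity_pt f z.
Hypothesis f0 : f 0 = 1.
Hypothesis f_eq : forall x, 0 <= x -> f x = 1 + RInt (clamped_field m ep nu pm qm C f) 0 x.

Local Notation ph := (weighted_mean ep nu f).
Local Notation Fd := (clamped_field m ep nu pm qm C f).

Let Fd_continuous (z : R) : continuity_pt Fd z.
Proof. apply (clamped_field_continuous n); try assumption. lra. Qed.

Lemma solution_derive (x : R) : 0 < x -> is_derive f x (Fd x).
Proof.
  intros Hx. apply (is_derive_ext_pos (fun x => 1 + RInt Fd 0 x)); [assumption| |].
  - intros y Hy. symmetry. apply f_eq. lra.
  - apply is_derive_RInt_continuous. exact Fd_continuous.
Qed.

(* [small_time] must not depend on the clamp [C], which is chosen in terms of it. *)
Lemma solution_small_time (x : R) : 0 <= x -> x <= small_time -> Rabs (f x - 1) <= 1 / 2.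
Proof.
  revert x. apply (real_induction (fun x => x <= small_time -> Rabs (f x - 1) <= 1 / 2)).
  - intros _. rewrite f0, Rminus_diag, Rabs_R0. lra.
  - intros T HT H.
    destruct (Rle_lt_dec small_time T) as [HsT|HsT].
    { exists 1. split; [lra|]. intros; lra. }
    (* The bootstrap: the bound 1/2 on [0, T] improves to 1/4 at T, which leaves room to continue
       beyond T. *)
    assert (HfT : Rabs (f T - 1) <= 1 / 4).
    { rewrite f_eq by assumption.
      replace (1 + RInt Fd 0 T - 1) with ((1 + RInt Fd 0 T) - (1 + RInt Fd 0 0))
        by (rewrite RInt_point; unfold zero; simpl; ring).
      eapply Rle_trans; [apply (mean_value_abs_le (fun x => 1 + RInt Fd 0 x) Fd 0 T field_bound HT)|].
      - intros z _. apply is_derive_RInt_continuous. exact Fd_continuous.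
      - intros z Hz. unfold clamped_field, field_bound, Rdiv.
        rewrite Rabs_mult, (Rabs_pos_eq (/ ep)) by (left; now apply Rinv_0_lt_compat).
        apply Rmult_le_compat_r; [left; now apply Rinv_0_lt_compat|].
        rewrite Rabs_Ropp.
        assert (Hf2 : forall y, 0 <= y <= z -> f y <= 3 / 2).
        { intros y Hy. specialize (H y ltac:(lra) ltac:(lra)). apply Rabs_le_between in H. lra. }
        assert (B1 : 0 <= powa z (pm + 1) * powa (clamp C (ph z)) (pm + 1) <= powa 2 (pm + 1)).
        { split; [apply Rmult_le_pos; apply powa_nonneg|].
          destruct (Rle_lt_dec z 0) as [Hz0|Hz0].
          - rewrite powa_nonpos, Rmult_0_l by assumption. apply powa_nonneg.
          - rewrite <- (Rmult_1_l (powa 2 _)). apply Rmult_le_compat; try apply powa_nonneg.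
            + replace 1 with (powa 1 (pm + 1)) at 2 by (rewrite powa_pos_eq, ln_1, Rmult_0_r, exp_0 by lra; reflexivity).
              apply powa_le; lra.
            + apply powa_le; [lra|]. apply clamp_le; [lra|].
              apply Rle_trans with (3 / 2 / n); [apply weighted_mean_upper; auto|].
              apply Rmult_le_reg_r with n; [lra|]. unfold Rdiv at 1. rewrite Rmult_assoc, Rinv_l by lra. lra. }
        assert (B2 : 0 <= m * powa (clamp C (f z)) (qm + 1) <= m * powa 2 (qm + 1)).
        { split; [apply Rmult_le_pos; [lra|apply powa_nonneg]|].
          apply Rmult_le_compat_l; [lra|]. apply powa_le; [lra|]. apply clamp_le; [lra|].
          specialize (Hf2 z ltac:(lra)). lra. }
        apply Rabs_le_between. lra.
      - apply Rle_trans with (field_bound * small_time); [apply Rmult_le_compat_l; lra|lra]. }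
    apply Rabs_le_between in HfT.
    destruct (continuity_pt_lt f T (3 / 2) (f_continuous T) ltac:(lra)) as [d1 [Hd1 H1]].
    destruct (continuity_pt_gt f T (1 / 2) (f_continuous T) ltac:(lra)) as [d2 [Hd2 H2]].
    exists (Rmin d1 d2). pose proof (Rmin_l d1 d2). pose proof (Rmin_r d1 d2).
    split; [now apply Rmin_glb_lt|]. intros z Hz _.
    specialize (H1 z ltac:(apply Rabs_def1; lra)). specialize (H2 z ltac:(apply Rabs_def1; lra)).
    apply Rabs_le_between. lra.
  - intros T HT H HsT.
    assert (1 / 2 <= f T <= 3 / 2).
    { apply (bounds_at_endpoint f 0 T); [assumption|apply f_continuous|].
      intros z Hz. specialize (H z Hz ltac:(lra)). apply Rabs_le_between in H. lra. }
    apply Rabs_le_between. lra.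
Qed.

Definition unclamped (x : R) := 0 < f x < C /\ 0 < ph x < C.

Lemma unclamped_small_time (x : R) : 0 < x -> x <= small_time -> unclamped x.
Proof.
  intros Hx Hxs.
  assert (Hf : forall y, 0 <= y <= x -> 1 / 2 <= f y <= 3 / 2).
  { intros y Hy. pose proof (solution_small_time y ltac:(lra) ltac:(lra)) as H. apply Rabs_le_between in H. lra. }
  assert (H1 : 1 / 2 / n <= ph x) by (apply weighted_mean_lower; auto; intros y Hy; apply Hf, Hy).
  assert (H2 : ph x <= 3 / 2 / n) by (apply weighted_mean_upper; auto; intros y Hy; apply Hf, Hy).
  assert (0 < 1 / 2 / n) by (apply Rdiv_lt_0_compat; lra).
  assert (3 / 2 / n <= 3 / 2).
  { apply Rmult_le_reg_r with n; [lra|]. unfold Rdiv at 1. rewrite Rmult_assoc, Rinv_l by lra. lra. }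
  specialize (Hf x ltac:(lra)). unfold unclamped. lra.
Qed.

(** X = r^(al - n) phi, and r^(al - n) = th^(1/qm) because ep = (n - al) qm. Likewise s = chi / phi
    in [log_s]. *)
Definition log_x (x : R) := ln x / qm + ln (ph x).
Definition log_s (x : R) := ln (f x) - ln (ph x).

Lemma solution_mean_derive (x : R) : 0 < x -> is_derive ph x ((f x - n * ph x) / (ep * x)).
Proof. intros. now apply weighted_mean_derive. Qed.

Lemma log_flow (x : R) : 0 < x -> unclamped x -> flow (- (1 / (ep * x))) log_x log_s x.
Proof.
  intros Hx [Hf Hph].
  pose proof (solution_derive x Hx) as D1. pose proof (solution_mean_derive x Hx) as D2.
  assert (HK : 0 < n - al) by lra.
  assert (Es : exp (log_s x) = f x / ph x).
  { unfold log_s. replace (ln (f x) - ln (ph x)) with (ln (f x) + - ln (ph x)) by ring.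
    rewrite exp_plus, exp_Ropp, !exp_ln by lra. reflexivity. }
  split.
  - unfold log_x. auto_derive.
    + repeat split; [lra|now eexists; eassumption|lra].
    + change (Derive (fun x0 => ph x0) x) with (Derive ph x). rewrite (is_derive_unique _ _ _ D2).
      unfold flow_x. rewrite Es. set (P := ph x) in *. unfold decay_rate. field. repeat split; lra.
  - unfold log_s at 1. auto_derive.
    + repeat split; [now eexists; eassumption|lra|now eexists; eassumption|lra].
    + change (Derive (fun x0 => ph x0) x) with (Derive ph x). change (Derive (fun x0 => f x0) x) with (Derive f x).
      rewrite (is_derive_unique _ _ _ D1), (is_derive_unique _ _ _ D2).
      unfold flow_l. rewrite Es.
      assert (E1 : exp (pm * log_x x - log_s x) = powa x (pm + 1) * x * powa (ph x) (pm + 1) / f x).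
      { rewrite !powa_pos_eq by lra.
        transitivity (exp ((pm + 1) * ln x) * exp (ln x) * exp ((pm + 1) * ln (ph x)) * exp (- ln (f x))).
        2:{ rewrite exp_Ropp, !exp_ln by lra. reflexivity. }
        rewrite <- !exp_plus. f_equal. unfold log_x, log_s.
        rewrite p_minus_1_of_q_minus_1 at 1. rewrite Rmult_plus_distr_l.
        replace (qm * (pm + 2) * (ln x / qm)) with ((pm + 2) * ln x) by (field; lra).
        rewrite <- p_minus_1_of_q_minus_1. ring. }
      assert (E2 : exp (qm * (log_x x + log_s x)) = x * powa (f x) (qm + 1) / f x).
      { rewrite !powa_pos_eq by lra.
        transitivity (exp (ln x) * exp ((qm + 1) * ln (f x)) * exp (- ln (f x))).
        2:{ rewrite exp_Ropp, !exp_ln by lra. reflexivity. }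
        rewrite <- !exp_plus. f_equal. unfold log_x, log_s.
        field. lra. }
      rewrite E1, E2. unfold clamped_field. rewrite !clamp_id by lra.
      field. repeat split; lra.
Qed.

Let W (x : R) := VV (log_x x) (log_s x).

Lemma lyapunov_nonincreasing (a b : R) : 0 < a <= b -> (forall x, a <= x <= b -> unclamped x) -> W b <= W a.
Proof.
  intros Hab Hg.
  apply (nonincreasing_of_derive W (fun x => - (1 / (ep * x)) *
    (exp (ga * log_x x) * ((al - exp (log_s x)) * (JJ (log_x x) la - JJ (log_x x) (log_s x)))))); [lra| |].
  - intros x Hx. destruct (log_flow x ltac:(lra) (Hg x Hx)) as [H1 H2].
    exact (lyapunov_derive log_x log_s _ x H1 H2).
  - intros x Hx. pose proof (lyapunov_rate_nonneg (log_x x) (log_s x)) as H.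
    assert (0 < 1 / (ep * x)) by (apply Rdiv_lt_0_compat; [lra|apply Rmult_lt_0_compat; lra]).
    set (d := exp (ga * log_x x) * ((al - exp (log_s x)) * (JJ (log_x x) la - JJ (log_x x) (log_s x)))) in *. nra.
Qed.

(** At th = 0 one has chi = 1, hence the mean phi tends to 1/n: s tends to n and X to 0. The limit
    ln(1/n) becomes the constant in the asymptotics of x. *)
Lemma log_near_zero (A e b : R) : 0 < e -> 0 < b -> exists x0, 0 < x0 <= b /\ forall x, 0 < x <= x0 ->
  log_x x <= A /\ Rabs (log_s x - ln n) < e /\ Rabs (ln (ph x) - ln (1 / n)) < e.
Proof.
  intros He Hb.
  destruct (ln_near_one (e / 2) ltac:(lra)) as [d [Hd Hln]].
  destruct (continuity_pt_lt f 0 (1 + d / 2) (f_continuous 0) ltac:(lra)) as [d1 [Hd1 H1]].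
  destruct (continuity_pt_gt f 0 (1 - d / 2) (f_continuous 0) ltac:(lra)) as [d2 [Hd2 H2]].
  set (B := exp (qm * (A - e / 2 - ln (1 / n)))). assert (HB : 0 < B) by apply exp_pos.
  set (x0 := Rmin (Rmin (d1 / 2) (d2 / 2)) (Rmin b B)).
  assert (Hx0 : 0 < x0 /\ x0 < d1 /\ x0 < d2 /\ x0 <= b /\ x0 <= B).
  { pose proof (Rmin_l (Rmin (d1 / 2) (d2 / 2)) (Rmin b B)). pose proof (Rmin_r (Rmin (d1 / 2) (d2 / 2)) (Rmin b B)).
    pose proof (Rmin_l (d1 / 2) (d2 / 2)). pose proof (Rmin_r (d1 / 2) (d2 / 2)). pose proof (Rmin_l b B). pose proof (Rmin_r b B).
    fold x0 in H, H0. split; [repeat apply Rmin_glb_lt; lra|]. lra. }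
  exists x0. split; [lra|]. intros x Hx.
  assert (Hf : forall y, 0 <= y <= x -> 1 - d / 2 <= f y <= 1 + d / 2).
  { intros y Hy. assert (Hy0 : Rabs (y - 0) < x0 + (Rmin d1 d2 - x0)).
    { rewrite Rminus_0_r, Rabs_pos_eq by lra. unfold Rmin. destruct Rle_dec; lra. }
    assert (Rabs (y - 0) < Rmin d1 d2) by lra.
    pose proof (Rmin_l d1 d2). pose proof (Rmin_r d1 d2).
    specialize (H1 y ltac:(lra)). specialize (H2 y ltac:(lra)). lra. }
  assert (P1 : (1 - d / 2) / n <= ph x) by (apply weighted_mean_lower; auto; try lra; intros y Hy; apply Hf, Hy).
  assert (P2 : ph x <= (1 + d / 2) / n) by (apply weighted_mean_upper; auto; try lra; intros y Hy; apply Hf, Hy).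
  assert (Hphn : 1 - d / 2 <= n * ph x <= 1 + d / 2).
  { split; apply Rmult_le_reg_r with (/ n); try (apply Rinv_0_lt_compat; lra);
      replace (n * ph x * / n) with (ph x) by (field; lra); assumption. }
  specialize (Hf x ltac:(lra)).
  assert (L1 : Rabs (ln (f x)) < e / 2) by (apply Hln, Rabs_def1; lra).
  assert (L2 : Rabs (ln (n * ph x)) < e / 2) by (apply Hln, Rabs_def1; lra).
  assert (Hph0 : 0 < ph x) by nra.
  rewrite ln_mult in L2 by lra.
  assert (Elnn : ln (1 / n) = - ln n) by (unfold Rdiv; rewrite Rmult_1_l; apply ln_Rinv; lra).
  apply Rabs_def2 in L1. apply Rabs_def2 in L2. rewrite Elnn. unfold log_s, log_x.
  split; [|split; apply Rabs_def1; lra].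
  assert (ln x <= qm * (A - e / 2 - ln (1 / n))).
  { rewrite <- (ln_exp (qm * _)). apply ln_le; [lra|]. fold B. lra. }
  rewrite Elnn in H.
  assert (ln x / qm <= A - e / 2 - - ln n); [|lra].
  apply Rmult_le_reg_l with qm; [assumption|]. replace (qm * (ln x / qm)) with (ln x) by (field; lra). exact H.
Qed.

(** Near th = 0, V < 0 by [lyapunov_neg_near_stable], and V decreases as th grows. For th >=
    [small_time] the bounds x, l <= A give phi <= exp(A - ln small_time / qm) and chi = phi s <=
    exp(2 A - ln small_time / qm). Neither involves C, so C can be taken above them and the clamp
    stays inactive. *)
Lemma unclamped_forever (A : R) :
  (forall x l, VV x l < 0 -> x <= A /\ l <= A) ->
  exp (A - ln small_time / qm) < C -> exp (2 * A - ln small_time / qm) < C ->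
  exists d, 0 < d /\ forall x, 0 < x -> unclamped x /\ (small_time <= x -> W x <= - d).
Proof.
  intros HA HC1 HC2.
  destruct lyapunov_neg_near_stable as [A1 [e1 [He1 Hneg]]].
  destruct (log_near_zero A1 e1 small_time He1 ltac:(lra)) as [x1 [Hx1 H1]].
  destruct (H1 x1 ltac:(lra)) as [L1 [L2 _]].
  set (d := - W x1). assert (Hd : 0 < d) by (pose proof (Hneg _ _ L1 L2); unfold d, W; lra).
  destruct (lyapunov_le_neg_bounded d Hd) as [A2 HA2].
  assert (HW0 : W small_time <= - d).
  { replace (- d) with (W x1) by (unfold d; ring). apply lyapunov_nonincreasing; [lra|].
    intros x Hx. apply unclamped_small_time; lra. }
  exists d. split; [assumption|].
  assert (Hmain : forall x, small_time <= x -> unclamped x).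
  { apply real_induction.
    - apply unclamped_small_time; lra.
    - intros T HT H. destruct (H T ltac:(lra)) as [[G1 G2] [G3 G4]].
      assert (HT0 : 0 < T) by lra.
      assert (Hc : continuity_pt ph T) by (eapply is_derive_continuity_pt, solution_mean_derive, HT0).
      destruct (continuity_pt_gt f T 0 (f_continuous T) G1) as [d1 [Hd1 K1]].
      destruct (continuity_pt_lt f T C (f_continuous T) G2) as [d2 [Hd2 K2]].
      destruct (continuity_pt_gt ph T 0 Hc G3) as [d3 [Hd3 K3]].
      destruct (continuity_pt_lt ph T C Hc G4) as [d4 [Hd4 K4]].
      exists (Rmin (Rmin d1 d2) (Rmin d3 d4)). split; [repeat apply Rmin_glb_lt; assumption|].
      intros z Hz. pose proof (Rmin_l (Rmin d1 d2) (Rmin d3 d4)). pose proof (Rmin_r (Rmin d1 d2) (Rmin d3 d4)).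
      pose proof (Rmin_l d1 d2). pose proof (Rmin_r d1 d2). pose proof (Rmin_l d3 d4). pose proof (Rmin_r d3 d4).
      specialize (K1 z ltac:(apply Rabs_def1; lra)). specialize (K2 z ltac:(apply Rabs_def1; lra)).
      specialize (K3 z ltac:(apply Rabs_def1; lra)). specialize (K4 z ltac:(apply Rabs_def1; lra)).
      unfold unclamped. lra.
    - intros T HT H.
      assert (HT0 : 0 < T) by lra.
      set (cT := ln T / qm).
      (* The upper bounds do not depend on T. The lower ones do, through [cT], which suffices since
         they only keep chi and phi positive at T. *)
      assert (HB : forall z, small_time <= z < T ->
         exp (- A2 - cT) <= ph z <= exp (A - ln small_time / qm) /\
         exp (- (2 * A2) - cT) <= f z <= exp (2 * A - ln small_time / qm)).
      { intros z Hz.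
        assert (HWz : W z <= - d).
        { apply Rle_trans with (W small_time); [|assumption]. apply lyapunov_nonincreasing; [lra|]. intros y Hy. apply H. lra. }
        destruct (H z Hz) as [[G1 G2] [G3 G4]].
        assert (HWn : W z < 0) by lra. destruct (HA _ _ HWn) as [U1 U2].
        destruct (HA2 _ _ HWz) as [U3 U4].
        assert (Q1 : ln small_time / qm <= ln z / qm).
        { apply Rmult_le_compat_r; [left; now apply Rinv_0_lt_compat|]. apply ln_le; lra. }
        assert (Q2 : ln z / qm <= cT).
        { apply Rmult_le_compat_r; [left; now apply Rinv_0_lt_compat|]. apply ln_le; lra. }
        unfold log_x, log_s in *.
        rewrite <- (exp_ln (ph z)) by assumption. rewrite <- (exp_ln (f z)) by assumption.
        repeat split; apply exp_le_compat; lra. }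
      destruct (bounds_at_endpoint ph small_time T (exp (- A2 - cT)) (exp (A - ln small_time / qm))) as [B1 B2];
        [assumption|eapply is_derive_continuity_pt, solution_mean_derive, HT0|intros z Hz; apply HB, Hz|].
      destruct (bounds_at_endpoint f small_time T (exp (- (2 * A2) - cT)) (exp (2 * A - ln small_time / qm))) as [B3 B4];
        [assumption|apply f_continuous|intros z Hz; apply HB, Hz|].
      pose proof (exp_pos (- A2 - cT)). pose proof (exp_pos (- (2 * A2) - cT)). unfold unclamped. lra. }
  intros x Hx. split.
  - destruct (Rle_lt_dec small_time x); [now apply Hmain|apply unclamped_small_time; lra].
  - intros Hsx. apply Rle_trans with (W small_time); [|assumption]. apply lyapunov_nonincreasing; [lra|].
    intros y Hy. apply Hmain. lra.
Qed.

End Solution.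

Lemma stable_trajectory : exists (xi lam : R -> R) (c : R),
  (forall t, flow 1 xi lam t) /\
  (forall e, 0 < e -> exists T, forall t, T <= t -> Rabs (xi t + (n - al) * t - c) < e) /\
  (forall x0, FE x0 = 0 -> forall e, 0 < e -> exists T, forall t, t <= T -> Rabs (xi t - x0) < e).
Proof.
  destruct lyapunov_neg_bounded as [A HA].
  set (C := 3 + exp (A - ln small_time / qm) + exp (2 * A - ln small_time / qm)).
  pose proof (exp_pos (A - ln small_time / qm)) as P1. pose proof (exp_pos (2 * A - ln small_time / qm)) as P2.
  assert (HC : 2 < C) by (unfold C; lra).
  destruct (clamped_solution n m ep nu pm qm C) as [f [Hfc [Hf0 Hfe]]]; try assumption; try lra.
  destruct (unclamped_forever C f HC Hfc Hf0 Hfe A HA) as [d [Hd Hgood]]; [unfold C; lra|unfold C; lra|].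
  set (lx := log_x f). set (ls := log_s f). set (th := fun t => exp (- (ep * t))).
  assert (Hth : forall t, 0 < th t) by (intros; apply exp_pos).
  assert (Dth : forall t, is_derive th t (- ep * th t)).
  { intros t. unfold th. auto_derive; [exact I|ring]. }
  assert (Hflow : forall t, flow 1 (fun t => lx (th t)) (fun t => ls (th t)) t).
  { intros t. destruct (Hgood (th t) (Hth t)) as [G _].
    destruct (log_flow C f HC Hfc Hfe (th t) (Hth t) G) as [D1 D2]. specialize (Hth t).
    split.
    - evar_last; [apply (is_derive_comp lx th t _ _ D1 (Dth t))|]. unfold scal; simpl; unfold mult; simpl.
      fold ls. field. lra.
    - evar_last; [apply (is_derive_comp ls th t _ _ D2 (Dth t))|]. unfold scal; simpl; unfold mult; simpl.
      fold ls lx. field. lra. }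
  exists (fun t => lx (th t)), (fun t => ls (th t)), (ln (1 / n)). split; [exact Hflow|]. split.
  - intros e He. destruct (log_near_zero f Hfc Hf0 0 e 1 He ltac:(lra)) as [x0 [Hx0 H]].
    exists (- ln x0 / ep). intros t Ht.
    assert (Htx : th t <= x0).
    { unfold th. rewrite <- (exp_ln x0) by lra. apply exp_le_compat.
      apply Rmult_le_compat_l with (r := ep) in Ht; [|lra].
      replace (ep * (- ln x0 / ep)) with (- ln x0) in Ht by (field; lra). lra. }
    destruct (H (th t)) as [_ [_ H3]]; [specialize (Hth t); lra|].
    replace (lx (th t) + (n - al) * t - ln (1 / n)) with (ln (weighted_mean ep nu f (th t)) - ln (1 / n)); [assumption|].
    unfold lx, log_x, th at 2. rewrite ln_exp. set (P := ln (weighted_mean ep nu f (th t))). unfold decay_rate. field. lra.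
  - intros x0 H0 e He.
    destruct (lyapunov_le_neg_bounded d Hd) as [A2 HA2].
    set (A3 := Rmax A A2).
    set (T0 := ln small_time / ep).
    assert (Hlate : forall t, T0 <= t -> small_time <= th (- t)).
    { intros t Ht. unfold th. rewrite <- (exp_ln small_time) by lra. apply exp_le_compat.
      apply Rmult_le_compat_l with (r := ep) in Ht; [|lra].
      replace (ep * T0) with (ln small_time) in Ht by (unfold T0; field; lra). lra. }
    assert (Hb : forall t, T0 <= t -> (- A3 <= lx (th (- t)) <= A3) /\ ls (th (- t)) <= A3).
    { intros t Ht. destruct (Hgood (th (- t)) (Hth _)) as [_ HW]. specialize (HW (Hlate t Ht)).
      destruct (HA2 _ _ HW) as [U1 U2]. assert (HWn : VV (lx (th (- t))) (ls (th (- t))) < 0) by (unfold lx, ls; lra). destruct (HA _ _ HWn) as [U3 U4].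
      pose proof (Rmax_l A A2). pose proof (Rmax_r A A2). fold A3 in H, H1. fold lx in U1, U3. fold ls in U2, U4. lra. }
    (* As t tends to -oo, th tends to infinity and V <= -d confines the trajectory to a compact set;
       convergence is applied in reversed time, hence -1. *)
    destruct (trajectory_limit (-1) T0 A3 x0 (fun t => lx (th (- t))) (fun t => ls (th (- t)))) with (e := e) as [T' [HT' H]];
      [lra| |intros t Ht; apply Hb, Ht|intros t Ht; apply Hb, Ht|assumption|assumption|].
    + intros t Ht. destruct (Hflow (- t)) as [D1 D2].
      assert (Dn : is_derive Ropp t (- 1)) by (auto_derive; [exact I|ring]).
      split.
      * evar_last; [apply (is_derive_comp (fun t => lx (th t)) Ropp t _ _ D1 Dn)|]. unfold scal; simpl; unfold mult; simpl. ring.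
      * evar_last; [apply (is_derive_comp (fun t => ls (th t)) Ropp t _ _ D2 Dn)|]. unfold scal; simpl; unfold mult; simpl. ring.
    + exists (- T'). intros t Ht. destruct (H (- t) ltac:(lra)) as [H1 _]. rewrite Ropp_involutive in H1. exact H1.
Qed.

End Flow.

Lemma filterlim_at_right_0 (f : R -> R) (l : R) :
  filterlim f (at_right 0) (locally l) <->
  forall e, 0 < e -> exists d, 0 < d /\ forall h, 0 < h < d -> Rabs (f h - l) < e.
Proof.
  rewrite filterlim_locally. split.
  - intros H e He. destruct (H (mkposreal e He)) as [d Hd]. exists d. split; [apply cond_pos|].
    intros h Hh. apply (Hd h); [|lra].
    change (Rabs (h - 0) < d). rewrite Rminus_0_r, Rabs_pos_eq; lra.
  - intros H e. destruct (H e (cond_pos e)) as [d [Hd Hd']]. exists (mkposreal d Hd).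
    intros h Hh Hh0. apply Hd'. assert (Rabs (h - 0) < d) as Hb by exact Hh. apply Rabs_def2 in Hb. lra.
Qed.

Lemma filterlim_p_infty (f : R -> R) (l : R) :
  filterlim f (Rbar_locally p_infty) (locally l) <->
  forall e, 0 < e -> exists B, forall x, B < x -> Rabs (f x - l) < e.
Proof.
  rewrite filterlim_locally. split.
  - intros H e He. exact (H (mkposreal e He)).
  - intros H e. exact (H e (cond_pos e)).
Qed.

(** * Back to the radial equation *)

Section Exponents.
Variables (N : nat) (p M : R).
Hypothesis HN : (3 <= N)%nat.
Hypothesis Hp : INR N / (INR N - 2) < p < (INR N + 2) / (INR N - 2).
Hypothesis HM : Mbar N p <= M < 0.

Local Notation n := (INR N - 2).
Local Notation al := (2 / (p - 1)).
Local Notation m := (- M).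

Lemma dimension_ge : 1 <= n.
Proof. apply le_INR in HN. simpl in HN. lra. Qed.

Lemma exponent_bounds : n + 2 < n * p < n + 4 /\ 1 < p.
Proof.
  pose proof dimension_ge as Hn. destruct Hp as [H1 H2].
  apply Rmult_lt_compat_l with (r := n) in H1; [|lra]. apply Rmult_lt_compat_l with (r := n) in H2; [|lra].
  replace (n * (INR N / n)) with (INR N) in H1 by (field; lra).
  replace (n * ((INR N + 2) / n)) with (INR N + 2) in H2 by (field; lra).
  split; [lra|]. apply Rmult_lt_reg_l with n; lra.
Qed.

Lemma p_minus_1_eq : p_minus_1 al = p - 1.
Proof. pose proof exponent_bounds. unfold p_minus_1. field. lra. Qed.

Lemma q_minus_1_eq : q_minus_1 al = (p - 1) / (p + 1).
Proof. pose proof exponent_bounds. unfold q_minus_1. field. lra. Qed.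

Lemma gradient_exponent_eq : 2 * p / (p + 1) = q_minus_1 al + 1.
Proof. pose proof exponent_bounds. rewrite q_minus_1_eq. field. lra. Qed.

Lemma al_bounds : al < n < 2 * al.
Proof.
  pose proof exponent_bounds. split; apply Rmult_lt_reg_r with (p - 1); try lra.
  - replace (al * (p - 1)) with 2 by (field; lra). lra.
  - replace (2 * al * (p - 1)) with 4 by (field; lra). lra.
Qed.

(** Since a = rho b with the same power of b overall, b and rho leave the weighted geometric mean
    and only (p ln p + ln rho) / (p + 1) remains in the exponent. *)
Lemma Mbar_eq : Mbar N p = - dulac_bound n al.
Proof.
  pose proof exponent_bounds as He. pose proof dimension_ge as Hn. pose proof al_bounds as Ha.
  assert (Hb : 0 < dulac_b n al).
  { apply Rdiv_lt_0_compat; apply Rmult_lt_0_compat; lra. }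
  set (rho := (n + al ^ 2) / al ^ 2).
  assert (Hal2 : 0 < al ^ 2) by (apply pow_lt; lra).
  assert (Hrho : 0 < rho) by (apply Rdiv_lt_0_compat; lra).
  assert (Haa : dulac_a n al = dulac_b n al * rho).
  { unfold rho, dulac_a, dulac_g, dulac_b. field. repeat split; lra. }
  unfold dulac_bound. rewrite Haa, p_minus_1_eq, q_minus_1_eq.
  replace (p - 1 + 1) with p by ring. replace (p - 1 + 2) with (p + 1) by ring.
  assert (E1 : (p * ln (dulac_b n al * rho / p) + ln (dulac_b n al)) / (p + 1)
     = ln (dulac_b n al) + ln rho + - ((p * ln p + ln rho) / (p + 1))).
  { assert (0 < dulac_b n al * rho) by (apply Rmult_lt_0_compat; assumption).
    rewrite ln_div, ln_mult by lra. field. lra. }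
  rewrite E1, !exp_plus, !exp_ln by assumption.
  unfold Mbar, Rpower.
  (* 4 / al^2 = (p - 1)^2. The factors 4 under the two radicals of [Mbar] have exponents adding up
     to 1. *)
  replace (n * (p - 1) ^ 2 + 4) with (4 * rho) by (unfold rho; field; lra).
  rewrite (ln_mult 4 p), (ln_mult 4 rho) by lra. rewrite <- exp_plus.
  replace (p / (p + 1) * (ln 4 + ln p) + 1 / (p + 1) * (ln 4 + ln rho))
    with (ln 4 + (p * ln p + ln rho) / (p + 1)) by (field; lra).
  rewrite exp_plus, exp_ln, exp_Ropp by lra.
  set (E := exp ((p * ln p + ln rho) / (p + 1))). assert (0 < E) by apply exp_pos.
  unfold dulac_b, rho.
  replace (INR N) with (n + 2) by ring. replace (n + 2 - 2) with n by ring.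
  set (k := n) in *. clearbody k.
  field. repeat split; try lra; nra.
Qed.

Lemma parameters_admissible : admissible n al m.
Proof.
  pose proof dimension_ge. pose proof al_bounds. pose proof Mbar_eq. unfold admissible. lra.
Qed.

Lemma FX_eq (x : R) : FX N p M (exp x) = isocline_rate n al m x.
Proof.
  pose proof exponent_bounds as He.
  unfold FX, isocline_rate, Kc, Rpower. rewrite !powa_pos_eq, ln_exp by apply exp_pos.
  rewrite gradient_exponent_eq, p_minus_1_eq, (Rplus_comm 1), q_minus_1_eq. field. lra.
Qed.

(** The choice operator returns a genuine root because [isocline_rate_root] supplies one; under X =
    exp x the two equations coincide. *)
Lemma XM_spec : 0 < XM N p M /\ isocline_rate n al m (ln (XM N p M)) = 0.
Proof.
  assert (H : 0 < XM N p M /\ FX N p M (XM N p M) = 0).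
  { unfold XM. apply epsilon_spec. destruct (isocline_rate_root parameters_admissible) as [x Hx].
    exists (exp x). split; [apply exp_pos|]. now rewrite FX_eq. }
  destruct H as [H1 H2]. split; [assumption|]. rewrite <- FX_eq, exp_ln; assumption.
Qed.

(** * Monotonicity and positivity of radial solutions *)

Definition equation (u u1 u2 : R -> R) := forall r, 0 < r ->
  is_derive u r (u1 r) /\ is_derive u1 r (u2 r) /\
  - u2 r - (INR N - 1) / r * u1 r
    = powa (Rabs (u r)) (p - 1) * u r + M * powa (Rabs (u1 r)) (2 * p / (p + 1)).

Section Solution.
Variables u u1 u2 : R -> R.
Hypothesis Hu : equation u u1 u2.

Lemma equation_flow : (forall r, 0 < r -> 0 < u r) -> (forall r, 0 < r -> u1 r < 0) ->
  forall t, flow_at n al m 1 (fun t => al * t + ln (u (exp t)))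
    (fun t => t + ln (- u1 (exp t)) - ln (u (exp t))) t.
Proof.
  intros Hpos Hneg t. pose proof exponent_bounds as He. pose proof al_bounds as Ha. pose proof dimension_ge as Hn.
  set (r := exp t). assert (Hr : 0 < r) by apply exp_pos.
  assert (Elnr : ln r = t) by apply ln_exp.
  destruct (Hu r Hr) as [D1 [D2 E]]. specialize (Hpos r Hr). specialize (Hneg r Hr).
  set (w := - u1 r) in *. assert (Hw : 0 < w) by (unfold w; lra).
  assert (Es : exp (t + ln w - ln (u r)) = r * w / u r).
  { replace (t + ln w - ln (u r)) with (t + ln w + - ln (u r)) by ring.
    rewrite !exp_plus, exp_Ropp, !exp_ln by assumption. reflexivity. }
  split.
  - auto_derive; [repeat split; [now eexists; exact D1|fold r; lra]|]. fold r.
    change (Derive (fun x => u x) r) with (Derive u r). rewrite (is_derive_unique _ _ _ D1).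
    unfold flow_x. fold w. rewrite Es. unfold w. field. lra.
  - auto_derive; [repeat split; try (now eexists; eassumption); fold r; fold w; lra|]. fold r.
    change (Derive (fun x => u x) r) with (Derive u r). change (Derive (fun x => u1 x) r) with (Derive u1 r).
    rewrite (is_derive_unique _ _ _ D1), (is_derive_unique _ _ _ D2).
    unfold flow_l. fold w. rewrite Es.
    rewrite (Rabs_pos_eq (u r)), (Rabs_left (u1 r)) in E by lra. fold w in E.
    rewrite gradient_exponent_eq, (powa_S w) in E by assumption.
    assert (E1 : exp (p_minus_1 al * (al * t + ln (u r)) - (t + ln w - ln (u r))) = r * (powa (u r) (p - 1) * u r) / w).
    { rewrite powa_pos_eq by assumption.
      transitivity (exp t * (exp ((p - 1) * ln (u r)) * exp (ln (u r))) * exp (- ln w)).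
      2:{ rewrite exp_Ropp, !exp_ln by assumption. reflexivity. }
      rewrite <- !exp_plus. f_equal. rewrite p_minus_1_eq. field. lra. }
    assert (E2 : exp (q_minus_1 al * (al * t + ln (u r) + (t + ln w - ln (u r)))) = r * powa w (q_minus_1 al)).
    { rewrite powa_pos_eq by assumption. unfold r. rewrite <- exp_plus. f_equal. unfold q_minus_1. field. lra. }
    rewrite E1, E2.
    set (P := powa (u r) (p - 1) * u r) in *. set (Q := powa w (q_minus_1 al)) in *.
    replace (u2 r) with ((INR N - 1) / r * w - P - M * (Q * w)) by (unfold w in *; lra).
    replace (u1 r) with (- w) by (unfold w; ring). field. lra.
Qed.

Hypothesis Hnonneg : forall r, 0 < r -> 0 <= u r.

Lemma second_derivative_le (r : R) : 0 < r -> 0 < u1 r ->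
  u2 r <= u1 r * (m * powa (u1 r) (q_minus_1 al) - (INR N - 1) / r).
Proof.
  intros Hr H1. destruct (Hu r Hr) as [_ [_ E]].
  rewrite (Rabs_pos_eq (u1 r)), gradient_exponent_eq, powa_S in E by lra.
  assert (0 <= powa (Rabs (u r)) (p - 1) * u r) by (apply Rmult_le_pos; [apply powa_nonneg|auto]). lra.
Qed.

(* At a level u' = b small, (N-1) u'/r dominates m u'^q, so u'' < 0 and u' > b propagates inwards. *)
Lemma increasing_near_zero (r0 : R) : 0 < r0 -> 0 < u1 r0 ->
  exists b, 0 < b /\ forall r, 0 < r <= r0 -> b < u1 r.
Proof.
  intros Hr0 H1. pose proof dimension_ge as Hn. pose proof exponent_bounds as He. pose proof al_bounds as Ha.
  assert (Hq : 0 < q_minus_1 al) by (apply Rdiv_lt_0_compat; lra).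
  destruct (powa_small (q_minus_1 al) (1 / (r0 * m))) as [d [Hd Hd']]; [assumption| |].
  { apply Rdiv_lt_0_compat; [lra|]. apply Rmult_lt_0_compat; lra. }
  set (b := Rmin (d / 2) (u1 r0 / 2)).
  assert (Hb : 0 < b /\ b < d /\ b < u1 r0).
  { pose proof (Rmin_l (d / 2) (u1 r0 / 2)). pose proof (Rmin_r (d / 2) (u1 r0 / 2)).
    fold b in H, H0. split; [apply Rmin_glb_lt; lra|]. lra. }
  exists b. split; [lra|].
  (* The substitution r = r0 exp(-s) turns propagation towards r = 0 into a forward barrier in s. *)
  assert (Hbar : forall s, 0 <= s -> b < u1 (r0 * exp (- s))).
  { apply (barrier (fun s => u1 (r0 * exp (- s))) (fun s => - (r0 * exp (- s)) * u2 (r0 * exp (- s)))).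
    - rewrite Ropp_0, exp_0, Rmult_1_r. lra.
    - intros s _. assert (Hrs : 0 < r0 * exp (- s)) by (apply Rmult_lt_0_compat; [lra|apply exp_pos]).
      destruct (Hu _ Hrs) as [_ [D _]].
      evar_last; [apply (is_derive_comp u1 (fun s => r0 * exp (- s)) s _ (- (r0 * exp (- s))) D)|].
      + auto_derive; [exact I|ring].
      + reflexivity.
    - intros s Hs E. set (r := r0 * exp (- s)) in *.
      assert (Hr : 0 < r) by (apply Rmult_lt_0_compat; [lra|apply exp_pos]).
      assert (Hrr : r <= r0).
      { unfold r. rewrite <- (Rmult_1_r r0) at 2. apply Rmult_le_compat_l; [lra|].
        rewrite <- exp_0. apply exp_le_compat. lra. }
      pose proof (second_derivative_le r Hr ltac:(lra)) as H. rewrite E in H.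
      specialize (Hd' b ltac:(lra)).
      assert (K1 : m * powa b (q_minus_1 al) < 1 / r0).
      { apply Rmult_lt_compat_l with (r := m) in Hd'; [|lra].
        replace (m * (1 / (r0 * m))) with (1 / r0) in Hd' by (field; lra). exact Hd'. }
      assert (K2 : 1 / r0 <= 1 / r) by (apply Rmult_le_compat_l; [lra|apply Rinv_le_contravar; lra]).
      assert (K3 : 1 / r <= (INR N - 1) / r).
      { apply Rmult_le_compat_r; [left; now apply Rinv_0_lt_compat|lra]. }
      assert (b * (m * powa b (q_minus_1 al) - (INR N - 1) / r) < 0) by nra.
      nra. }
  intros r Hr. specialize (Hbar (- ln (r / r0))).
  rewrite Ropp_involutive, exp_ln in Hbar by (apply Rdiv_lt_0_compat; lra).
  replace (r0 * (r / r0)) with r in Hbar by (field; lra). apply Hbar.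
  assert (ln (r / r0) <= ln 1); [|rewrite ln_1 in *; lra].
  apply ln_le; [apply Rdiv_lt_0_compat; lra|].
  apply Rmult_le_reg_r with r0; [lra|]. unfold Rdiv. rewrite Rmult_assoc, Rinv_l by lra. lra.
Qed.

Lemma solution_le_of_derive_pos (b r0 : R) : 0 < b -> (forall r, 0 < r <= r0 -> b < u1 r) ->
  forall r, 0 < r <= r0 -> u r <= u r0.
Proof.
  intros Hb H r Hr. apply (nondecreasing_of_derive u u1); [lra| |].
  - intros x Hx. apply Hu. lra.
  - intros x Hx. specialize (H x ltac:(lra)). lra.
Qed.

Lemma solution_nonincreasing : (forall r, 0 < r -> u1 r <= 0) -> forall a b, 0 < a <= b -> u b <= u a.
Proof.
  intros H a b Hab. apply (nonincreasing_of_derive u u1); [lra| |].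
  - intros x Hx. apply Hu. lra.
  - intros x Hx. apply H. lra.
Qed.

(** At a zero of u' the equation reduces to u'' = -u^p < 0, so u' would be positive just to the
    left. *)
Lemma strictly_decreasing : (forall r, 0 < r -> 0 < u r) -> (forall r, 0 < r -> u1 r <= 0) ->
  forall r, 0 < r -> u1 r < 0.
Proof.
  intros Hpos H r Hr. destruct (Rle_lt_or_eq_dec _ _ (H r Hr)) as [|E0]; [assumption|exfalso].
  destruct (Hu r Hr) as [_ [D E]]. rewrite E0, Rabs_R0, (powa_nonpos 0) in E by lra.
  assert (0 < powa (Rabs (u r)) (p - 1) * u r).
  { apply Rmult_lt_0_compat; [apply powa_pos, Rabs_pos_lt|]; specialize (Hpos r Hr); lra. }
  destruct (derive_pos_left (fun z => - u1 z) r (- u2 r)) as [d [Hd Hz]].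
  - apply (is_derive_opp u1 r (u2 r) D).
  - lra.
  - specialize (Hz (r - Rmin (d / 2) (r / 2))).
    pose proof (Rmin_l (d / 2) (r / 2)). pose proof (Rmin_r (d / 2) (r / 2)).
    assert (0 < Rmin (d / 2) (r / 2)) by (apply Rmin_glb_lt; lra).
    specialize (Hz ltac:(lra)). specialize (H (r - Rmin (d / 2) (r / 2)) ltac:(lra)). lra.
Qed.

(** Away from r = 0 the second derivative is bounded by a combination of |u| and |u'|, both
    exponents being above 1, and Gronwall applies to u^2 + u'^2, run backwards from r0. *)
Lemma vanishing_of_double_zero (r0 a : R) : 0 < a <= r0 -> u r0 = 0 -> u1 r0 = 0 -> u a = 0.
Proof.
  intros Ha H0 H1. pose proof dimension_ge as Hn. pose proof exponent_bounds as He. pose proof al_bounds as Hal.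
  assert (Hq : 0 < q_minus_1 al) by (apply Rdiv_lt_0_compat; lra).
  assert (Hbd : forall f df, (forall z, 0 < z -> is_derive f z (df z)) -> exists B, forall z, a <= z <= r0 -> Rabs (f z) <= B).
  { intros f df Hf. destruct (continuity_ab_maj (fun z => Rabs (f z)) a r0) as [z0 [Hz0 _]]; [lra| |now exists (Rabs (f z0))].
    intros z Hz. apply (continuity_pt_comp f Rabs); [|apply Rcontinuity_abs].
    eapply is_derive_continuity_pt, Hf. lra. }
  destruct (Hbd u u1) as [B0 HB0]; [intros z Hz; apply Hu, Hz|].
  destruct (Hbd u1 u2) as [B1 HB1]; [intros z Hz; apply Hu, Hz|].
  set (C1 := powa B0 (p - 1)). set (C2 := m * powa B1 (q_minus_1 al) + (INR N - 1) / a).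
  assert (HC1 : 0 <= C1) by apply powa_nonneg.
  assert (HNa : 0 <= (INR N - 1) / a) by (apply Rmult_le_pos; [lra|left; apply Rinv_0_lt_compat; lra]).
  assert (HC2 : 0 <= C2).
  { assert (0 <= m * powa B1 (q_minus_1 al)) by (apply Rmult_le_pos; [lra|apply powa_nonneg]). unfold C2; lra. }
  assert (Hu2 : forall z, a <= z <= r0 -> Rabs (u2 z) <= C1 * Rabs (u z) + C2 * Rabs (u1 z)).
  { intros z Hz. destruct (Hu z ltac:(lra)) as [_ [_ E]].
    rewrite gradient_exponent_eq in E.
    assert (EQ : powa (Rabs (u1 z)) (q_minus_1 al + 1) = powa (Rabs (u1 z)) (q_minus_1 al) * Rabs (u1 z)).
    { destruct (Req_dec (u1 z) 0) as [->|Hne].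
      - rewrite Rabs_R0, !powa_nonpos by lra. ring.
      - apply powa_S, Rabs_pos_lt, Hne. }
    rewrite EQ in E.
    assert (K1 : powa (Rabs (u z)) (p - 1) <= C1) by (apply powa_le; [lra|auto]).
    assert (K2 : powa (Rabs (u1 z)) (q_minus_1 al) <= powa B1 (q_minus_1 al)) by (apply powa_le; [lra|auto]).
    assert (K3 : (INR N - 1) / z <= (INR N - 1) / a) by (apply Rmult_le_compat_l; [lra|apply Rinv_le_contravar; lra]).
    assert (K4 : 0 <= (INR N - 1) / z) by (apply Rmult_le_pos; [lra|left; apply Rinv_0_lt_compat; lra]).
    replace (u2 z) with (- (powa (Rabs (u z)) (p - 1) * u z) +
       (m * powa (Rabs (u1 z)) (q_minus_1 al) * Rabs (u1 z) + - ((INR N - 1) / z * u1 z))) by lra.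
    eapply Rle_trans; [apply Rabs_triang|]. apply Rplus_le_compat.
    - rewrite Rabs_Ropp, Rabs_mult, (Rabs_pos_eq (powa _ _)) by apply powa_nonneg.
      apply Rmult_le_compat_r; [apply Rabs_pos|assumption].
    - eapply Rle_trans; [apply Rabs_triang|].
      rewrite Rabs_Ropp, (Rabs_mult ((INR N - 1) / z)), (Rabs_pos_eq ((INR N - 1) / z)) by assumption.
      rewrite Rabs_pos_eq by (apply Rmult_le_pos; [apply Rmult_le_pos; [lra|apply powa_nonneg]|apply Rabs_pos]).
      unfold C2. rewrite Rmult_plus_distr_r. apply Rplus_le_compat.
      + apply Rmult_le_compat_r; [apply Rabs_pos|]. apply Rmult_le_compat_l; lra.
      + apply Rmult_le_compat_r; [apply Rabs_pos|assumption]. }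
  set (G := fun z => u z * u z + u1 z * u1 z).
  assert (HG : G a = 0).
  { apply (gronwall_zero G (fun z => 2 * (u z * u1 z) + 2 * (u1 z * u2 z)) (1 + C1 + 2 * C2) a r0 r0); try lra.
    - intros z Hz. destruct (Hu z ltac:(lra)) as [D1 [D2 _]]. unfold G.
      auto_derive; [repeat split; now eexists; eassumption|].
      change (Derive (fun x => u x) z) with (Derive u z). change (Derive (fun x => u1 x) z) with (Derive u1 z).
      rewrite (is_derive_unique _ _ _ D1), (is_derive_unique _ _ _ D2). ring.
    - intros z _. pose proof (Rle_0_sqr (u z)). pose proof (Rle_0_sqr (u1 z)). unfold Rsqr, G in *. lra.
    - intros z Hz. specialize (Hu2 z Hz). unfold G.
      eapply Rle_trans; [apply Rabs_triang|]. rewrite !Rabs_mult, (Rabs_pos_eq 2) by lra.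
      assert (Q1 : Rabs (u z) * Rabs (u z) = u z * u z) by (rewrite <- Rabs_mult; apply Rabs_pos_eq, Rle_0_sqr).
      assert (Q2 : Rabs (u1 z) * Rabs (u1 z) = u1 z * u1 z) by (rewrite <- Rabs_mult; apply Rabs_pos_eq, Rle_0_sqr).
      rewrite <- Q1, <- Q2. pose proof (Rabs_pos (u z)) as P0. pose proof (Rabs_pos (u1 z)) as P1.
      set (x := Rabs (u z)) in *. set (y := Rabs (u1 z)) in *.
      assert (K : 2 * (x * y) <= x * x + y * y) by (pose proof (Rle_0_sqr (x - y)); unfold Rsqr in *; lra).
      assert (K' : y * Rabs (u2 z) <= y * (C1 * x + C2 * y)) by (apply Rmult_le_compat_l; lra).
      assert (C1 * (2 * (x * y)) <= C1 * (x * x + y * y)) by (apply Rmult_le_compat_l; lra).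
      assert (0 <= C2 * (x * x)) by (apply Rmult_le_pos; [lra|apply Rle_0_sqr]).
      lra.
    - unfold G. rewrite H0, H1. ring. }
  unfold G in HG. pose proof (Rle_0_sqr (u a)). pose proof (Rle_0_sqr (u1 a)). unfold Rsqr in *.
  apply Rsqr_0_uniq. unfold Rsqr. lra.
Qed.

End Solution.
End Exponents.

(** * From trajectories to radial solutions and back *)

Section Conclusion.
Variables (N : nat) (p M : R).
Hypothesis HN : (3 <= N)%nat.
Hypothesis Hp : INR N / (INR N - 2) < p < (INR N + 2) / (INR N - 2).
Hypothesis HM : Mbar N p <= M < 0.

Local Notation n := (INR N - 2).
Local Notation al := (2 / (p - 1)).
Local Notation m := (- M).

Let Hadm : admissible n al m. Proof. exact (parameters_admissible N p M HN Hp HM). Qed.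
Let Hn : 1 <= n. Proof. exact (dimension_ge N HN). Qed.
Let Ha : al < n < 2 * al. Proof. exact (al_bounds N p HN Hp). Qed.
Let Hp1 : 1 < p. Proof. exact (proj2 (exponent_bounds N p HN Hp)). Qed.

Definition profile (xi : R -> R) (r : R) := exp (- (al * ln r) + xi (ln r)).
Definition profile_derive (xi lam : R -> R) (r : R) := - exp (- ((al + 1) * ln r) + xi (ln r) + lam (ln r)).
(** Since u' = -exp(-(al+1) t + x + l), the logarithmic derivative r u'' / u' is -(al+1) + x' +
    l'. *)
Definition profile_derive2 (xi lam : R -> R) (r : R) :=
  profile_derive xi lam r / r * (- (al + 1) + flow_x al (lam (ln r)) + flow_l n al m (xi (ln r)) (lam (ln r))).

Lemma profile_equation (xi lam : R -> R) : (forall t, flow_at n al m 1 xi lam t) ->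
  equation N p M (profile xi) (profile_derive xi lam) (profile_derive2 xi lam).
Proof.
  intros Hf r Hr. set (t := ln r). destruct (Hf t) as [D1 D2].
  assert (Er : exp t = r) by now apply exp_ln.
  assert (E1 : profile_derive xi lam r = - (profile xi r * exp (lam t) / r)).
  { transitivity (- (profile xi r * exp (lam t) * exp (- t))); [|rewrite exp_Ropp, Er; reflexivity].
    unfold profile_derive, profile. fold t. rewrite <- !exp_plus. f_equal. f_equal. ring. }
  split; [|split].
  - rewrite E1. unfold profile. auto_derive; [repeat split; try assumption; eexists; exact D1|].
    change (Derive (fun x => xi x) (ln r)) with (Derive xi t). rewrite (is_derive_unique _ _ _ D1).
    fold t. unfold flow_x. field. lra.
  - unfold profile_derive2, profile_derive. auto_derive; [repeat split; try assumption; now eexists; eassumption|].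
    change (Derive (fun x => xi x) (ln r)) with (Derive xi t). change (Derive (fun x => lam x) (ln r)) with (Derive lam t).
    rewrite (is_derive_unique _ _ _ D1), (is_derive_unique _ _ _ D2).
    fold t. field. lra.
  - unfold profile_derive2. set (w := exp (- ((al + 1) * t) + xi t + lam t)).
    assert (Ew : profile_derive xi lam r = - w) by reflexivity. rewrite Ew.
    assert (Hw : 0 < w) by apply exp_pos.
    assert (Hu : 0 < profile xi r) by apply exp_pos.
    rewrite Rabs_Ropp, (Rabs_pos_eq w), (Rabs_pos_eq (profile xi r)) by lra.
    rewrite (gradient_exponent_eq N p HN Hp), (powa_S w) by assumption.
    rewrite (powa_pos_eq (profile xi r)), (powa_pos_eq w) by assumption.
    unfold profile, w. fold t. rewrite !ln_exp.
    unfold flow_x, flow_l. fold t.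
    assert (K1 : exp ((p - 1) * (- (al * t) + xi t)) * exp (- (al * t) + xi t)
       = exp (p_minus_1 al * xi t - lam t) * exp (- ((al + 1) * t) + xi t + lam t) / r).
    { transitivity (exp (p_minus_1 al * xi t - lam t) * exp (- ((al + 1) * t) + xi t + lam t) * exp (- t)).
      2:{ rewrite exp_Ropp, Er. reflexivity. }
      rewrite <- !exp_plus. f_equal. rewrite (p_minus_1_eq N p HN Hp). field. lra. }
    assert (K2 : exp (q_minus_1 al * (- ((al + 1) * t) + xi t + lam t)) = exp (q_minus_1 al * (xi t + lam t)) / r).
    { transitivity (exp (q_minus_1 al * (xi t + lam t)) * exp (- t)).
      2:{ rewrite exp_Ropp, Er. reflexivity. }
      rewrite <- exp_plus. f_equal. unfold q_minus_1. field. lra. }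
    rewrite K1, K2. field. lra.
Qed.

Lemma ground_state_absent (u : R -> R) : ~ ground_state N p M u.
Proof.
  intros [Hnn [[r1 [Hr1 Hur1]] [u1 [u2 [HD [L1 [L2 [_ [_ [Hu10 HE]]]]]]]]]].
  assert (Hu : equation N p M u u1 u2).
  { intros r Hr. destruct (HD r Hr) as [D1 D2]. auto. }
  assert (Hnn' : forall r, 0 < r -> 0 <= u r) by (intros; apply Hnn; lra).
  rewrite Hu10 in L1. rewrite filterlim_at_right_0 in L1, L2.
  destruct (L1 1 ltac:(lra)) as [d1 [Hd1 K1]]. destruct (L2 1 ltac:(lra)) as [d2 [Hd2 K2]].
  assert (B1 : forall r, 0 < r < d1 -> Rabs (u r - u 0) <= r).
  { intros r Hr. specialize (K1 r Hr). rewrite Rminus_0_r in K1. unfold Rdiv in K1.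
    rewrite Rabs_mult, (Rabs_pos_eq (/ r)) in K1 by (left; apply Rinv_0_lt_compat; lra).
    apply Rmult_lt_compat_r with (r := r) in K1; [|lra]. rewrite Rmult_assoc, Rinv_l in K1 by lra. lra. }
  assert (B2 : forall r, 0 < r < d2 -> Rabs (u1 r) <= (Rabs (u2 0) + 1) * r).
  { intros r Hr. specialize (K2 r Hr). rewrite Hu10, Rminus_0_r in K2.
    assert (Rabs (u1 r / r) <= Rabs (u2 0) + 1).
    { replace (u1 r / r) with (u2 0 + (u1 r / r - u2 0)) by ring. eapply Rle_trans; [apply Rabs_triang|]. lra. }
    replace (u1 r) with (u1 r / r * r) by (field; lra). rewrite Rabs_mult, (Rabs_pos_eq r) by lra.
    apply Rmult_le_compat_r; lra. }
  (* A positive value of u' would force u' > b all the way to 0, against |u'| <= (|u''(0)| + 1) r,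
     which u'(0) = 0 gives near 0. *)
  assert (Hdec : forall r, 0 < r -> u1 r <= 0).
  { intros r0 Hr0. apply Rnot_lt_le. intros Hlt.
    destruct (increasing_near_zero N p M HN Hp HM u u1 u2 Hu Hnn' r0 Hr0 Hlt) as [b [Hb Hbr]].
    pose proof (Rabs_pos (u2 0)) as Hu2.
    set (r := Rmin r0 (Rmin (d2 / 2) (b / (Rabs (u2 0) + 1)))).
    assert (Hbb : 0 < b / (Rabs (u2 0) + 1)) by (apply Rdiv_lt_0_compat; lra).
    pose proof (Rmin_l r0 (Rmin (d2 / 2) (b / (Rabs (u2 0) + 1)))) as R1.
    pose proof (Rmin_r r0 (Rmin (d2 / 2) (b / (Rabs (u2 0) + 1)))) as R2.
    pose proof (Rmin_l (d2 / 2) (b / (Rabs (u2 0) + 1))) as R3.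
    pose proof (Rmin_r (d2 / 2) (b / (Rabs (u2 0) + 1))) as R4. fold r in R1, R2.
    assert (Hr : 0 < r) by (repeat apply Rmin_glb_lt; lra).
    specialize (Hbr r ltac:(lra)). specialize (B2 r ltac:(lra)).
    assert ((Rabs (u2 0) + 1) * r <= b).
    { apply Rle_trans with ((Rabs (u2 0) + 1) * (b / (Rabs (u2 0) + 1))); [apply Rmult_le_compat_l; lra|].
      right. field. lra. }
    pose proof (Rle_abs (u1 r)). lra. }
  pose proof (solution_nonincreasing N p M u u1 u2 Hu Hdec) as Hmono.
  (* A zero at r0 makes u vanish beyond r0 by monotonicity. At r0 + 1, inside that region, u'
     vanishes as well; the double zero spreads down to 0, and u(0) = 0 by continuity. *)
  assert (Hpos : forall r, 0 < r -> 0 < u r).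
  { intros r0 Hr0. destruct (Hnn' r0 Hr0) as [|E0]; [assumption|exfalso].
    assert (Hz : forall r, r0 <= r -> u r = 0).
    { intros r Hr. pose proof (Hmono r0 r ltac:(lra)). pose proof (Hnn' r ltac:(lra)). lra. }
    assert (H1 : u1 (r0 + 1) = 0).
    { destruct (HD (r0 + 1) ltac:(lra)) as [D _]. rewrite <- (is_derive_unique _ _ _ D).
      apply is_derive_unique. apply is_derive_ext_loc with (fun _ => 0).
      - exists (mkposreal 1 Rlt_0_1). intros y Hy. symmetry. apply Hz.
        assert (Rabs (y - (r0 + 1)) < 1) as Hb by exact Hy. apply Rabs_def2 in Hb. lra.
      - apply (is_derive_const (V := R_NormedModule) 0). }
    assert (Hall : forall r, 0 < r -> u r = 0).
    { intros r Hr. destruct (Rle_lt_dec r0 r) as [|Hlt]; [now apply Hz|].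
      apply (vanishing_of_double_zero N p M HN Hp HM u u1 u2 Hu (r0 + 1) r); [lra|apply Hz; lra|assumption]. }
    apply Hur1. destruct (Rle_lt_or_eq_dec 0 r1 Hr1) as [Hlt|<-]; [now apply Hall|].
    apply cond_eq. intros e He. set (r := Rmin (d1 / 2) (e / 2)).
    pose proof (Rmin_l (d1 / 2) (e / 2)) as R1. pose proof (Rmin_r (d1 / 2) (e / 2)) as R2. fold r in R1, R2.
    assert (Hr : 0 < r) by (apply Rmin_glb_lt; lra).
    specialize (B1 r ltac:(lra)). rewrite (Hall r Hr) in B1. rewrite Rabs_minus_sym in B1. lra. }
  pose proof (strictly_decreasing N p M u u1 u2 Hu Hpos Hdec) as Hneg.
  apply (no_regular_trajectory Hadm _ _ (equation_flow N p M HN Hp u u1 u2 Hu Hpos Hneg)).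
  intros A.
  set (c0 := u 1). assert (Hc0 : 0 < c0) by (apply Hpos; lra).
  assert (Hu0 : 0 <= u 0) by (apply Hnn; lra).
  set (D := Rabs (u2 0) + 1). assert (HD0 : 0 < D) by (pose proof (Rabs_pos (u2 0)); unfold D; lra).
  (* u <= u(0) + 1 near 0 controls x through [T1]. From -u' <= D r and u >= u(1) one gets s <= D r^2
     / c0, and the square explains the division by 2 in [T2]. *)
  set (T1 := (A - ln (u 0 + 1)) / al). set (T2 := (A - ln D + ln c0) / 2).
  set (d := Rmin 1 (Rmin (d1 / 2) (d2 / 2))).
  assert (Hd : 0 < d) by (repeat apply Rmin_glb_lt; lra).
  pose proof (Rmin_l 1 (Rmin (d1 / 2) (d2 / 2))) as R1. pose proof (Rmin_r 1 (Rmin (d1 / 2) (d2 / 2))) as R2.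
  pose proof (Rmin_l (d1 / 2) (d2 / 2)) as R3. pose proof (Rmin_r (d1 / 2) (d2 / 2)) as R4. fold d in R1, R2.
  set (t := Rmin (ln d) (Rmin T1 T2)).
  pose proof (Rmin_l (ln d) (Rmin T1 T2)) as S1. pose proof (Rmin_r (ln d) (Rmin T1 T2)) as S2.
  pose proof (Rmin_l T1 T2) as S3. pose proof (Rmin_r T1 T2) as S4. fold t in S1, S2.
  set (r := exp t). assert (Hr : 0 < r) by apply exp_pos.
  assert (Hrd : r <= d) by (unfold r; rewrite <- (exp_ln d Hd); now apply exp_le_compat).
  exists t. fold r.
  specialize (B1 r ltac:(lra)). specialize (B2 r ltac:(lra)). apply Rabs_le_between in B1. fold D in B2.
  pose proof (Hmono r 1 ltac:(lra)) as Hc. fold c0 in Hc.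
  pose proof (Hneg r Hr) as Hn1. rewrite Rabs_left in B2 by assumption.
  split.
  - assert (ln (u r) <= ln (u 0 + 1)) by (apply ln_le; [apply Hpos, Hr|lra]).
    assert (al * t <= al * T1) by (apply Rmult_le_compat_l; lra).
    replace (al * T1) with (A - ln (u 0 + 1)) in H0 by (unfold T1; field; lra). lra.
  - assert (ln c0 <= ln (u r)) by (apply ln_le; lra).
    assert (ln (- u1 r) <= ln D + t).
    { rewrite <- (ln_exp t), <- ln_mult by (try apply exp_pos; assumption). apply ln_le; [lra|exact B2]. }
    assert (t <= T2) by lra. unfold T2 in H1. lra.
Qed.

(** The logarithmic variables require u' < 0. A positive u' would keep u bounded near 0, whereas u
    is equivalent to U_M, which blows up there. *)
Lemma good_solution_flow (v : R -> R) : good_solution N p M v ->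
  exists xi lam c, (forall t, flow_at n al m 1 xi lam t) /\
    (forall e, 0 < e -> exists T, forall t, T <= t -> Rabs (xi t + (n - al) * t - c) < e) /\
    (forall r, 0 < r -> v r = profile xi r).
Proof.
  intros [Hpos [[u1 [u2 Hv]] [H0 [c [Hc Hinf]]]]].
  change (equation N p M v u1 u2) in Hv.
  destruct (XM_spec N p M HN Hp HM) as [HX _].
  assert (Hdec : forall r, 0 < r -> u1 r <= 0).
  { intros r0 Hr0. apply Rnot_lt_le. intros Hlt.
    destruct (increasing_near_zero N p M HN Hp HM v u1 u2 Hv (fun r Hr => Rlt_le _ _ (Hpos r Hr)) r0 Hr0 Hlt) as [b [Hb Hbr]].
    pose proof (solution_le_of_derive_pos N p M v u1 u2 Hv b r0 Hb Hbr) as Hup.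
    unfold equiv_at_0 in H0. rewrite filterlim_at_right_0 in H0. destruct (H0 (1 / 2) ltac:(lra)) as [d [Hd K]].
    set (X := XM N p M) in *.
    (* Chosen so that X B = 2 v(r0) + X: then v > U_M / 2 >= X B / 2 near 0 exceeds v(r0). *)
    set (B := 2 * v r0 / X + 1).
    assert (HB : 0 < B).
    { assert (0 < 2 * v r0 / X) by (apply Rdiv_lt_0_compat; [specialize (Hpos r0 Hr0); lra|assumption]). unfold B; lra. }
    set (r := Rmin r0 (Rmin (d / 2) (exp (- (ln B / al))))).
    pose proof (Rmin_l r0 (Rmin (d / 2) (exp (- (ln B / al))))) as R1.
    pose proof (Rmin_r r0 (Rmin (d / 2) (exp (- (ln B / al))))) as R2.
    pose proof (Rmin_l (d / 2) (exp (- (ln B / al)))) as R3.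
    pose proof (Rmin_r (d / 2) (exp (- (ln B / al)))) as R4. fold r in R1, R2.
    assert (Hr : 0 < r) by (repeat apply Rmin_glb_lt; try apply exp_pos; lra).
    specialize (K r ltac:(lra)). apply Rabs_def2 in K. specialize (Hup r ltac:(lra)).
    assert (HBr : B <= Rpower r (- al)).
    { unfold Rpower. rewrite <- (exp_ln B HB) at 1. apply exp_le_compat.
      assert (ln r <= - (ln B / al)) by (rewrite <- (ln_exp (- _)); apply ln_le; lra).
      apply Rmult_le_compat_l with (r := al) in H; [|lra].
      replace (al * - (ln B / al)) with (- ln B) in H by (field; lra). lra. }
    assert (HU : X * B <= UM N p M r) by (change (X * B <= X * Rpower r (- al)); apply Rmult_le_compat_l; lra).
    assert (HXB : X * B = 2 * v r0 + X) by (unfold B; field; lra).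
    pose proof (Hpos r0 Hr0) as Hv0.
    assert (K2 : 1 / 2 * UM N p M r < v r).
    { replace (v r) with (v r / UM N p M r * UM N p M r) by (field; lra). apply Rmult_lt_compat_r; lra. }
    lra. }
  pose proof (strictly_decreasing N p M v u1 u2 Hv Hpos Hdec) as Hneg.
  exists (fun t => al * t + ln (v (exp t))), (fun t => t + ln (- u1 (exp t)) - ln (v (exp t))), (ln c).
  split; [exact (equation_flow N p M HN Hp v u1 u2 Hv Hpos Hneg)|]. split.
  - intros e He. unfold equiv_at_infty in Hinf. rewrite filterlim_p_infty in Hinf.
    destruct (ln_near_one e He) as [d [Hd Hln]]. destruct (Hinf d ltac:(lra)) as [B K].
    exists (ln (Rmax 1 (B + 1))). intros t Ht.
    pose proof (Rmax_l 1 (B + 1)). pose proof (Rmax_r 1 (B + 1)).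
    assert (Hb : B < exp t).
    { apply exp_le_compat in Ht. rewrite exp_ln in Ht by lra. lra. }
    specialize (Hln _ (K _ Hb)).
    pose proof (Hpos (exp t) (exp_pos t)) as Hvt.
    assert (Hden : 0 < c * Rpower (exp t) (2 - INR N)) by (apply Rmult_lt_0_compat; [assumption|apply exp_pos]).
    rewrite ln_div, (ln_mult c) in Hln by (try apply exp_pos; assumption).
    unfold Rpower in Hln. rewrite !ln_exp in Hln.
    replace (al * t + ln (v (exp t)) + (n - al) * t - ln c) with (ln (v (exp t)) - (ln c + (2 - INR N) * t)) by ring.
    exact Hln.
  - intros r Hr. unfold profile. rewrite exp_ln by assumption.
    replace (- (al * ln r) + (al * ln r + ln (v r))) with (ln (v r)) by ring. symmetry. apply exp_ln. now apply Hpos.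
Qed.

Lemma exp_near_zero (e : R) : 0 < e -> exists d, 0 < d /\ forall y, Rabs y < d -> Rabs (exp y - 1) < e.
Proof.
  intros He.
  assert (Hc : continuity_pt exp 0) by (apply derivable_continuous_pt, derivable_pt_exp).
  destruct (proj1 (continuity_pt_locally _ _) Hc (mkposreal e He)) as [d Hd].
  exists d. split; [apply cond_pos|]. intros y Hy. rewrite <- exp_0. apply Hd.
  change (Rabs (y - 0) < d). now rewrite Rminus_0_r.
Qed.

Lemma profile_good (xi lam : R -> R) (c : R) : (forall t, flow_at n al m 1 xi lam t) ->
  (forall e, 0 < e -> exists T, forall t, T <= t -> Rabs (xi t + (n - al) * t - c) < e) ->
  (forall e, 0 < e -> exists T, forall t, t <= T -> Rabs (xi t - ln (XM N p M)) < e) ->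
  good_solution N p M (profile xi).
Proof.
  intros Hf Hinf H0. destruct (XM_spec N p M HN Hp HM) as [HX _].
  split; [intros; apply exp_pos|]. split; [|split].
  - exists (profile_derive xi lam), (profile_derive2 xi lam). now apply profile_equation.
  - unfold equiv_at_0. rewrite filterlim_at_right_0. intros e He.
    destruct (exp_near_zero e He) as [d [Hd K]]. destruct (H0 d Hd) as [T HT].
    exists (exp T). split; [apply exp_pos|]. intros r Hr.
    assert (Ht : ln r <= T) by (rewrite <- (ln_exp T); apply ln_le; lra).
    specialize (K _ (HT _ Ht)).
    replace (profile xi r / UM N p M r) with (exp (xi (ln r) - ln (XM N p M))); [assumption|].
    unfold profile, UM, Rpower. unfold Rdiv at 1. rewrite <- (exp_ln (XM N p M)) at 2 by assumption.
    rewrite <- exp_plus, <- exp_Ropp, <- exp_plus. f_equal. ring.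
  - exists (exp c). split; [apply exp_pos|]. unfold equiv_at_infty. rewrite filterlim_p_infty. intros e He.
    destruct (exp_near_zero e He) as [d [Hd K]]. destruct (Hinf d Hd) as [T HT].
    exists (exp T). intros r Hr.
    assert (Ht : T <= ln r) by (rewrite <- (ln_exp T); apply ln_le; [apply exp_pos|lra]).
    specialize (K _ (HT _ Ht)).
    replace (profile xi r / (exp c * Rpower r (2 - INR N))) with (exp (xi (ln r) + (n - al) * ln r - c)); [assumption|].
    unfold profile, Rpower. rewrite <- exp_plus.
    transitivity (exp (- (al * ln r) + xi (ln r)) * exp (- (c + (2 - INR N) * ln r))).
    + rewrite <- exp_plus. f_equal. ring.
    + now rewrite (exp_Ropp (c + (2 - INR N) * ln r)).
Qed.

(** Translating t = ln r by h is the similarity with k = exp h, so uniqueness up to translation of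
    trajectories becomes uniqueness up to scaling. *)
Lemma profile_shift (xi : R -> R) (h r : R) : 0 < r ->
  profile (fun t => xi (t + h)) r = Rpower (exp h) al * profile xi (exp h * r).
Proof.
  intros Hr. unfold profile, Rpower. rewrite ln_mult, !ln_exp by (try apply exp_pos; assumption).
  rewrite <- exp_plus. rewrite (Rplus_comm h). f_equal. ring.
Qed.

End Conclusion.

Theorem theorem4p12 (N : nat) (p M : R) :
  (3 <= N)%nat ->
  INR N / (INR N - 2) < p < (INR N + 2) / (INR N - 2) ->
  Mbar N p <= M < 0 ->
  (forall u : R -> R, ~ ground_state N p M u) /\
  (exists u : R -> R,
     good_solution N p M u /\
     forall v : R -> R, good_solution N p M v ->
       exists k, 0 < k /\ forall r, 0 < r -> v r = Rpower k (2 / (p - 1)) * u (k * r)).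
Proof.
  intros HN Hp HM. split; [intros u; now apply ground_state_absent|].
  pose proof (parameters_admissible N p M HN Hp HM) as Hadm.
  destruct (stable_trajectory Hadm) as [xi [lam [c [Hf [Hinf H0]]]]].
  exists (profile p xi). split.
  - apply (profile_good N p M HN Hp HM xi lam c Hf Hinf).
    exact (H0 _ (proj2 (XM_spec N p M HN Hp HM))).
  - intros v Hv. destruct (good_solution_flow N p M HN Hp HM v Hv) as [xv [lv [cv [Hfv [Hinfv Ev]]]]].
    destruct (stable_unique Hadm xi lam xv lv c cv Hf Hfv Hinf Hinfv) as [h Hh].
    exists (exp h). split; [apply exp_pos|]. intros r Hr.
    rewrite Ev by assumption. rewrite <- profile_shift by assumption.
    unfold profile. now rewrite (proj1 (Hh (ln r))).
Qed.
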